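(* Let $a:\mathbb{R}^n\times\mathbb{R}^n\to\mathbb{C}$ be a symbol such that $a(x,\cdot)\in L^1_{loc}(\mathbb{R}^n)$ for a.e. $x\in\mathbb{R}^n$. Let $2\leq p_1<\infty$, $1\leq p_2<\infty$, and let $F$ be the Fourier integral operator with phase function $\phi$ associated to $a$, that is, $Ff(x)=\int_{\mathbb{R}^n}e^{i\phi(x,\xi)}a(x,\xi)(\mathscr{F}f)(\xi)\,d\xi$. If $F:L^{p_1}(\mathbb{R}^n)\rightarrow L^{p_2}(\mathbb{R}^n)$ is nuclear, then $$\left(\int_{\mathbb{R}^n}\left(\int_{\mathbb{R}^n}|a(x,\xi)|^{p_2}dx\right)^{\frac{p_1}{p_2}}d\xi\right)^{\frac{1}{p_1}}<\infty$$ and $$\left(\int_{\mathbb{R}^n}\left(\int_{\mathbb{R}^n}|a(x,\xi)|^{p_1}d\xi\right)^{\frac{p_2}{p_1}}dx\right)^{\frac{1}{p_2}}<\infty.$$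
   Context: The symbol $a$ is measurable on $\mathbb{R}^n\times\mathbb{R}^n$ and the phase function $\phi:\mathbb{R}^n\times\mathbb{R}^n\to\mathbb{R}$ is a measurable real-valued function. The Fourier transform is $(\mathscr{F}f)(\xi)=\int_{\mathbb{R}^n}e^{-i2\pi x\cdot\xi}f(x)\,dx$. The operator $F$ is given by the formula in the claim for $f\in\mathscr{D}(\mathbb{R}^n)=C_c^\infty(\mathbb{R}^n)$ and is regarded as a densely defined operator on $L^{p_1}(\mathbb{R}^n)$. For Banach spaces $E_1,E_2$, a densely defined linear operator $T:D(T)\subset E_1\to E_2$ is said to be (to extend to) a nuclear operator from $E_1$ into $E_2$ if there exist sequences $(e_n')$ in the dual $E_1'$ and $(y_n)$ in $E_2$ such that $Tf=\sum_{n} e_n'(f)y_n$ for all $f\in D(T)$ and $\sum_{n}\Vert e_n'\Vert_{E_1'}\Vert y_n\Vert_{E_2}<\infty$. *)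

(* Defs.v *)
From HB Require Import structures.
From mathcomp Require Import all_boot all_order all_algebra.
From mathcomp Require Import all_classical all_reals all_analysis.
From mathcomp Require Import measurable_realfun complex.

Set Implicit Arguments.
Unset Strict Implicit.
Unset Printing Implicit Defensive.

Import Order.TTheory GRing.Theory Num.Theory.
Import numFieldNormedType.Exports.

Local Open Scope classical_set_scope.
Local Open Scope complex_scope.
Local Open Scope ring_scope.

Local Notation normc := ComplexField.Normc.normc.

(* For [T = R] the sigma-algebra generated by the coordinates is the Borel
   sigma-algebra of R^n. *)
Section borel_rV.
Context {d} {T : measurableType d} (n : nat).

Let coord (i : 'I_n) (v : 'rV[T]_n) : T := v ord0 i.

Let rV_set0 : g_sigma_preimage coord set0.
Proof. exact: sigma_algebra0. Qed.

Let rV_setC A : g_sigma_preimage coord A -> g_sigma_preimage coord (~` A).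
Proof. exact: sigma_algebraC. Qed.

Let rV_bigcup (F : (set 'rV[T]_n)^nat) : (forall i, g_sigma_preimage coord (F i)) ->
  g_sigma_preimage coord (\bigcup_i (F i)).
Proof. exact: sigma_algebra_bigcup. Qed.

HB.instance Definition _ := @isMeasurable.Build (measure_tuple_display d)
  'rV[T]_n (g_sigma_preimage coord) rV_set0 rV_setC rV_bigcup.

Lemma measurable_coord i : measurable_fun [set: 'rV[T]_n] (coord i).
Proof.
move=> _ Y mY; rewrite setTI; apply: sub_sigma_algebra => /=.
rewrite -bigcup_seq/=; exists i => /=; first by rewrite mem_index_enum.
by exists Y => //; rewrite setTI.
Qed.

Lemma measurable_fun_rVP d' (S : measurableType d') (f : S -> 'rV[T]_n) :
  measurable_fun [set: S] f <->
  forall i, measurable_fun [set: S] (fun x => f x ord0 i).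
Proof.
split=> [mf i|mf].
  exact: (measurableT_comp (measurable_coord i)).
move=> _ A mA; rewrite setTI.
suff : g_sigma_preimage coord `<=` [set B | measurable (f @^-1` B)] by exact.
apply: smallest_sub.
  split=> /=.
  - by rewrite preimage_set0.
  - by move=> B mB; rewrite setTD preimage_setC; exact: measurableC.
  - by move=> F mF; rewrite preimage_bigcup; exact: bigcupT_measurable.
rewrite -bigcup_seq => B [i _ [C mC <-]] /=.
rewrite setTI -comp_preimage.
by have := mf i measurableT C mC; rewrite setTI.
Qed.
End borel_rV.

Section lebesgue_rV.
Context {R : realType}.

Section cons.
Variable n : nat.

(* [measurableTypeR R] is [R] with its Borel sets, in the form in which the
   library defines [lebesgue_measure]. *)
Definition rV_cons (z : measurableTypeR R * 'rV[R]_n) : 'rV[R]_n.+1 :=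
  \row_i oapp (z.2 ord0) z.1 (unlift ord0 i).

Definition rV_uncons (v : 'rV[R]_n.+1) : measurableTypeR R * 'rV[R]_n :=
  (v ord0 ord0, \row_j v ord0 (lift ord0 j)).

Lemma rV_consK : cancel rV_cons rV_uncons.
Proof.
move=> [x v]; rewrite /rV_cons /rV_uncons; congr pair.
  by rewrite mxE unlift_none.
by apply/rowP => j; rewrite !mxE liftK.
Qed.

Lemma measurable_rV_cons : measurable_fun [set: measurableTypeR R * 'rV[R]_n] rV_cons.
Proof.
apply/measurable_fun_rVP => i.
under [X in measurable_fun _ X]eq_fun do rewrite mxE.
case: (unlift ord0 i) => [j|] /=; last exact: measurable_fst.
exact: (measurableT_comp (measurable_coord j)).
Qed.

Lemma measurable_rV_uncons : measurable_fun [set: 'rV[R]_n.+1] rV_uncons.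
Proof.
apply/measurable_fun_pairP; split => /=; first exact: measurable_coord.
apply/measurable_fun_rVP => i.
under [X in measurable_fun _ X]eq_fun do rewrite mxE.
exact: measurable_coord.
Qed.

Variable mu : {sigma_finite_measure set 'rV[R]_n -> \bar R}.

Definition lebesgue_cons : set 'rV[R]_n.+1 -> \bar R :=
  pushforward (lebesgue_measure \x mu)%E rV_cons.

Let lebesgue_cons0 : lebesgue_cons set0 = 0%E.
Proof. by rewrite /lebesgue_cons /pushforward preimage_set0 measure0. Qed.

Let measurable_preimage_cons A : measurable A -> measurable (rV_cons @^-1` A).
Proof. by move=> mA; rewrite -[X in measurable X]setTI; exact: measurable_rV_cons. Qed.

Let lebesgue_cons_ge0 A : (0 <= lebesgue_cons A)%E.
Proof. exact: integral_ge0. Qed.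

Let lebesgue_cons_sigma_additive : semi_sigma_additive lebesgue_cons.
Proof.
move=> F mF tF mUF; rewrite /lebesgue_cons /pushforward preimage_bigcup.
apply: measure_semi_sigma_additive.
- by move=> k; exact: measurable_preimage_cons.
- apply/trivIsetP => /= i j _ _ ij; rewrite -preimage_setI.
  by move/trivIsetP : tF => /(_ _ _ _ _ ij) ->//; rewrite preimage_set0.
- by rewrite -preimage_bigcup; exact: measurable_preimage_cons.
Qed.

HB.instance Definition _ := isMeasure.Build _ _ _ lebesgue_cons
  lebesgue_cons0 lebesgue_cons_ge0 lebesgue_cons_sigma_additive.

Let lebesgue_cons_sigma_finite : sigma_finite setT lebesgue_cons.
Proof.
have /sigma_finiteP[F [TF ndF Foo]] := sigma_finiteT (@lebesgue_measure R).
have /sigma_finiteP[G [TG ndG Goo]] := sigma_finiteT mu.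
exists (fun k => rV_uncons @^-1` (F k `*` G k)) => [|k].
  rewrite predeqE => v; split => // _.
  have [i _ Fi] : (\bigcup_i F i) (rV_uncons v).1 by rewrite -TF.
  have [j _ Gj] : (\bigcup_i G i) (rV_uncons v).2 by rewrite -TG.
  exists (maxn i j) => //; split.
  - by move: Fi; exact/subsetPset/ndF/leq_maxl.
  - by move: Gj; exact/subsetPset/ndG/leq_maxr.
have [mF Fk] := Foo k; have [mG Gk] := Goo k; split.
  rewrite -[X in measurable X]setTI.
  by apply: measurable_rV_uncons => //; exact: measurableX.
rewrite /lebesgue_cons /pushforward -comp_preimage.
rewrite (_ : rV_uncons \o rV_cons = id); last first.
  by apply/funext => z; exact: rV_consK.
by rewrite preimage_id product_measure1E// lte_mul_pinfty// ge0_fin_numE.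
Qed.

HB.instance Definition _ := Measure_isSigmaFinite.Build _ _ _ lebesgue_cons
  lebesgue_cons_sigma_finite.

End cons.

Fixpoint lebesgue_rV n : {sigma_finite_measure set 'rV[R]_n -> \bar R} :=
  match n with
  | 0 => [the {sigma_finite_measure set 'rV[R]_0 -> \bar R} of
           dirac (0 : 'rV[R]_0)]
  | m.+1 => [the {sigma_finite_measure set 'rV[R]_m.+1 -> \bar R} of
              lebesgue_cons (lebesgue_rV m)]
  end.

End lebesgue_rV.

Section complex_integral.
Context d (T : measurableType d) (R : realType).
Variable mu : {measure set T -> \bar R}.
Implicit Types f : T -> R[i].

(* Measurability with respect to the completion of the sigma-algebra of [T] for
   [mu]; when [T] carries its Borel sets this is Lebesgue measurability. *)
Definition completed_measurable_fun (g : T -> R) : Prop :=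
  forall B : set R, measurable B -> completed_algebra_gen mu (g @^-1` B).

Definition cmeasurable f : Prop :=
  completed_measurable_fun (fun x => complex.Re (f x)) /\
  completed_measurable_fun (fun x => complex.Im (f x)).

(* The integral of a nonnegative function is the supremum of the integrals of
   the simple measurable functions below it, so on completed-measurable
   integrands it agrees with integration against the completion of [mu]. *)
Definition cintegrable f : Prop :=
  cmeasurable f /\ (\int[mu]_x (normc (f x))%:E < +oo)%E.

Definition cintegral f : R[i] :=
  Complex (\int[mu]_x complex.Re (f x)) (\int[mu]_x complex.Im (f x)).

Definition Lp_norm (p : R) f : \bar R :=
  Lnorm mu p%:E (fun x => (normc (f x))%:E).

Definition Lp (p : R) : set (T -> R[i]^o) :=
  [set f | cmeasurable f /\ (Lp_norm p f < +oo)%E].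

End complex_integral.

(* A Banach space is presented as a set [E] of vectors with a seminorm [N], the
   vectors at distance [0] being identified (as in the L^p spaces). *)
Section nuclear.
Context {R : realType}.

Section dual.
Context {V : lmodType R[i]} (E : set V) (N : V -> \bar R).

Definition dual : set (V -> R[i]) :=
  [set l | (forall (c : R[i]) (u v : V), E u -> E v ->
              l (c *: u + v) = c * l u + l v) /\
           exists M : R, forall v, E v -> ((normc (l v))%:E <= M%:E * N v)%E].

Definition dual_norm (l : V -> R[i]) : \bar R :=
  ereal_sup [set (normc (l v))%:E | v in [set v | E v /\ (N v <= 1)%E]].

End dual.

Definition nuclear {V1 V2 : lmodType R[i]}
    (E1 : set V1) (N1 : V1 -> \bar R) (E2 : set V2) (N2 : V2 -> \bar R)
    (D : set V1) (T : V1 -> V2) : Prop :=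
  (forall f, D f -> E2 (T f)) /\
  exists (e' : nat -> V1 -> R[i]) (y : nat -> V2),
    [/\ forall k, dual E1 N1 (e' k),
        forall k, E2 (y k),
        (\sum_(0 <= k <oo) (dual_norm E1 N1 (e' k) * N2 (y k)) < +oo)%E &
        forall f, D f ->
          N2 (T f - \sum_(0 <= k < m) e' k f *: y k) @[m --> \oo] --> 0%E].

End nuclear.

Section fourier_integral_operator.
Context {R : realType} {n : nat}.
Local Notation leb := (@lebesgue_rV R n).

Definition dot (x y : 'rV[R]_n) : R := \sum_i x ord0 i * y ord0 i.

Definition expi (t : R) : R[i] := cos t +i* sin t.

Definition iter_partial (s : seq 'I_n) (g : 'rV[R]_n -> R) : 'rV[R]_n -> R :=
  foldr (fun i h => 'D_(delta_mx ord0 i) h) g s.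

Definition smooth (g : 'rV[R]_n -> R) : Prop :=
  forall s : seq 'I_n, continuous (iter_partial s g) /\
    forall x i, derivable (iter_partial s g) x (delta_mx ord0 i).

Definition test_function : set ('rV[R]_n -> R[i]^o) :=
  [set f | [/\ smooth (fun x => complex.Re (f x)),
               smooth (fun x => complex.Im (f x)) &
               compact (closure [set x | f x != 0])]].

Definition fourier (f : 'rV[R]_n -> R[i]) (xi : 'rV[R]_n) : R[i] :=
  cintegral leb (fun x => expi (- (2 * pi * dot x xi)) * f x).

Definition locally_cintegrable (f : 'rV[R]_n -> R[i]) : Prop :=
  cmeasurable leb f /\
  forall K : set 'rV[R]_n, compact K ->
    (\int[leb]_(x in K) (normc (f x))%:E < +oo)%E.

Variables (phi : 'rV[R]_n -> 'rV[R]_n -> R) (a : 'rV[R]_n -> 'rV[R]_n -> R[i]).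

Definition fio_integrand (f : 'rV[R]_n -> R[i]) (x xi : 'rV[R]_n) : R[i] :=
  expi (phi x xi) * a x xi * fourier f xi.

Definition fio (f : 'rV[R]_n -> R[i]^o) : 'rV[R]_n -> R[i]^o :=
  fun x => cintegral leb (fio_integrand f x).

(* For [a x] merely locally integrable the integral defining [fio f x] need not
   converge, since [fourier f] is not compactly supported. *)
Definition fio_well_defined : Prop :=
  forall f, test_function f ->
    {ae leb, forall x, cintegrable leb (fio_integrand f x)}.

Definition nuclear_fio (p1 p2 : R) : Prop :=
  fio_well_defined /\
  nuclear (Lp leb p1) (Lp_norm leb p1) (Lp leb p2) (Lp_norm leb p2)
    test_function fio.

End fourier_integral_operator.

(* Main.v *)
Require Import Defs.
From mathcomp Require Import all_boot all_order all_algebra.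
From mathcomp Require Import all_classical all_reals all_analysis.
From mathcomp Require Import measurable_realfun complex ring lra.

(* Fix a bump v >= 0 and test F on the functions f_j obtained by averaging the
   modulated translates e((b - b').j/K) v(. - (b - b')/S) over b, b' in [0, K)^n.
   The Fourier transform of f_j is that of v times a Fejer kernel centred at the
   j-th point of a grid of step S^-2, so F f_j(x) is, up to a factor S^n, an
   average of a(x, .) e^(i phi(x, .)) v^ around that point.  If F = sum_k e'_k y_k
   then |F f_j(x)| <= sum_k |e'_k(f_j)| |y_k(x)|, and the l^p1 norm of
   j |-> e'_k(f_j) is bounded by the norm of e'_k: by duality this is a bound on
   the L^p1 norm of sum_j c_j f_j in terms of the l^p1' norm of c, which is the
   Hausdorff-Young inequality of the discrete Fourier transform (p1 >= 2).
   Minkowski's inequality bounds both mixed norms of the majorant, uniformly in S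
   and in the scale of v.  Letting S tend to infinity while v shrinks to a point,
   Fatou's lemma transfers the bound to a. *)

Set Implicit Arguments.
Unset Strict Implicit.
Unset Printing Implicit Defensive.

Import Order.TTheory GRing.Theory Num.Theory.
Import numFieldNormedType.Exports.

Local Open Scope classical_set_scope.
Local Open Scope ring_scope.

Local Notation normc := ComplexField.Normc.normc.
Local Notation e t := (expi (2 * pi * t)).

(** If e'_k were integration against g_k in L^p1', then e^(i phi) a would be the sum over k of
    y_k(x) times the inverse Fourier transform of g_k at xi, and Hausdorff-Young would put that
    transform in L^p1. The packets carry this out at finite resolution, where only finite sequences
    are dualised and transformed. The average runs over two indices because a single sum over b
    yields the Dirichlet kernel. The Fejer kernel is nonnegative, has constant mass over a period
    and constant sum over the grid, so averaging against it contracts L^1 and converges for every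
    integrable function. For fixed b' a combination of the f_j is still a sum of translates whose
    coefficients are a discrete Fourier transform, so the second average costs nothing in the
    estimate. Two limits compete. The Fourier transform of v has size about m^-n when v has width
    1/m, so recovering a multiplies the averaging error by m^n; hence S is chosen as a function of
    m, large enough to beat this factor. The bounds survive because all powers of S and m cancel;
    the Hausdorff-Young constant only has to be finite. *)

Lemma eq_leW d (T : porderType d) (x y : T) : x = y -> (x <= y)%O.
Proof. by move=> ->. Qed.

(** * The complex modulus *)

Section normc.
Context {R : realType}.
Implicit Types z w : R[i].

Lemma normc_ge0 z : 0 <= normc z.
Proof. by case: z => x y; exact: sqrtr_ge0. Qed.

Lemma normcM z w : normc (z * w) = normc z * normc w.
Proof. exact: ComplexField.Normc.normcM. Qed.

Lemma ler_normcD z w : normc (z + w) <= normc z + normc w.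
Proof. exact: le_normcD. Qed.

Lemma ler_normc_sum (I : Type) (r : seq I) (P : pred I) (F : I -> R[i]) :
  normc (\sum_(i <- r | P i) F i) <= \sum_(i <- r | P i) normc (F i).
Proof.
elim/big_ind2 : _ => [|z x w y zx wy|//]; first by rewrite ComplexField.Normc.normc0.
by rewrite (le_trans (ler_normcD _ _))// lerD.
Qed.

Lemma sqr_normcE z : normc z ^+ 2 = complex.Re z ^+ 2 + complex.Im z ^+ 2.
Proof. by case: z => x y; rewrite sqr_sqrtr// addr_ge0// sqr_ge0. Qed.

End normc.

Lemma normcN (R : realType) (z : R[i]) : normc (- z) = normc z.
Proof. by case: z => x y /=; rewrite !sqrrN. Qed.

(** * The Hausdorff-Young inequality for finite matrices *)

Lemma conjugateE (R : realType) (p q : R) : 2 < q -> p^-1 + q^-1 = 1 ->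
  1 < p /\ p * (q - 1) = q.
Proof.
move=> q2 pq.
have q0 : q != 0 by rewrite gt_eqF//; lra.
have p0 : p != 0.
  apply/eqP => p0; move: pq; rewrite p0 invr0 add0r => q1.
  have : q = 1 by rewrite -[q]invrK q1 invr1.
  lra.
have pqE : p * (q - 1) = q.
  have : p * q * (p^-1 + q^-1) = p * q by rewrite pq mulr1.
  have -> : p * q * (p^-1 + q^-1) = p + q by field; rewrite q0.
  by move=> h; lra.
by split => //; nra.
Qed.

(** A coefficient with t |c_j|^(p-1) > 2 satisfies |c_j| <= (t/2) |c_j|^p, so all of these together
    contribute at most t/2 to any value of U c, the entries of U being at most 1. Where U c exceeds
    t, the remaining coefficients therefore give a value of at least t/2, and Chebyshev's inequality
    with the l^2 bound counts such places; 4 is the square of the lost factor 2. *)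
Lemma weak_type_count (R : realType) (I J : finType) (U : I -> J -> R[i]) (L p : R)
    (c : J -> R[i]) (t : R) : 1 < p -> 0 < t ->
    (forall b j, normc (U b j) <= 1) ->
    (forall c : J -> R[i],
      \sum_b normc (\sum_j U b j * c j) ^+ 2 <= L * \sum_j normc (c j) ^+ 2) ->
    \sum_j normc (c j) `^ p <= 1 ->
  t ^+ 2 * (\sum_(b | t < normc (\sum_j U b j * c j)) 1) <=
  4 * L * \sum_(j | t * normc (c j) `^ (p - 1) <= 2) normc (c j) ^+ 2.
Proof.
move=> p_gt1 t0 U1 U2 c1.
pose P j := t * normc (c j) `^ (p - 1) <= 2.
pose small j := if P j then c j else 0.
have small2 : \sum_j normc (small j) ^+ 2 = \sum_(j | P j) normc (c j) ^+ 2.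
  rewrite [RHS]big_mkcond/=; apply: eq_bigr => j _; rewrite /small.
  by case: ifPn => // _; rewrite ComplexField.Normc.normc0 expr0n.
rewrite -/P -small2 -mulrA.
apply: (@le_trans _ _ (4 * \sum_b normc (\sum_j U b j * small j) ^+ 2)); last first.
  by rewrite ler_wpM2l.
rewrite mulr_sumr [X in X <= _]big_mkcond/= mulr_sumr; apply: ler_sum => b _.
case: ifPn => [tb|_]; last by rewrite mulr_ge0// sqr_ge0.
have large : normc (\sum_(j | ~~ P j) U b j * c j) <= t / 2.
  rewrite (le_trans (ler_normc_sum _ _ _))//.
  apply: (@le_trans _ _ (t / 2 * \sum_j normc (c j) `^ p)); last first.
    by rewrite ler_piMr// divr_ge0// ltW.
  rewrite mulr_sumr [X in _ <= X](bigID P)/= ler_wpDl//.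
    by apply: sumr_ge0 => j _; rewrite mulr_ge0 ?powR_ge0// divr_ge0// ltW.
  apply: ler_sum => j /=; rewrite /P -ltNge => cj.
  rewrite normcM (@le_trans _ _ (normc (c j)))//.
    by rewrite ler_piMl// normc_ge0.
  rewrite -(@mulr_powRB1 _ (normc (c j)) p) ?normc_ge0//; last lra.
  by have := normc_ge0 (c j); nra.
have : \sum_j U b j * c j = \sum_j U b j * small j + \sum_(j | ~~ P j) U b j * c j.
  rewrite [LHS](bigID P)/=; congr (_ + _).
  rewrite [LHS]big_mkcond/=; apply: eq_bigr => j _.
  by rewrite /small; case: ifPn => // _; rewrite mulr0.
move=> E; have := ler_normcD (\sum_j U b j * small j) (\sum_(j | ~~ P j) U b j * c j).
rewrite -E; set x : R := normc (\sum_j U b j * small j).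
set y : R := normc (\sum_j U b j * c j) in tb *.
rewrite mulr1 => h; have tx : t / 2 <= x by lra.
nra.
Qed.

(* The levels at most [X] among the dyadic ones form a geometric progression. *)
Lemma sum_dyadic_le (R : realType) (T X r : R) (N : nat) : 0 <= T -> 0 <= X -> 0 < r ->
  \sum_(i < N | T * 2^-1 ^+ i <= X) (T * 2^-1 ^+ i) `^ r <=
    X `^ r / (1 - 2 `^ (- r)).
Proof.
move=> T0 X0 r0.
have k1 : 0 < 1 - 2 `^ (- r) :> R.
  have h : 1 `^ r < 2 `^ r :> R by rewrite gt0_ltr_powR ?nnegrE// ltrDl.
  by rewrite subr_gt0 powRN invf_lt1 ?powR_gt0//; rewrite powR1 in h.
have half x : 0 <= x -> (x * 2^-1) `^ r = x `^ r * 2 `^ (- r).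
  by move=> x0; rewrite powRM// -powR_inv1// -powRrM mulN1r.
elim: N T X T0 X0 => [|N IH] T X T0 X0.
  by rewrite big_ord0 divr_ge0 ?powR_ge0// ltW.
have [TX|XT] := leP T X; last first.
  rewrite big_mkcond big_ord_recl/= expr0 mulr1 (lt_geF XT) add0r.
  have := IH (T / 2) X; rewrite divr_ge0// => /(_ isT X0); apply: le_trans.
  rewrite -big_mkcond/=; apply: eq_leW.
  by apply: eq_big => [i|i _]; rewrite /bump/= add1n exprS mulrA.
rewrite big_mkcond big_ord_recl/= expr0 mulr1 TX.
apply: (@le_trans _ _ (T `^ r + T `^ r * 2 `^ (- r) / (1 - 2 `^ (- r)))).
  rewrite lerD2l -half//.
  apply: (@le_trans _ _ (\sum_(i < N | T / 2 * 2^-1 ^+ i <= T / 2) (T / 2 * 2^-1 ^+ i) `^ r)).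
    rewrite -big_mkcond/= [X in _ <= X]big_mkcond/= [X in X <= _]big_mkcond/=.
    apply: ler_sum => i _; rewrite /bump/= add1n exprS mulrA.
    rewrite [X in _ <= if X then _ else _](_ : _ = true).
      by case: ifP => // _; exact: powR_ge0.
    apply/idP; rewrite ler_piMr ?divr_ge0// exprn_ile1//; lra.
  by apply: IH; rewrite divr_ge0.
rewrite (_ : _ + _ = T `^ r / (1 - 2 `^ (- r))).
  by apply: ler_wpM2r; rewrite ?invr_ge0 ?ge0_ler_powR ?nnegrE// ltW.
by field; rewrite gt_eqF.
Qed.

(** The 4 comes from [weak_type_count], 2^q from passing between consecutive dyadic levels, and
    2^(q-2) from the threshold 2 on t |c_j|^(p-1). The denominator sums the geometric series of
    [sum_dyadic_le] for r = q - 2. *)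
Definition HY_const (R : realType) (q : R) : R :=
  4 * 2 `^ q * 2 `^ (q - 2) / (1 - 2 `^ (- (q - 2))).

Lemma HY_const_ge0 (R : realType) (q : R) : 2 < q -> 0 <= HY_const q.
Proof.
move=> q2; rewrite /HY_const divr_ge0 ?mulr_ge0 ?powR_ge0//.
rewrite subr_ge0 powRN invf_le1 ?powR_gt0//.
have h : 2 `^ 0 <= 2 `^ (q - 2) :> R by rewrite ler_powR ?ler1n// subr_ge0 ltW.
by rewrite powRr0 in h.
Qed.

Lemma powRX (R : realType) (x r : R) (N : nat) : 0 <= x ->
  (x ^+ N) `^ r = (x `^ r) ^+ N.
Proof. by move=> x0; rewrite -powR_mulrn// powRAC powR_mulrn// powR_ge0. Qed.

(* Marcinkiewicz-style interpolation between the trivial l^1 -> l^oo bound and the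
   l^2 bound: the values of U c are split along dyadic levels, where
   [weak_type_count] applies.  The constant blows up as q decreases to 2. *)
Lemma hausdorff_young_normalized (R : realType) (I J : finType) (U : I -> J -> R[i])
    (L p q : R) (c : J -> R[i]) : 2 < q -> p^-1 + q^-1 = 1 -> 0 <= L ->
    (forall b j, normc (U b j) <= 1) ->
    (forall c : J -> R[i],
      \sum_b normc (\sum_j U b j * c j) ^+ 2 <= L * \sum_j normc (c j) ^+ 2) ->
  \sum_j normc (c j) `^ p <= 1 ->
  \sum_b normc (\sum_j U b j * c j) `^ q <=
    HY_const q * L * \sum_j normc (c j) `^ p.
Proof.
move=> q2 pq L0 U1 U2 c1; have [p_gt1 pE] := conjugateE q2 pq.
have q_gt0 : 0 < q by lra.
pose d b : R := normc (\sum_j U b j * c j).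
have d0 b : 0 <= d b by exact: normc_ge0.
(* The top level must dominate every value [d b]; the 1 keeps it positive. *)
pose T : R := 1 + \sum_b d b.
have T0 : 0 < T by rewrite ltr_pwDl// sumr_ge0.
have dT b : d b <= T by rewrite /T (bigD1 b)//= addrCA lerDl addr_ge0// sumr_ge0.
pose t i : R := T * 2^-1 ^+ i.
have t0 i : 0 < t i by rewrite mulr_gt0// exprn_gt0.
have t2 i : t i = 2 * t i.+1 by rewrite /t exprS; field.
(* Since 2^q t_(i+1)^q = t_i^q, lowering the floor from t_N to t_(N+1) is paid for by the new term
   whenever d lies above t_(N+1). *)
have level N b :
    d b `^ q <= t N `^ q + \sum_(i < N | t i.+1 < d b) 2 `^ q * t i.+1 `^ q.
  elim: N => [|N IH].
    by rewrite big_ord0 addr0 /t expr0 mulr1 ge0_ler_powR ?nnegrE ?dT// ltW.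
  have [tdb|dbt] := ltP (t N.+1) (d b).
    rewrite (le_trans IH)// [X in _ <= _ + X]big_mkcond/= big_ord_recr/= tdb -big_mkcond/=.
    rewrite t2 powRM ?(ltW (t0 _))//.
    by rewrite [X in X <= _]addrC lerDr addrC lerDl powR_ge0 || (have := powR_ge0 (t N.+1) q; lra).
  apply: (@le_trans _ _ (t N.+1 `^ q)).
    by rewrite ge0_ler_powR ?nnegrE// ltW.
  by rewrite lerDl sumr_ge0// => i _; rewrite mulr_ge0 ?powR_ge0.
have main N : \sum_b d b `^ q <= #|I|%:R * t N `^ q +
    HY_const q * L * \sum_j normc (c j) `^ p.
  apply: (@le_trans _ _ (\sum_b (t N `^ q +
      \sum_(i < N | t i.+1 < d b) 2 `^ q * t i.+1 `^ q))).
    by apply: ler_sum => b _; exact: level.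
  rewrite big_split/= sumr_const -[X in X + _ <= _]mulr_natl lerD ?lexx//.
  under eq_bigr do rewrite big_mkcond/=.
  rewrite exchange_big/=.
  apply: (@le_trans _ _ (\sum_(i < N) \sum_j (if t i.+1 * normc (c j) `^ (p - 1) <= 2
     then 2 `^ q * t i.+1 `^ (q - 2) * (4 * L) * normc (c j) ^+ 2 else 0))).
    apply: ler_sum => i _.
    have tq : t i.+1 `^ q = t i.+1 `^ (q - 2) * t i.+1 ^+ 2.
      rewrite -(powR_mulrn 2) ?(ltW (t0 _))// -powRD ?subrK//.
      by rewrite gt_eqF ?implybT.
    have E S : 2 `^ q * t i.+1 `^ (q - 2) * (t i.+1 ^+ 2 * S) = 2 `^ q * t i.+1 `^ q * S.
      by rewrite tq; ring.
    have := weak_type_count p_gt1 (t0 i.+1) U1 U2 c1.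
    have k0 : 0 <= 2 `^ q * t i.+1 `^ (q - 2) by rewrite mulr_ge0// powR_ge0.
    move=> /(ler_wpM2l k0); rewrite E mulr_sumr.
    rewrite [X in _ -> X <= _](_ : _ = \sum_(b | t i.+1 < d b) 2 `^ q * t i.+1 `^ q * 1).
      move=> /le_trans; apply; rewrite !mulr_sumr big_mkcond/=; apply: ler_sum => j _.
      by case: ifP => // _; rewrite !mulrA.
    by rewrite -big_mkcond/=; apply: eq_bigr => b _; rewrite mulr1.
  rewrite exchange_big/= mulr_sumr; apply: ler_sum => j _.
  have [cj0|cj0] := eqVneq (normc (c j)) 0.
    rewrite big1; last by move=> i _; rewrite cj0 expr0n/= mulr0 if_same.
    by apply: mulr_ge0; [apply: mulr_ge0 => //; exact: HY_const_ge0|exact: powR_ge0].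
  have cj_gt0 : 0 < normc (c j) by rewrite lt_neqAle eq_sym cj0 normc_ge0.
  (* The levels at which j counts as small are exactly those at most X. *)
  pose x : R := normc (c j); pose X : R := 2 / x `^ (p - 1).
  have X0 : 0 <= X by rewrite divr_ge0// powR_ge0.
  apply: (@le_trans _ _ (2 `^ q * (4 * L) * x ^+ 2 *
     \sum_(i < N | T / 2 * 2^-1 ^+ i <= X) (T / 2 * 2^-1 ^+ i) `^ (q - 2))).
    rewrite [X in _ <= _ * X]big_mkcond/= mulr_sumr; apply: ler_sum => i _.
    have -> : T / 2 * 2^-1 ^+ i = t i.+1 by rewrite /t exprS mulrA.
    rewrite -/x ler_pdivlMr ?powR_gt0//.
    case: ifP => _; last by rewrite mulr0.
    by apply: eq_leW; ring.
  have r0 : 0 < q - 2 by lra.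
  have -> : HY_const q * L * x `^ p =
      2 `^ q * (4 * L) * x ^+ 2 * (X `^ (q - 2) / (1 - 2 `^ (- (q - 2)))).
    rewrite /HY_const /X powRM ?powR_ge0 ?invr_ge0//; last by rewrite powR_ge0.
    (* From p (q - 1) = q one gets (p - 1) (q - 2) = 2 - p. *)
    have -> : x `^ p = x ^+ 2 * (x `^ (p - 1))^-1 `^ (q - 2).
      rewrite -powRN -powRrM -(powR_mulrn 2) ?(ltW cj_gt0)// -powRD.
        by congr (_ `^ _); lra.
      by rewrite (gt_eqF (cj_gt0 : 0 < x)) implybT.
    by ring.
  apply: ler_wpM2l.
    apply: mulr_ge0; last exact: sqr_ge0.
    by apply: mulr_ge0; [exact: powR_ge0|exact: mulr_ge0].
  by apply: sum_dyadic_le => //; rewrite divr_ge0 ?ltW.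
(* The floor costs t_N^q for each of the finitely many b, which vanishes as N grows. *)
have cvg0 : (fun N => #|I|%:R * t N `^ q + HY_const q * L * \sum_j normc (c j) `^ p)
    @ \oo --> #|I|%:R * 0 + HY_const q * L * \sum_j normc (c j) `^ p.
  apply: cvgD; last exact: cvg_cst.
  apply: cvgM; first exact: cvg_cst.
  have -> : (fun N => t N `^ q) = (fun N => T `^ q * (2^-1 `^ q) ^+ N).
    apply/funext => N; rewrite /t powRM ?(ltW T0) ?exprn_ge0 ?invr_ge0//; congr (_ * _).
    by rewrite powRX ?invr_ge0.
  rewrite -[X in _ --> X](mulr0 (T `^ q)); apply: cvgM; first exact: cvg_cst.
  apply: cvg_expr; rewrite ger0_norm ?powR_ge0//.
  have h : 2^-1 `^ q < 1 `^ q :> R by rewrite gt0_ltr_powR ?nnegrE ?invr_ge0//; lra.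
  by rewrite powR1 in h.
rewrite mulr0 add0r in cvg0; rewrite -(cvg_lim _ cvg0)//.
apply: limr_ge; first by apply/cvg_ex; eexists; exact: cvg0.
by apply: nearW => N; exact: main.
Qed.


Lemma normc_real (R : realType) (x : R) : 0 <= x -> normc x%:C%C = x.
Proof. by move=> x0; rewrite /normc /= expr0n/= addr0 sqrtr_sqr ger0_norm. Qed.

Lemma normc_realM (R : realType) (x : R) (z : R[i]) : 0 <= x ->
  normc (x%:C * z)%C = x * normc z.
Proof.
move=> x0; by rewrite normcM normc_real.
Qed.

Definition HY_const' (R : realType) (q : R) : R := if q == 2 then 1 else HY_const q.

Lemma HY_const'_ge0 (R : realType) (q : R) : 2 <= q -> 0 <= HY_const' q.
Proof.
by rewrite /HY_const' le_eqVlt eq_sym => /orP[->//|q2]; rewrite gt_eqF// HY_const_ge0.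
Qed.

(** Both sides are homogeneous of degree q in c, which reduces the claim to the normalised case; at
    q = 2 the l^2 hypothesis itself is the inequality, with constant 1. *)
Lemma hausdorff_young (R : realType) (I J : finType) (U : I -> J -> R[i])
    (L p q : R) (c : J -> R[i]) : 2 <= q -> p^-1 + q^-1 = 1 -> 0 <= L ->
    (forall b j, normc (U b j) <= 1) ->
    (forall c : J -> R[i],
      \sum_b normc (\sum_j U b j * c j) ^+ 2 <= L * \sum_j normc (c j) ^+ 2) ->
  \sum_b normc (\sum_j U b j * c j) `^ q <=
    HY_const' q * L * (\sum_j normc (c j) `^ p) `^ (q / p).
Proof.
rewrite le_eqVlt => /predU1P[<-|q2] pq L0 U1 U2.
  have pE : p = 2.
    have : p^-1 = 2^-1 by lra.
    by move=> /(congr1 GRing.inv); rewrite !invrK.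
  rewrite pE divff// powRr1 ?sumr_ge0//; last by move=> *; exact: powR_ge0.
  rewrite /HY_const' eqxx mul1r.
  under eq_bigr do rewrite powR_mulrn ?normc_ge0//.
  under [in X in _ <= _ * X]eq_bigr do rewrite powR_mulrn ?normc_ge0//.
  exact: U2.
have [p_gt1 pE] := conjugateE q2 pq.
have p_gt0 : 0 < p by lra.
have q_gt0 : 0 < q by lra.
rewrite /HY_const' gt_eqF//.
set S := \sum_j normc (c j) `^ p.
have S0 : 0 <= S by rewrite sumr_ge0// => j _; exact: powR_ge0.
have [S0'|SN0] := eqVneq S 0.
  have c0 j : c j = 0.
    apply: ComplexField.Normc.eq0_normc; apply: (@powR_eq0_eq0 _ _ p); apply/eqP.
    move: S0' => /eqP; rewrite psumr_eq0; last by move=> *; exact: powR_ge0.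
    by move=> /allP/(_ j); rewrite mem_index_enum => /(_ isT).
  rewrite big1.
    rewrite mulr_ge0 ?powR_ge0// mulr_ge0// HY_const_ge0//.
  move=> b _; rewrite big1 ?ComplexField.Normc.normc0 ?powR0 ?gt_eqF//.
  by move=> j _; rewrite c0 mulr0.
have S_gt0 : 0 < S by rewrite lt_neqAle eq_sym SN0.
pose N : R := S `^ p^-1.
have N0 : 0 < N by exact: powR_gt0.
have Np : N `^ p = S by rewrite -powRrM mulVf ?gt_eqF// powRr1.
have Nq : N `^ q = S `^ (q / p) by rewrite -powRrM mulrC.
pose c' j := ((N^-1)%:C * c j)%C.
have c'E : \sum_j normc (c' j) `^ p = 1.
  rewrite -[RHS](divff SN0) {2}/S mulrC mulr_sumr; apply: eq_bigr => j _.
  rewrite normc_realM ?invr_ge0 ?ltW// powRM ?invr_ge0 ?normc_ge0 ?(ltW N0)//.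
  by rewrite -powR_inv1 ?(ltW N0)// -powRrM mulN1r powRN Np.
have := hausdorff_young_normalized q2 pq L0 U1 U2 (c := c').
rewrite c'E lexx mulr1 => /(_ isT) h.
rewrite -Nq -ler_pdivrMr ?powR_gt0//; apply: le_trans h.
rewrite mulr_suml; apply: ler_sum => b _.
have -> : \sum_j U b j * c' j = ((N^-1)%:C * \sum_j U b j * c j)%C.
  by rewrite mulr_sumr; apply: eq_bigr => j _; rewrite /c' mulrCA.
rewrite normc_realM ?invr_ge0 ?(ltW N0)// powRM ?invr_ge0 ?normc_ge0 ?(ltW N0)//.
by rewrite mulrC -[N^-1]powR_inv1 ?(ltW N0)// -powRrM mulN1r powRN.
Qed.

(* The extremal coefficients in the converse of Hoelder's inequality. *)
Lemma finite_dual_norm (R : realType) (J : finType) (h : J -> R[i]) (B p q : R) :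
    2 <= q -> p^-1 + q^-1 = 1 -> 0 <= B ->
    (forall c : J -> R[i],
      normc (\sum_j c j * h j) <= B * (\sum_j normc (c j) `^ p) `^ p^-1) ->
  \sum_j normc (h j) `^ q <= B `^ q.
Proof.
move=> q2 pq B0 hB.
have q_gt0 : 0 < q by lra.
have pV : p^-1 = 1 - q^-1 by lra.
have q1 : q^-1 < 1 by rewrite invf_lt1//; lra.
have p_gt0 : 0 < p by rewrite -invr_gt0 pV subr_gt0.
have pE : (q - 1) * p = q.
  have : q * p * p^-1 = q by rewrite mulfK// gt_eqF.
  have : q * p * (1 - q^-1) = q * p - p * (q * q^-1) by ring.
  rewrite pV divff ?gt_eqF// => -> h1.
  lra.
pose Z := \sum_j normc (h j) `^ q.
have Z0 : 0 <= Z by rewrite sumr_ge0// => j _; exact: powR_ge0.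
have [Z0'|ZN0] := eqVneq Z 0; first by rewrite -/Z Z0' powR_ge0.
have Zp : 0 < Z by rewrite lt_neqAle eq_sym ZN0.
pose c j := ((normc (h j) `^ (q - 2))%:C * (h j)^*)%C.
have cE j : normc (c j) = normc (h j) `^ (q - 1).
  rewrite /c normc_realM ?powR_ge0//.
  have -> : normc (h j)^*%C = normc (h j).
    by case: (h j) => x y; rewrite /= sqrrN.
  have [->|hN0] := eqVneq (normc (h j)) 0.
    by rewrite mulr0 powR0// gt_eqF//; lra.
  rewrite -{2}[normc (h j)]powRr1 ?normc_ge0// -powRD ?hN0 ?implybT//.
  by congr (_ `^ _); lra.
have chE j : c j * h j = (normc (h j) `^ q)%:C%C.
  have -> : c j * h j = ((normc (h j) `^ (q - 2))%:C * (normc (h j) ^+ 2)%:C)%C.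
    rewrite /c -mulrA; congr (_ * _).
    rewrite sqr_normcE; case: (h j) => x y; apply/eqP; rewrite eq_complex/=.
    by apply/andP; split; apply/eqP; ring.
  rewrite -rmorphM/=; congr (_%:C)%C.
  have [->|hN0] := eqVneq (normc (h j)) 0.
    by rewrite expr0n/= mulr0 powR0// gt_eqF.
  rewrite -powR_mulrn ?normc_ge0// -powRD ?hN0 ?implybT//.
  by congr (_ `^ _); lra.
have := hB c.
under eq_bigr do rewrite chE.
rewrite -rmorph_sum normc_real// -/Z.
under eq_bigr do rewrite cE -powRrM pE.
rewrite pV => ZB.
have Z1 : Z `^ q^-1 <= B.
  rewrite -(@ler_pM2r _ (Z `^ (1 - q^-1))) ?powR_gt0// -powRD ?ZN0 ?implybT//.
  by rewrite addrC subrK powRr1.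
have : (Z `^ q^-1) `^ q <= B `^ q.
  by rewrite ge0_ler_powR ?nnegrE ?powR_ge0// ltW.
by rewrite -powRrM mulVf ?gt_eqF// powRr1.
Qed.

(** * The discrete Fourier transform *)

Section trig.
Context {R : realType}.
Implicit Types (x y t : R) (z : R[i]).

Lemma expiD x y : expi (x + y) = expi x * expi y.
Proof.
rewrite /expi cosD sinD; apply/eqP; rewrite eq_complex/=.
by apply/andP; split; apply/eqP; ring.
Qed.

Lemma expi0 : expi 0 = 1 :> R[i].
Proof. by rewrite /expi cos0 sin0. Qed.

Lemma normc_expi x : normc (expi x) = 1.
Proof.
by apply/eqP; rewrite -(@eqrXn2 _ 2)// ?normc_ge0// sqr_normcE/= cos2Dsin2 expr1n.
Qed.

Lemma conjc_expi x : ((expi x)^*)%C = expi (- x).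
Proof. by rewrite /expi cosN sinN. Qed.

Lemma expi_sum (I : Type) (r : seq I) (F : I -> R) :
  expi (\sum_(i <- r) F i) = \prod_(i <- r) expi (F i).
Proof. by elim/big_rec2 : _ => [|i u v _ <-]; rewrite ?expi0 ?expiD. Qed.

Lemma expiX x (n : nat) : expi x ^+ n = expi (n%:R * x).
Proof.
by elim: n => [|n IH]; rewrite ?mul0r ?expi0// exprS IH -expiD -natr1 mulrDl mul1r addrC.
Qed.

Lemma expi_nat (n : nat) : e n%:R = 1 :> R[i].
Proof.
rewrite /expi; have -> : 2 * pi * n%:R = 0 + (n%:R * 2) * pi :> R by ring.
rewrite -natrM muln2 -mul2n mulrC.
elim: n => [|n [IHc IHs]]; first by rewrite muln0 mulr0 addr0 cos0 sin0.
have -> : 0 + pi * (2 * n.+1)%:R = 0 + pi * (2 * n)%:R + pi *+ 2 :> R.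
  by rewrite mulnS natrD mulrDr mulr_natr addrA addrAC.
by rewrite cosD2pi sinD2pi IHc IHs.
Qed.

Lemma conjcM_normc z : (z * z^* = (normc z ^+ 2)%:C)%C.
Proof.
rewrite sqr_normcE; case: z => x y; apply/eqP; rewrite eq_complex/=.
by apply/andP; split; apply/eqP; ring.
Qed.

Lemma sqr_normc_expiB1 t : normc (e t - 1) ^+ 2 = 4 * sin (pi * t) ^+ 2.
Proof.
rewrite sqr_normcE /expi/=.
have -> : 2 * pi * t = pi * t + pi * t by ring.
rewrite cosD sinD subr0.
have : cos (pi * t) ^+ 2 = 1 - sin (pi * t) ^+ 2 by rewrite -(cos2Dsin2 (pi * t)) addrK.
set c := cos _; set s := sin _ => h.
have -> : c * c = 1 - s ^+ 2 by rewrite -expr2.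
have -> : (s * c + c * s) ^+ 2 = 4 * s ^+ 2 * c ^+ 2 by ring.
by rewrite h; ring.
Qed.

Lemma expi_ne1 t : 0 < `|t| < 1 -> e t != 1.
Proof.
move=> /andP[t0 t1]; apply/eqP => E.
have := sqr_normc_expiB1 t; rewrite E subrr ComplexField.Normc.normc0 expr0n/=.
have : sin (pi * `|t|) > 0.
  by rewrite sin_gt0_pi// mulr_gt0 ?pi_gt0//= gtr_pMr ?pi_gt0.
have -> : sin (pi * t) ^+ 2 = sin (pi * `|t|) ^+ 2.
  by have [_|_] := ger0P t => //; rewrite mulrN sinN sqrrN.
by move=> h /eqP; rewrite eq_sym mulf_eq0 sqrf_eq0 (gt_eqF h) orbF pnatr_eq0.
Qed.

(** The usual bound 1 / |sin (pi t)| for a geometric sum, squared and multiplied out so that integer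
    t need no separate treatment. *)
Lemma geometric_expi_le t (K : nat) :
  normc (\sum_(b < K) e (b%:R * t)) ^+ 2 * sin (pi * t) ^+ 2 <= 1.
Proof.
set S := \sum_(b < K) _.
have E : e (K%:R * t) - 1 = (e t - 1) * S.
  rewrite mulrCA -expiX subrX1; congr (_ * _); apply: eq_bigr => b _.
  by rewrite expiX mulrCA.
have := normcM (e t - 1) S; rewrite -E => {}E.
have h2 : normc (e (K%:R * t) - 1) <= 2.
  rewrite (le_trans (ler_normcD _ _))// normcN normc_expi.
  by rewrite ComplexField.Normc.normc1.
have n0 := normc_ge0 (e (K%:R * t) - 1).
have : normc (e (K%:R * t) - 1) ^+ 2 <= 4 by nra.
rewrite E exprMn sqr_normc_expiB1; lra.
Qed.

End trig.

Section dft.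
Context {R : realType} (K' : nat).
Let K := K'.+1.

(** Orthogonality of the characters of Z/K: off the diagonal the sum is a unimodular factor,
    carrying the offset x, times a full geometric sum over a nontrivial K-th root of unity. *)
Lemma sum_expi_ord (j j' : 'I_K) (x : R) :
  \sum_(b < K) e ((b%:R - x) * ((j%:R - j'%:R) / K%:R)) = (K%:R *+ (j == j'))%:C%C.
Proof.
have K0 : K%:R != 0 :> R by rewrite pnatr_eq0.
have [<-|jj'] := eqVneq j j'.
  rewrite mulr1n subrr mul0r.
  under eq_bigr do rewrite !mulr0 expi0.
  by rewrite sumr_const card_ord rmorph_nat.
rewrite mulr0n.
set t := (j%:R - j'%:R) / K%:R.
have E b : e ((b%:R - x) * t) = e (- x * t) * e t ^+ b :> R[i].
  by rewrite expiX -expiD; congr expi; ring.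
under eq_bigr do rewrite E.
rewrite -mulr_sumr.
suff : (e t - 1) * (\sum_(b < K) e t ^+ b) = 0.
  move=> /eqP; rewrite mulf_eq0 subr_eq0 => /orP[|/eqP->]; last by rewrite mulr0.
  rewrite (negbTE (expi_ne1 _))//.
  rewrite normr_gt0 mulf_eq0 invr_eq0 (negbTE K0) orbF subr_eq0 eqr_nat/=.
  rewrite jj'/= normrM normfV [`|K%:R|]ger0_norm// ltr_pdivrMr ?ltr0n// mul1r.
  rewrite ltr_norml ltrBDr ltrBDl; apply/andP; split.
    by rewrite addrC ltrBlDr ltr_wpDl// ltr_nat.
  by rewrite ltr_wpDl// ltr_nat.
rewrite -subrX1 expiX.
have -> : K%:R * (2 * pi * t) = 2 * pi * j%:R + - (2 * pi * j'%:R).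
  by rewrite /t; field.
by rewrite expiD -conjc_expi !expi_nat conjc1 mulr1 subrr.
Qed.

End dft.

Lemma prod_expi_ffun (R : realType) (n : nat) (T : finType) (F : 'I_n -> T -> R) :
  \sum_(f : {ffun 'I_n -> T}) expi (\sum_i F i (f i)) =
  \prod_i \sum_(t : T) expi (F i t).
Proof. by rewrite bigA_distr_bigA/=; apply: eq_bigr => f _; rewrite expi_sum. Qed.

(** Expanding the product shows that x and 1/2 only introduce unimodular factors depending on b
    alone or on j alone, which leave orthogonality intact. The 1/2 centres the frequencies j/K at 0;
    x will be the second averaging index b'. *)
Definition dft_phase (R : realType) (n K : nat) (x : 'I_n -> R)
    (b j : {ffun 'I_n -> 'I_K}) : R :=
  \sum_i ((b i)%:R - x i) * ((j i)%:R / K%:R - 2^-1).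

Lemma dft_orthogonal (R : realType) (n K' : nat) (x : 'I_n -> R)
    (j j' : {ffun 'I_n -> 'I_K'.+1}) :
  \sum_b e (dft_phase x b j) * (e (dft_phase x b j'))^*%C =
  ((K'.+1 ^ n)%:R *+ (j == j'))%:C%C.
Proof.
transitivity (\sum_(b : {ffun 'I_n -> 'I_K'.+1})
    expi (\sum_i 2 * pi * (((b i)%:R - x i) * (((j i)%:R - (j' i)%:R) / K'.+1%:R))) : R[i]).
  apply: eq_bigr => b _; rewrite conjc_expi -expiD; congr expi.
  rewrite /dft_phase !mulr_sumr -sumrN -big_split/=.
  by apply: eq_bigr => i _; ring.
rewrite (prod_expi_ffun (fun i (b : 'I_K'.+1) =>
  2 * pi * ((b%:R - x i) * (((j i)%:R - (j' i)%:R) / K'.+1%:R)))).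
under eq_bigr do rewrite sum_expi_ord.
rewrite -rmorph_prod/=; congr (_%:C)%C.
have [->|jj'] := eqVneq j j'.
  under eq_bigr do rewrite eqxx mulr1n.
  by rewrite prodr_const card_ord -natrX.
have [i ji] : exists i, j i != j' i.
  apply/existsP; apply: contraR jj'; rewrite negb_exists => /forallP h.
  by apply/eqP/ffunP => i; apply/eqP; move: (h i); rewrite negbK.
by rewrite (bigD1 i)//= (negbTE ji) !mulr0n mul0r.
Qed.

Lemma dft_parseval (R : realType) (n K' : nat) (x : 'I_n -> R)
    (c : {ffun 'I_n -> 'I_K'.+1} -> R[i]) :
  \sum_b normc (\sum_j e (dft_phase x b j) * c j) ^+ 2 =
  (K'.+1 ^ n)%:R * \sum_j normc (c j) ^+ 2.
Proof.
apply: (@complexI R); rewrite rmorph_sum/= rmorphM/= rmorph_sum/=.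
under eq_bigr do rewrite -conjcM_normc rmorph_sum/= big_distrl/=.
under eq_bigr do under eq_bigr do rewrite big_distrr/=.
rewrite exchange_big/= mulr_sumr; apply: eq_bigr => j _.
rewrite exchange_big/= (bigD1 j)//= [X in _ + X]big1 ?addr0.
  under eq_bigr do rewrite rmorphM/= mulrACA.
  by rewrite -mulr_suml dft_orthogonal eqxx mulr1n conjcM_normc.
move=> j' jj'.
under eq_bigr do rewrite rmorphM/= mulrACA.
by rewrite -mulr_suml dft_orthogonal eq_sym (negbTE jj') mulr0n mul0r.
Qed.

Lemma dft_hausdorff_young (R : realType) (n K' : nat) (x : 'I_n -> R) (p q : R)
    (c : {ffun 'I_n -> 'I_K'.+1} -> R[i]) : 2 <= q -> p^-1 + q^-1 = 1 ->
  \sum_b normc (\sum_j e (dft_phase x b j) * c j) `^ q <=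
  HY_const' q * (K'.+1 ^ n)%:R * (\sum_j normc (c j) `^ p) `^ (q / p).
Proof.
move=> q2 pq; apply: hausdorff_young => //.
  by move=> b j; rewrite normc_expi.
by move=> {}c; rewrite dft_parseval.
Qed.

(** * Mixed norms of nonnegative functions *)

Section mixed_norm.
Import HBNNSimple.
Local Open Scope ereal_scope.

Lemma limn_einf_le (R : realType) (u : (\bar R)^nat) (B : \bar R) :
  (forall n, u n <= B) -> limn_einf u <= B.
Proof.
move=> uB; rewrite limn_einf_lim; apply: lime_le; first exact: is_cvg_einfs.
by apply: nearW => n; rewrite (le_trans _ (uB n))//; apply: ereal_inf_lbound; exists n => /=.
Qed.

Lemma limn_einf_ge0 (R : realType) (u : (\bar R)^nat) :
  (forall n, 0 <= u n) -> 0 <= limn_einf u.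
Proof.
move=> u0; rewrite limn_einf_lim; apply: lime_ge; first exact: is_cvg_einfs.
by apply: nearW => n; apply: le_ereal_inf_tmp => _ [m _ <-].
Qed.

Lemma ge0_ler_poweR (R : realType) (r : R) (x y : \bar R) : (0 <= r)%R ->
  0 <= x -> x <= y -> x `^ r <= y `^ r.
Proof.
move=> r0 x0 xy; apply: gt0_ler_poweR => //; rewrite in_itv/= leey andbT//.
exact: le_trans xy.
Qed.

(** Every tail infimum of u is at most S^(1/r), where S is the lower limit of the powers; only
    monotonicity of powers is involved. *)
Lemma poweR_limn_einf (R : realType) (u : (\bar R)^nat) (r : R) : (0 < r)%R ->
  (forall n, 0 <= u n) -> (limn_einf u) `^ r <= limn_einf (fun n => u n `^ r).
Proof.
move=> r0 u0.
set v := fun n => u n `^ r; set S := limn_einf v.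
have S0 : 0 <= S by apply: limn_einf_ge0 => n; exact: poweR_ge0.
have einf0 n : 0 <= einfs u n by apply: le_ereal_inf_tmp => _ [m _ <-].
have h n : einfs u n `^ r <= S.
  apply: (@le_trans _ _ (einfs v n)).
    apply: le_ereal_inf_tmp => _ [m /= nm <-].
    apply: ge0_ler_poweR => //; first exact: ltW.
    by apply: ereal_inf_lbound; exists m.
  rewrite /S limn_einf_lim (cvg_lim _ (ereal_nondecreasing_cvgn (@nondecreasing_einfs _ v)))//.
  by apply: ereal_sup_ubound; exists n.
have {}h m : einfs u m <= S `^ r^-1.
  have := ge0_ler_poweR (ltW (_ : 0 < r^-1)%R) (poweR_ge0 _ _) (h m).
  by rewrite -poweRrM mulfV ?gt_eqF// poweRe1//; apply; rewrite invr_gt0.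
have -> : S = (S `^ r^-1) `^ r by rewrite -poweRrM mulVf ?gt_eqF// poweRe1.
apply: ge0_ler_poweR; [exact: ltW|exact: limn_einf_ge0|].
rewrite limn_einf_lim; apply: lime_le; first exact: is_cvg_einfs.
by apply: nearW.
Qed.

(* Neither function is assumed measurable: the integral of a nonnegative
   function is a supremum over the simple functions below it. *)
Lemma ae_le_integral d (T : measurableType d) (R : realType)
    (mu : {measure set T -> \bar R}) (f g : T -> \bar R) :
  (forall x, 0 <= f x) -> (forall x, 0 <= g x) ->
  {ae mu, forall x, f x <= g x} -> \int[mu]_x f x <= \int[mu]_x g x.
Proof.
move=> f0 g0 [N [mN N0 Nfg]].
rewrite ge0_integralTE// ge0_integralTE//.
apply: ge_ereal_sup => _ [h /= hf <-].
(* Cutting h to 0 on the exceptional set puts it below g everywhere without changing its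
   integral. *)
pose h' := proj_nnsfun h (measurableC mN).
have h'E x : h' x = (h x * \1_(~` N) x)%R by [].
apply: (@le_trans _ _ (sintegral mu h')); last first.
  apply: ereal_sup_ubound; exists h' => // x; change ((h x * \1_(~` N) x)%:E <= g x); rewrite indicE.
  have [xN|xN] := boolP (x \in ~` N); last by rewrite mulr0.
  rewrite mulr1 (le_trans (hf x))//; apply: contrapT => fgx.
  by move: xN; rewrite inE => /=; apply; exact: Nfg.
rewrite -!integralT_nnsfun (ge0_negligible_integral mN)//; last 2 first.
- exact/measurable_EFinP.
- by move=> x _; rewrite lee_fin.
rewrite setTD integral_mkcond; apply: eq_leW.
apply: eq_integral => x _; transitivity ((h x * \1_(~` N) x)%:E) => //.
rewrite indicE patchE.
by case: ifPn => xN; rewrite ?mulr1// mulr0.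
Qed.

Lemma ae_eq_integral_nonmeasurable d (T : measurableType d) (R : realType)
    (mu : {measure set T -> \bar R}) (f g : T -> \bar R) :
  {ae mu, forall x, f x = g x} -> \int[mu]_x f x = \int[mu]_x g x.
Proof.
move=> fg; rewrite integralE [RHS]integralE; congr (_ - _); apply/eqP; rewrite eq_le;
  apply/andP; split; apply: ae_le_integral => //; apply: filterS fg => x /= fgx.
- by rewrite !funeposE fgx.
- by rewrite !funeposE fgx.
- by rewrite !funenegE fgx.
- by rewrite !funenegE fgx.
Qed.

(** F is later the modulus of a symbol that is measurable only for the completion, so it is first
    compared with the measurable lower limit of the H_n, to which Fatou's lemma applies. *)
Lemma fatou_poweR d (T : measurableType d) (R : realType)
    (mu : {measure set T -> \bar R}) (F : T -> \bar R) (H : nat -> T -> \bar R) (r : R) :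
  (0 < r)%R -> (forall x, 0 <= F x) -> (forall n x, 0 <= H n x) ->
  (forall n, measurable_fun setT (H n)) ->
  {ae mu, forall x, F x <= limn_einf (H ^~ x)} ->
  \int[mu]_x (F x `^ r) <= limn_einf (fun n => \int[mu]_x (H n x `^ r)).
Proof.
move=> r0 F0 H0 mH FH.
apply: (@le_trans _ _ (\int[mu]_x limn_einf (fun n => H n x `^ r))).
  apply: ae_le_integral => [x|x|]; first exact: poweR_ge0.
    by apply: limn_einf_ge0 => n; exact: poweR_ge0.
  apply: filterS FH => x /= Fx.
  apply: le_trans (poweR_limn_einf r0 (H0 ^~ x)).
  by apply: ge0_ler_poweR => //; exact: ltW.
apply: fatou => // [n|n x _]; last exact: poweR_ge0.
exact: measurableT_comp (measurable_poweR r) (mH n).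
Qed.

(** Minkowski's inequality bounds each partial sum by the full series of the b_k, and Fatou's lemma
    passes to the limit. *)
Lemma minkowski_series d (T : measurableType d) (R : realType)
    (mu : {measure set T -> \bar R}) (g : nat -> T -> R) (p : R) (b : nat -> \bar R) :
  (1 <= p)%R -> (forall k x, 0 <= g k x)%R ->
  (forall k, measurable_fun setT (g k)) ->
  (forall k, (\int[mu]_x ((g k x)%:E `^ p)) `^ p^-1 <= b k) ->
  (\int[mu]_x ((\sum_(0 <= k <oo) (g k x)%:E) `^ p)) `^ p^-1 <= \sum_(0 <= k <oo) b k.
Proof.
move=> p1 g0 mg gb.
have p0 : (0 < p)%R by exact: lt_le_trans p1.
have b0 k : 0 <= b k by apply: le_trans (gb k); exact: poweR_ge0.
pose S n x : R := (\sum_(0 <= k < n) g k x)%R.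
have S0 n x : (0 <= S n x)%R by apply: sumr_ge0.
have mS n : measurable_fun setT (S n) by exact: measurable_sum.
have NE f : (forall x, 0 <= f x)%R ->
    (\int[mu]_x ((f x)%:E `^ p)) `^ p^-1 = Lnorm mu p%:E (EFin \o f).
  move=> f0; rewrite unlock /=; congr (_ `^ _); apply: eq_integral => x _.
  by rewrite /= ger0_norm.
have hS n : (\int[mu]_x ((S n x)%:E `^ p)) `^ p^-1 <= \sum_(0 <= k < n) b k.
  rewrite NE//; elim: n => [|n IH].
    rewrite big_geq// (_ : EFin \o S 0%N = cst 0).
      by rewrite Lnorm0// eqe gt_eqF.
    by apply/funext => x; rewrite /S /= big_geq.
  rewrite big_nat_recr//= (_ : S n.+1 = (S n \+ g n)%R).
    apply: (le_trans (minkowski_EFin _ (mS n) (mg n) p1)).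
    by rewrite leeD// -NE.
  by apply/funext => x; rewrite /S /= big_nat_recr.
have hS' n : \int[mu]_x ((S n x)%:E `^ p) <= (\sum_(0 <= k <oo) b k) `^ p.
  have I0 : 0 <= \int[mu]_x ((S n x)%:E `^ p) by apply: integral_ge0 => x _; exact: poweR_ge0.
  rewrite -[leLHS]poweRe1// -[X in _ `^ X](mulVf (lt0r_neq0 p0)) poweRrM.
  apply: ge0_ler_poweR; [exact: ltW|exact: poweR_ge0|].
  by apply: le_trans (hS n) _; exact: nneseries_lim_ge.
have B0 : 0 <= \sum_(0 <= k <oo) b k by exact: nneseries_ge0.
set B := (leRHS); have -> : B = (B `^ p) `^ p^-1 by rewrite -poweRrM mulfV ?gt_eqF// poweRe1.
apply: ge0_ler_poweR; first by rewrite invr_ge0 ltW.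
  by apply: integral_ge0 => x _; exact: poweR_ge0.
apply: (le_trans (fatou_poweR (H := fun n x => (S n x)%:E) p0 _ _ _ _)).
- by move=> x; apply: nneseries_ge0 => k _ _; rewrite lee_fin.
- by move=> n x; rewrite lee_fin.
- by move=> n; exact/measurable_EFinP.
- apply: aeW => x; rewrite is_cvg_limn_einfE.
    by under [X in _ <= limn X]eq_fun do rewrite -sumEFin.
  under eq_fun do rewrite -sumEFin.
  by apply: is_cvg_nneseries => k _ _; rewrite lee_fin.
- exact: limn_einf_le.
Qed.


Section product.
Context d1 d2 (X : measurableType d1) (Y : measurableType d2) (R : realType).
Variables (mu : {sigma_finite_measure set X -> \bar R})
          (nu : {sigma_finite_measure set Y -> \bar R}).

(** By Tonelli the measures of the sections of a null set have integral 0. *)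
Lemma ae_product_section2 (P : X * Y -> Prop) : {ae mu \x nu, forall z, P z} ->
  {ae nu, forall y, {ae mu, forall x, P (x, y)}}.
Proof.
move=> [N [mN N0 PN]].
have mf : measurable_fun [set: X * Y] (EFin \o \1_N : X * Y -> \bar R).
  by apply/measurable_EFinP; exact: measurable_indic.
have f0 z : 0 <= (EFin \o \1_N : X * Y -> \bar R) z by rewrite lee_fin.
have := fubini_tonelli2 (m1 := mu) (m2 := nu) _ mf f0; rewrite integral_indic// setIT => h.
have {}h := etrans (esym N0) h.
have G0 y : 0 <= fubini_G mu (EFin \o \1_N) y by exact: integral_ge0.
have : ae_eq nu setT (fubini_G mu (EFin \o \1_N)) (cst 0).
  apply/ae_eq_integral_abs => //; first exact: measurable_fun_fubini_tonelli_G.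
  by rewrite [RHS]h; apply: eq_integral => y _; rewrite gee0_abs.
apply: filterS => y /(_ I) /= Gy.
exists (ysection N y); split.
- exact: measurable_ysection.
- rewrite -Gy /fubini_G -[ysection N y]setIT -integral_indic//; last exact: measurable_ysection.
  by apply: eq_integral => x _ /=; rewrite !indicE mem_ysection.
- by move=> x /= Pxy; rewrite /ysection/= inE; exact: PN.
Qed.

Lemma ae_product_section1 (P : X * Y -> Prop) : {ae mu \x nu, forall z, P z} ->
  {ae mu, forall x, {ae nu, forall y, P (x, y)}}.
Proof.
move=> [N [mN N0 PN]].
have mf : measurable_fun [set: X * Y] (EFin \o \1_N : X * Y -> \bar R).
  by apply/measurable_EFinP; exact: measurable_indic.
have f0 z : 0 <= (EFin \o \1_N : X * Y -> \bar R) z by rewrite lee_fin.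
have := fubini_tonelli1 (m1 := mu) (m2 := nu) _ mf f0; rewrite integral_indic// setIT => h.
have {}h := etrans (esym N0) h.
have G0 x : 0 <= fubini_F nu (EFin \o \1_N) x by exact: integral_ge0.
have : ae_eq mu setT (fubini_F nu (EFin \o \1_N)) (cst 0).
  apply/ae_eq_integral_abs => //; first exact: measurable_fun_fubini_tonelli_F.
  by rewrite [RHS]h; apply: eq_integral => y _; rewrite gee0_abs.
apply: filterS => x /(_ I) /= Gx.
exists (xsection N x); split.
- exact: measurable_xsection.
- rewrite -Gx /fubini_F -[xsection N x]setIT -integral_indic//; last exact: measurable_xsection.
  by apply: eq_integral => y _ /=; rewrite !indicE mem_xsection.
- by move=> y /= Pxy; rewrite /xsection/= inE; exact: PN.
Qed.

(** The q-th power of the mixed norm: without the outer root, Fatou's lemma can be applied to the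
    inner and then to the outer integral. *)
Definition mixed (p q : R) (F : X * Y -> \bar R) : \bar R :=
  \int[nu]_y ((\int[mu]_x (F (x, y) `^ p)) `^ (q / p)).

(** Fatou's lemma twice: on almost every section in the inner variable, then in the outer variable
    for the powers q / p of the inner integrals. *)
Lemma mixed_liminf (p q : R) (F : X * Y -> \bar R) (H : nat -> X * Y -> \bar R)
    (C : \bar R) : (0 < p)%R -> (0 < q)%R ->
  (forall z, 0 <= F z) -> (forall n z, 0 <= H n z) ->
  (forall n, measurable_fun setT (H n)) ->
  {ae mu \x nu, forall z, F z <= limn_einf (H ^~ z)} ->
  (forall n, mixed p q (H n) <= C) -> mixed p q F <= C.
Proof.
move=> p0 q0 F0 H0 mH FH HC.
have qp0 : (0 < q / p)%R by rewrite divr_gt0.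
pose u n y := \int[mu]_x (H n (x, y) `^ p).
have u0 n y : 0 <= u n y by apply: integral_ge0 => x _; exact: poweR_ge0.
have mHp n : measurable_fun setT (fun z => H n z `^ p).
  exact: measurableT_comp (measurable_poweR p) (mH n).
apply: (@le_trans _ _ (limn_einf (fun n => \int[nu]_y (u n y `^ (q / p))))).
  apply: fatou_poweR => //.
  - by move=> y; apply: integral_ge0 => x _; exact: poweR_ge0.
  - move=> n.
    exact: (measurable_fun_fubini_tonelli_G (m1 := mu) _ (mHp n) (fun z => poweR_ge0 _ _)).
  - apply: filterS (ae_product_section2 FH) => y FHy.
    apply: fatou_poweR => // n.
    exact: measurableT_comp (mH n) (measurable_pair2 y).
exact: limn_einf_le.
Qed.

(** Minkowski's inequality twice. For fixed y the factors [g k y] are constants in the inner norm,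
    which turns each [f k] into its bound [a k]; the outer norm then treats the series of the
    [a k * g k y]. *)
Lemma mixed_series (p q : R) (f : nat -> X -> R) (g : nat -> Y -> R) (a b : nat -> R) :
  (1 <= p)%R -> (1 <= q)%R ->
  (forall k x, 0 <= f k x)%R -> (forall k y, 0 <= g k y)%R ->
  (forall k, measurable_fun setT (f k)) -> (forall k, measurable_fun setT (g k)) ->
  (forall k, 0 <= a k)%R -> (forall k, 0 <= b k)%R ->
  (forall k, (\int[mu]_x ((f k x)%:E `^ p)) `^ p^-1 <= (a k)%:E) ->
  (forall k, (\int[nu]_y ((g k y)%:E `^ q)) `^ q^-1 <= (b k)%:E) ->
  mixed p q (fun z => \sum_(0 <= k <oo) (f k z.1 * g k z.2)%:E) <=
  (\sum_(0 <= k <oo) (a k * b k)%:E) `^ q.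
Proof.
move=> p1 q1 f0 g0 mf mg a0 b0 fa gb.
have p0 : (0 < p)%R by exact: lt_le_trans p1.
have q0 : (0 < q)%R by exact: lt_le_trans q1.
have inner y : (\int[mu]_x ((\sum_(0 <= k <oo) (f k x * g k y)%:E) `^ p)) `^ p^-1 <=
    \sum_(0 <= k <oo) (a k * g k y)%:E.
  apply: minkowski_series => //.
  - by move=> k x; rewrite mulr_ge0.
  - by move=> k; exact: measurable_funM.
  - move=> k.
    have -> : \int[mu]_x (f k x * g k y)%:E `^ p =
        (g k y)%:E `^ p * \int[mu]_x ((f k x)%:E `^ p).
      rewrite -ge0_integralZl//.
      + by apply: eq_integral => x _; rewrite EFinM poweRM ?lee_fin// muleC.
      + by apply: measurableT_comp (measurable_poweR p) _; exact/measurable_EFinP.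
      + by move=> x _; exact: poweR_ge0.
      + exact: poweR_ge0.
    rewrite poweRM ?poweR_ge0//; last by apply: integral_ge0 => x _; exact: poweR_ge0.
    rewrite -poweRrM mulfV ?gt_eqF// poweRe1 ?lee_fin// EFinM muleC.
    by apply: lee_wpmul2r; rewrite ?lee_fin.
have outer : (\int[nu]_y ((\sum_(0 <= k <oo) (a k * g k y)%:E) `^ q)) `^ q^-1 <=
    \sum_(0 <= k <oo) (a k * b k)%:E.
  apply: minkowski_series => //.
  - by move=> k x; rewrite mulr_ge0.
  - by move=> k; exact: measurable_funM.
  - move=> k.
    have -> : \int[nu]_y (a k * g k y)%:E `^ q =
        (a k)%:E `^ q * \int[nu]_y ((g k y)%:E `^ q).
      rewrite -ge0_integralZl//.
      + by apply: eq_integral => x _; rewrite EFinM poweRM ?lee_fin.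
      + by apply: measurableT_comp (measurable_poweR q) _; exact/measurable_EFinP.
      + by move=> x _; exact: poweR_ge0.
      + exact: poweR_ge0.
    rewrite poweRM ?poweR_ge0//; last by apply: integral_ge0 => x _; exact: poweR_ge0.
    rewrite -poweRrM mulfV ?gt_eqF// poweRe1 ?lee_fin// EFinM.
    by apply: lee_wpmul2l; rewrite ?lee_fin.
apply: (@le_trans _ _ (\int[nu]_y ((\sum_(0 <= k <oo) (a k * g k y)%:E) `^ q))).
  apply: ae_le_integral => [y|y|]; [exact: poweR_ge0|exact: poweR_ge0|].
  apply: aeW => y /=; rewrite mulrC poweRrM.
  apply: ge0_ler_poweR; [exact: ltW|exact: poweR_ge0|exact: inner].
set I := (leLHS).
have -> : I = (I `^ q^-1) `^ q.
  rewrite -poweRrM mulVf ?gt_eqF// poweRe1//.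
  by apply: integral_ge0 => y _; exact: poweR_ge0.
by apply: ge0_ler_poweR; [exact: ltW|exact: poweR_ge0|exact: outer].
Qed.

End product.

End mixed_norm.

(** * Lebesgue measure on row vectors *)

Section lebesgue_rV_theory.
Context {R : realType}.
Local Open Scope ereal_scope.
Local Notation leb1 := (@lebesgue_measure R).

Lemma lebesgue_measure_translate (c : R) (A : set (measurableTypeR R)) : measurable A ->
  leb1 [set x | A (x + c)%R] = leb1 A.
Proof.
move=> mA.
have mc : measurable_fun [set: measurableTypeR R] (fun x : measurableTypeR R => (x + c)%R : measurableTypeR R).
  exact: measurable_funD.
have := @lebesgue_measure_unique R [the measure _ _ of pushforward leb1 (fun x : measurableTypeR R => (x + c)%R : measurableTypeR R)].
move=> /(_ mc) h; rewrite [RHS]h//.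
move=> X [[a b] ab <-]; rewrite /= /pushforward.
have -> : (fun x : R => (x + c)%R) @^-1` `]a, b] = `](a - c)%R, (b - c)%R]%classic.
  by apply/seteqP; split => x /=; rewrite !in_itv/= ltrBlDr lerBrDr.
rewrite !lebesgue_measure_itv/= !lte_fin ltrD2r.
by case: ifP => // _; rewrite -!EFinD; congr EFin; ring.
Qed.

Lemma ge0_integral_translate1 (c : R) (f : measurableTypeR R -> \bar R) :
  measurable_fun setT f -> (forall x, 0 <= f x) ->
  \int[leb1]_x f (x + c)%R = \int[leb1]_x f x.
Proof.
move=> mf f0.
have mc : measurable_fun [set: measurableTypeR R] (fun x : measurableTypeR R => (x + c)%R : measurableTypeR R).
  exact: measurable_funD.
transitivity (\int[pushforward leb1 (fun x : measurableTypeR R => (x + c)%R : measurableTypeR R)]_x f x).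
  by rewrite ge0_integral_pushforward.
apply: eq_measure_integral => A mA _.
exact: lebesgue_measure_translate.
Qed.

Lemma ge0_integral_rV_cons n (f : 'rV[R]_n.+1 -> \bar R) :
  measurable_fun setT f -> (forall v, 0 <= f v) ->
  \int[lebesgue_rV n.+1]_v f v =
  \int[leb1]_x \int[lebesgue_rV n]_v f (rV_cons (x, v)).
Proof.
move=> mf f0.
transitivity (\int[pushforward (leb1 \x lebesgue_rV n) (@rV_cons R n)]_v f v) => //.
rewrite ge0_integral_pushforward//; last exact: measurable_rV_cons.
rewrite preimage_setT (fubini_tonelli1 (m1 := leb1))//.
  by apply: measurableT_comp mf _; exact: measurable_rV_cons.
by move=> z; exact: f0.
Qed.

Lemma rV_cons_translate n (x : R) (v : 'rV[R]_n) (w : 'rV[R]_n.+1) :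
  (rV_cons (x, v) + w)%R =
  rV_cons ((x + w ord0 ord0)%R, (v + \row_j w ord0 (lift ord0 j))%R).
Proof.
apply/rowP => i; rewrite !mxE; case: unliftP => [j ->|->] /=; by rewrite ?mxE.
Qed.

Lemma measurable_rV_translate n (w : 'rV[R]_n) :
  measurable_fun setT (fun v : 'rV[R]_n => (v + w)%R).
Proof.
apply/measurable_fun_rVP => i.
under [X in measurable_fun _ X]eq_fun do rewrite mxE.
by apply: measurable_funD => //; exact: measurable_coord.
Qed.

Lemma ge0_integral_rV_translate n (w : 'rV[R]_n) (f : 'rV[R]_n -> \bar R) :
  measurable_fun setT f -> (forall v, 0 <= f v) ->
  \int[lebesgue_rV n]_v f (v + w)%R = \int[lebesgue_rV n]_v f v.
Proof.
elim: n w f => [|n IH] w f mf f0.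
  by apply: eq_integral => v _; congr f; apply/rowP => -[].
have mfw := measurableT_comp mf (measurable_rV_translate w).
rewrite (ge0_integral_rV_cons mf f0) (ge0_integral_rV_cons mfw (fun v => f0 _)).
pose w' := (\row_j w ord0 (lift ord0 j))%R : 'rV[R]_n.
pose F x := \int[lebesgue_rV n]_v f (rV_cons (x, v)).
have mfc : measurable_fun setT (f \o @rV_cons R n).
  by apply: measurableT_comp mf _; exact: measurable_rV_cons.
transitivity (\int[leb1]_x F (x + w ord0 ord0)%R).
  apply: eq_integral => x _.
  under eq_integral do rewrite /= rV_cons_translate.
  rewrite (IH w' (fun v => f (rV_cons ((x + w ord0 ord0)%R, v))))//.
  exact: measurableT_comp mfc (measurable_pair1 _).
apply: ge0_integral_translate1.
  exact: (measurable_fun_fubini_tonelli_F (m2 := lebesgue_rV n) _ mfc (fun z => f0 _)).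
by move=> x; exact: integral_ge0.
Qed.

Lemma measurable_prod_coord n (f : 'I_n -> R -> R) :
  (forall i, measurable_fun setT (f i)) ->
  measurable_fun setT (fun v : 'rV[R]_n => \prod_i f i (v ord0 i))%R.
Proof.
move=> mf; apply: measurable_prod => i _.
exact: measurableT_comp (mf i) (measurable_coord i).
Qed.

Lemma ge0_integral_prod_coord n (f : 'I_n -> R -> R) :
  (forall i, measurable_fun setT (f i)) -> (forall i x, 0 <= f i x)%R ->
  \int[lebesgue_rV n]_v (\prod_i f i (v ord0 i))%:E = \prod_i \int[leb1]_x (f i x)%:E.
Proof.
elim: n f => [|n IH] f mf f0.
  rewrite big_ord0; under eq_integral do rewrite big_ord0.
  by rewrite /= integral_dirac// diracT mul1e.
rewrite ge0_integral_rV_cons//; last 2 first.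
- by apply/measurable_EFinP; exact: measurable_prod_coord.
- by move=> v; rewrite lee_fin prodr_ge0.
rewrite big_ord_recl/=.
pose g (i : 'I_n) := f (lift ord0 i).
have mg : measurable_fun setT (fun v : 'rV[R]_n => (\prod_i g i (v ord0 i))%:E).
  by apply/measurable_EFinP; apply: measurable_prod_coord => i; exact: mf.
have g0 (v : 'rV[R]_n) : 0 <= (\prod_i g i (v ord0 i))%:E.
  by rewrite lee_fin; apply: prodr_ge0 => i _; exact: f0.
transitivity (\int[leb1]_x ((f ord0 x)%:E * \prod_i \int[leb1]_x (g i x)%:E)).
  apply: eq_integral => x _; rewrite -(IH g); last 2 first.
  - by move=> i; exact: mf.
  - by move=> i y; exact: f0.
  rewrite -ge0_integralZl//; last by rewrite lee_fin.
  apply: eq_integral => v _; rewrite -EFinM; congr EFin.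
  rewrite big_ord_recl/=; congr (_ * _)%R.
    by rewrite mxE unlift_none.
  by apply: eq_bigr => i _; rewrite mxE liftK.
rewrite ge0_integralZr//.
- by apply: measurableT_comp; last exact: mf.
- by move=> x _; rewrite lee_fin.
- by apply: prode_ge0 => i _; apply: integral_ge0 => x _; rewrite lee_fin; exact: f0.
Qed.

End lebesgue_rV_theory.

(** * The Fejer kernel *)

(** Normalised to have mean 1 over a period, see [integral_fejer_period]. *)
Definition fejer (R : realType) (K : nat) (t : R) : R :=
  K%:R^-1 * normc (\sum_(b < K) e (b%:R * t)) ^+ 2.

Lemma fejer_ge0 (R : realType) (K : nat) (t : R) : 0 <= fejer K t.
Proof. by rewrite mulr_ge0 ?invr_ge0// sqr_ge0. Qed.

Lemma Re_sum (R : realType) (I : Type) (r : seq I) (F : I -> R[i]) :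
  complex.Re (\sum_(i <- r) F i) = \sum_(i <- r) complex.Re (F i).
Proof. by apply: (big_morph (@complex.Re R)) => // -[? ?] [? ?]. Qed.

Lemma sqr_normc_expi_sum (R : realType) (K : nat) (t : R) :
  ((normc (\sum_(b < K) e (b%:R * t)) ^+ 2)%:C)%C =
  \sum_(b < K) \sum_(b' < K) e ((b%:R - b'%:R) * t).
Proof.
rewrite -conjcM_normc rmorph_sum/= big_distrl/=; apply: eq_bigr => b _.
rewrite big_distrr/=; apply: eq_bigr => b' _.
transitivity (e (b%:R * t) * (e (b'%:R * t))^*%C) => //.
by rewrite conjc_expi -expiD; congr expi; ring.
Qed.

Lemma fejerE (R : realType) (K : nat) (t : R) : fejer K t =
  K%:R^-1 * \sum_(b < K) \sum_(b' < K) cos (2 * pi * (b%:R - b'%:R) * t).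
Proof.
congr (_ * _); have := congr1 (@complex.Re R) (sqr_normc_expi_sum K t).
rewrite /= => ->; rewrite Re_sum; apply: eq_bigr => b _.
by rewrite Re_sum; apply: eq_bigr => b' _; rewrite /= mulrA.
Qed.

(** Write sin x = 2 sin (x/2) cos (x/2). On [0, pi/4] the cosine is at least k = cos (pi/4), so sin
    (x/2) >= k x/2 by the mean value theorem, and 2 (k x/2) k = x/2 because k^2 = 1/2. *)
Lemma half_le_sin (R : realType) (x : R) : 0 <= x <= pi / 2 -> x / 2 <= sin x.
Proof.
move=> /andP[x0 xpi].
have pi0 := pi_gt0 R.
have c4 : cos (pi / 4) ^+ 2 = 2^-1 :> R.
  have : cos (pi / 4 + pi / 4) = 0 :> R.
    by rewrite (_ : pi / 4 + pi / 4 = pi / 2) ?cos_pihalf//; field.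
  rewrite cosD -!expr2; have := cos2Dsin2 (pi / 4 : R); lra.
have c40 : 0 < cos (pi / 4) :> R by rewrite cos_gt0_pihalf//; apply/andP; split; lra.
have cle (y : R) : 0 <= y <= pi / 4 -> cos (pi / 4) <= cos y.
  move=> /andP[y0 y4]; rewrite leNgt ltr_cos ?in_itv/= -?leNgt//.
    by apply/andP; split; lra.
  by apply/andP; split; lra.
have sx : x / 2 * cos (pi / 4) <= sin (x / 2).
  have x20 : 0 <= x / 2 by lra.
  have cs : {within `[0, x / 2], continuous (sin : R -> R)}.
    by apply: continuous_subspaceT; exact: continuous_sin.
  have [c] := MVT_segment x20 (fun y _ => is_derive_sin y) cs.
  rewrite in_itv/= sin0 !subr0 => /andP[c0 cx] ->.
  by rewrite mulrC; apply: ler_wpM2r => //; apply: cle; lra.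
have cx : cos (pi / 4) <= cos (x / 2) by apply: cle; lra.
have -> : sin x = 2 * sin (x / 2) * cos (x / 2).
  by rewrite [in LHS](_ : x = x / 2 + x / 2) ?sinD; [ring|field].
set s := sin (x / 2) in sx *; set c := cos (x / 2) in cx *; set k := cos (pi / 4) in c4 c40 sx cx.
have : x / 2 * k * k <= s * c.
  by apply: ler_pM => //; rewrite ?mulr_ge0 ?divr_ge0// ltW.
have -> : x / 2 * k * k = x / 2 * k ^+ 2 by ring.
rewrite c4; lra.
Qed.

Lemma fejer_le (R : realType) (K : nat) (t : R) : (0 < K)%N -> 0 < `|t| <= 2^-1 ->
  fejer K t <= (K%:R * t ^+ 2)^-1.
Proof.
move=> K0 /andP[t0 t2]; rewrite /fejer invfM ler_pM2l ?invr_gt0 ?ltr0n//.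
have := geometric_expi_le t K; set N := _ ^+ 2 => h.
have N0 : 0 <= N by exact: sqr_ge0.
have tt : 0 < t ^+ 2 by rewrite -real_normK ?num_real// exprn_gt0.
rewrite -[_^-1]mul1r ler_pdivlMr//; apply: le_trans h.
apply: ler_wpM2l => //.
have -> : sin (pi * t) ^+ 2 = sin (pi * `|t|) ^+ 2.
  by have [_|_] := ger0P t => //; rewrite mulrN sinN sqrrN.
rewrite -real_normK ?num_real//.
(* Since pi >= 2, sin (pi |t|) >= pi |t| / 2 >= |t|. *)
have pi2 := pi_ge2 R; have pi0 := pi_gt0 R.
have s2 : `|t| <= sin (pi * `|t|).
  apply: le_trans (half_le_sin _); first by nra.
  by apply/andP; split; [rewrite mulr_ge0// ltW|rewrite ler_wpM2l// ltW].
by rewrite ler_sqr ?nnegrE// (le_trans _ s2).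
Qed.

(** Once the square is expanded, each diagonal term gives K, and the others cancel over the K
    equally spaced nodes. *)
Lemma sum_fejer (R : realType) (K' : nat) (c : R) (K := K'.+1) :
  \sum_(j < K) fejer K (j%:R / K%:R - c) = K%:R.
Proof.
have K0 : K%:R != 0 :> R by rewrite pnatr_eq0.
rewrite -mulr_sumr.
suff -> : \sum_(j < K) normc (\sum_(b < K) e (b%:R * (j%:R / K%:R - c))) ^+ 2 = K%:R * K%:R.
  by rewrite mulrA mulVf// mul1r.
apply: (@complexI R); rewrite rmorph_sum/=.
under eq_bigr do rewrite sqr_normc_expi_sum.
rewrite exchange_big/=; under eq_bigr do rewrite exchange_big/=.
transitivity (\sum_(b < K) (K%:R)%:C%C : R[i]); last first.
  by rewrite -rmorph_sum/= sumr_const card_ord mulr_natl.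
apply: eq_bigr => b _; rewrite (bigD1 b)//= [X in _ + X]big1 ?addr0.
  transitivity (\sum_(j < K) 1 : R[i]).
    by apply: eq_bigr => j _; rewrite subrr mul0r mulr0 expi0.
  by rewrite sumr_const card_ord rmorph_nat.
move=> b' b'b.
transitivity (\sum_(j < K) e ((j%:R - c * K%:R) * ((b%:R - b'%:R) / K%:R)) : R[i]).
  by apply: eq_bigr => j _; congr expi; field.
by rewrite sum_expi_ord eq_sym (negbTE b'b) mulr0n.
Qed.

(** A primitive of y |-> cos (w (x - y)). The frequency w = 0 occurs on the diagonal b = b' of the
    Fejer sum, the only terms that contribute over a full period. *)
Definition cos_primitive (R : realType) (x w : R) (y : R) : R :=
  if w == 0 then y else - (w^-1 * sin (w * (x - y))).

Lemma is_derive_cos_primitive (R : realType) (x w y : R) :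
  is_derive y 1 (cos_primitive x w) (cos (w * (x - y))).
Proof.
rewrite /cos_primitive; case: eqP => [->|/eqP w0].
  by rewrite mul0r cos0; exact: is_derive_id.
have -> : (fun y0 : R => - (w^-1 * sin (w * (x - y0)))) =
    - (w^-1 *: ((sin : R -> R) \o (w *: (cst x - id)))) by apply/funext.
apply: is_derive_eq.
by rewrite /GRing.scale/= sub0r !mulrN mulr1 opprK mulrCA mulVf// mulr1.
Qed.

Lemma continuous_fejer (R : realType) (K : nat) (x S : R) :
  continuous (fun y => fejer K ((x - y) / S)).
Proof.
move=> y; rewrite /continuous_at.
under eq_fun do rewrite fejerE; rewrite fejerE.
apply: cvgM; first exact: cvg_cst.
apply: cvg_big => [|b _]; first exact: add_continuous.
apply: cvg_big => [|b' _]; first exact: add_continuous.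
apply: continuous_cvg; first exact: continuous_cos.
apply: cvgM; first exact: cvg_cst.
apply: cvgM; last exact: cvg_cst.
by apply: cvgB; [exact: cvg_cst|exact: cvg_id].
Qed.

Lemma measurable_fejer (R : realType) (K : nat) (x S : R) :
  measurable_fun setT (fun y : R => fejer K ((x - y) / S)).
Proof. by apply: continuous_measurable_fun; exact: continuous_fejer. Qed.

Lemma integral_fejer_period (R : realType) (K' : nat) (x S a : R) (K := K'.+1) : 0 < S ->
  (\int[lebesgue_measure]_(y in `[a, (a + S)%R]) (fejer K ((x - y) / S))%:E = S%:E)%E.
Proof.
move=> S0.
have K0 : K%:R != 0 :> R by rewrite pnatr_eq0.
pose w (b b' : 'I_K) : R := 2 * pi * (b%:R - b'%:R) / S.
pose F : R -> R := K%:R^-1 *: (\sum_(b < K) \sum_(b' < K) cos_primitive x (w b b')).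
have dF (y : R) : is_derive y 1 F (fejer K ((x - y) / S)).
  rewrite (_ : fejer _ _ = K%:R^-1 *: (\sum_(b < K) \sum_(b' < K) cos (w b b' * (x - y)))).
    apply: is_deriveZ; apply: is_derive_sum => b; apply: is_derive_sum => b'.
    exact: is_derive_cos_primitive.
  rewrite fejerE; congr (_ * _); apply: eq_bigr => b _; apply: eq_bigr => b' _.
  by congr cos; rewrite /w; ring.
have cF : continuous F.
  by move=> y; apply: differentiable_continuous; apply/derivable1_diffP; exact: ex_derive.
rewrite (continuous_FTC2 (F := F)).
- rewrite -EFinB; congr EFin; rewrite /F.
  rewrite -[LHS]/(K%:R^-1 * _ - K%:R^-1 * _) -mulrBr.
  suff -> : (\sum_(b < K) \sum_(b' < K) cos_primitive x (w b b')) (a + S) -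
            (\sum_(b < K) \sum_(b' < K) cos_primitive x (w b b')) a = K%:R * S.
    by rewrite mulrA mulVf// mul1r.
  rewrite !fct_sumE -sumrB.
  transitivity (\sum_(b < K) S); last by rewrite sumr_const card_ord mulr_natl.
  apply: eq_bigr => b _; rewrite !fct_sumE -sumrB (bigD1 b)//= big1 ?addr0.
    by rewrite /cos_primitive /w subrr mulr0 mul0r eqxx; ring.
  move=> b' b'b; rewrite /cos_primitive; case: ifPn => w0.
    move: w0; rewrite /w !mulf_eq0 invr_eq0 (gt_eqF S0) orbF.
    by rewrite pnatr_eq0/= (gt_eqF (pi_gt0 R))/= subr_eq0 eqr_nat => /eqP/val_inj bb'; rewrite bb' eqxx in b'b.
  (* The phase changes by 2 pi (b' - b), split into two natural multiples of 2 pi because [expi_nat]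
     is about natural numbers and the difference may be negative. *)
  have -> : w b b' * (x - (a + S)) = w b b' * (x - a) + 2 * pi * b'%:R + - (2 * pi * b%:R).
    by rewrite /w; field; rewrite gt_eqF.
  suff -> : sin (w b b' * (x - a) + 2 * pi * b'%:R + - (2 * pi * b%:R)) = sin (w b b' * (x - a)).
    by rewrite subrr.
  have := congr1 (@complex.Im R) (expiD (w b b' * (x - a) + 2 * pi * b'%:R) (- (2 * pi * b%:R))).
  have -> : expi (- (2 * pi * b%:R)) = 1 :> R[i] by rewrite -conjc_expi expi_nat conjc1.
  have -> : expi (w b b' * (x - a) + 2 * pi * b'%:R) = expi (w b b' * (x - a)) :> R[i].
    by rewrite [LHS]expiD expi_nat mulr1.
  by rewrite mulr1.
- by rewrite ltrDl.
- by apply: continuous_in_subspaceT => y _; exact: continuous_fejer.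
- split.
  + by move=> y _; exact: ex_derive.
  + exact/cvg_at_right_filter/cF.
  + exact/cvg_at_left_filter/cF.
- by move=> y _; rewrite derive1E; exact: derive_val.
Qed.

(* With S = s.+1 there are S^3 frequencies, spaced by S^-2 in [-S/2, S/2[; the
   successor of [nfreq s] is S^3, so that ['I_(nfreq s).+1] is visibly nonempty. *)
Definition nfreq (s : nat) : nat := (s.+1 ^ 3).-1.

Lemma nfreqE (s : nat) : (nfreq s).+1 = (s.+1 ^ 3)%N.
Proof. by rewrite prednK// expn_gt0. Qed.

Lemma nfreqR (R : realType) (s : nat) : (nfreq s).+1%:R = s.+1%:R ^+ 3 :> R.
Proof. by rewrite nfreqE natrX. Qed.

Definition grid (R : realType) (s j : nat) : R := j%:R / s.+1%:R ^+ 2 - s.+1%:R / 2.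

Definition cell (R : realType) (s j : nat) : set R :=
  `[grid R s j, (grid R s j + (s.+1%:R ^+ 2)^-1)%R[%classic.

Definition kernel1 (R : realType) (s j : nat) (y : R) : R :=
  fejer (nfreq s).+1 ((grid R s j - y) / s.+1%:R).

Lemma kernel1_ge0 (R : realType) (s j : nat) (y : R) : 0 <= kernel1 s j y.
Proof. exact: fejer_ge0. Qed.

Lemma measurable_kernel1 (R : realType) (s j : nat) : measurable_fun setT (@kernel1 R s j).
Proof. exact: measurable_fejer. Qed.

Lemma sum_kernel1 (R : realType) (s : nat) (y : R) :
  \sum_(j < (nfreq s).+1) kernel1 s j y = s.+1%:R ^+ 3.
Proof.
rewrite -nfreqR -[RHS](sum_fejer _ (2^-1 + y / s.+1%:R)).
apply: eq_bigr => j _; congr fejer; rewrite nfreqR /grid; field.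
by rewrite addrC natr1 pnatr_eq0.
Qed.

(** With K = S^3 frequencies and period S, the Fejer bound 1 / (K (u/S)^2) becomes 1 / (S u^2). Over
    a whole period the part at distance at least d then has mass at most d^-2, negligible against
    the total mass S. *)
Lemma kernel1_le (R : realType) (s j : nat) (y d : R) : 0 < d ->
  d <= `|grid R s j - y| <= s.+1%:R / 2 -> kernel1 s j y <= (s.+1%:R * d ^+ 2)^-1.
Proof.
move=> d0 /andP[dy yS].
set S : R := s.+1%:R in yS *; have S0 : 0 < S by rewrite ltr0n.
set u : R := grid R s j - y in dy yS *.
have uS : `|u / S| = `|u| / S by rewrite normrM normfV [`|S|]gtr0_norm.
apply: le_trans (fejer_le _ _) _ => //.
  rewrite uS divr_gt0 ?(lt_le_trans d0 dy)//=.
  by rewrite ler_pdivrMr// mulrC.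
rewrite nfreqR -/S lef_pV2 ?posrE; last 2 first.
- apply: mulr_gt0; first exact: exprn_gt0.
  by rewrite -/u -real_normK ?num_real// uS exprn_gt0// divr_gt0// (lt_le_trans d0 dy).
- by rewrite mulr_gt0 ?exprn_gt0.
rewrite -/u; have -> : S ^+ 3 * (u / S) ^+ 2 = S * u ^+ 2 by field; rewrite gt_eqF.
by rewrite ler_pM2l// -[u ^+ 2]real_normK ?num_real// ler_sqr// nnegrE ltW.
Qed.

Lemma kernel1_tail (R : realType) (s j : nat) (d : R) (A : set R) : 0 < d -> measurable A ->
    (forall y, A y -> d <= `|grid R s j - y| <= s.+1%:R / 2) ->
  (\int[lebesgue_measure]_(y in A) (kernel1 s j y)%:E <=
    ((s.+1%:R * d ^+ 2)^-1)%:E * lebesgue_measure A)%E.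
Proof.
move=> d0 mA Ad.
rewrite -integral_cst//; apply: ge0_le_integral => //.
- by move=> y _; rewrite lee_fin kernel1_ge0.
- by apply/measurable_EFinP; apply: measurable_funTS; exact: measurable_kernel1.
- by move=> y Ay; rewrite lee_fin kernel1_le// Ad.
Qed.

Lemma kernel1_period (R : realType) (s j : nat) :
  (\int[lebesgue_measure]_(y in `[(grid R s j - s.+1%:R / 2)%R, (grid R s j + s.+1%:R / 2)%R])
     (kernel1 s j y)%:E = s.+1%:R%:E)%E.
Proof.
have -> : grid R s j + s.+1%:R / 2 = grid R s j - s.+1%:R / 2 + s.+1%:R by lra.
by rewrite integral_fejer_period// ltr0n.
Qed.

Lemma kernel1_le_period (R : realType) (s j : nat) (A : set R) : measurable A ->
    (forall y, A y -> `|grid R s j - y| <= s.+1%:R / 2) ->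
  (\int[lebesgue_measure]_(y in A) (kernel1 s j y)%:E <= s.+1%:R%:E)%E.
Proof.
move=> mA AS; rewrite -(kernel1_period R s j); apply: ge0_subset_integral => //.
- by apply/measurable_EFinP; apply: measurable_funTS; exact: measurable_kernel1.
- by move=> y _; rewrite lee_fin kernel1_ge0.
- move=> y /AS; rewrite /= in_itv/= ler_norml => /andP[h1 h2].
  by apply/andP; split; lra.
Qed.

(** The part of the period missed by A lies at distance at least d from the centre, where the tail
    bound, applied over the length S, leaves at most d^-2. *)
Lemma kernel1_bulk (R : realType) (s j : nat) (d : R) (A : set R) : 0 < d -> measurable A ->
    (forall y, A y -> `|grid R s j - y| <= s.+1%:R / 2) ->
    (forall y, `|grid R s j - y| < d -> A y) ->
  (s.+1%:R%:E - (d ^- 2)%:E <= \int[lebesgue_measure]_(y in A) (kernel1 s j y)%:E)%E.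
Proof.
move=> d0 mA AS Ad.
set S : R := s.+1%:R in AS *; have S0 : 0 < S by rewrite ltr0n.
pose P : set R := `[(grid R s j - S / 2)%R, (grid R s j + S / 2)%R]%classic.
have mP : measurable P by exact: measurable_itv.
have PE y : P y <-> `|grid R s j - y| <= S / 2.
  rewrite /P /= in_itv/= ler_norml; split => /andP[h1 h2]; apply/andP; split; lra.
have AP : A `<=` P by move=> y /AS /PE.
have mk : measurable_fun P (fun y => (kernel1 s j y)%:E).
  by apply/measurable_EFinP; apply: measurable_funTS; exact: measurable_kernel1.
have := kernel1_period R s j; rewrite -/S -/P -(setDUK AP).
rewrite ge0_integral_setU//; last 4 first.
- exact: measurableD.
- by rewrite setDUK.
- by move=> y _; rewrite lee_fin kernel1_ge0.
- by apply/disj_setPS => y [Ay [_ /(_ Ay)]].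
move=> <-; rewrite leeBlDr// leeD2l//.
apply: le_trans (kernel1_tail (d := d) d0 _ _) _.
- exact: measurableD.
- by move=> y [/PE -> nAy]; rewrite andbT leNgt; apply/negP => /Ad.
apply: (@le_trans _ _ (((S * d ^+ 2)^-1)%:E * lebesgue_measure P)%E).
  apply: lee_wpmul2l; first by rewrite lee_fin invr_ge0 mulr_ge0 ?sqr_ge0// ltW.
  by apply: le_measure; rewrite ?inE//; exact: measurableD.
rewrite /P lebesgue_measure_itv/= lte_fin ltrD2l gtrN ?divr_gt0//.
rewrite -EFinD -EFinM lee_fin; apply: eq_leW.
by field; rewrite !gt_eqF.
Qed.

(** The S^3 cells of length S^-2 tile [-S/2, S/2[, and the index of x is the integer part of (x +
    S/2) S^2. *)
Lemma cell_index (R : realType) (s : nat) (x : R) : `|x| < s.+1%:R / 2 ->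
  exists j : 'I_(nfreq s).+1, forall j' : 'I_(nfreq s).+1, cell s j' x <-> j' = j.
Proof.
set S : R := s.+1%:R; have S0 : 0 < S by rewrite ltr0n.
rewrite ltr_norml => /andP[x1 x2].
pose z := (x + S / 2) * S ^+ 2.
have z0 : 0 <= z by rewrite mulr_ge0 ?sqr_ge0//; lra.
have zK : z < (nfreq s).+1%:R.
  have xS : x + S / 2 < S by lra.
  by rewrite nfreqR -/S exprS ltr_pM2r ?exprn_gt0.
pose j := Num.truncn z.
have /andP[jz zj] : j%:R <= z < j.+1%:R by exact: truncn_itv.
have jK : (j < (nfreq s).+1)%N by rewrite -(ltr_nat R) (le_lt_trans jz).
have cellE (i : nat) : cell s i x <-> i%:R <= z < i.+1%:R.
  rewrite /cell /= in_itv/= /grid -/S.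
  have -> : (i%:R / S ^+ 2 - S / 2 <= x) = (i%:R <= z).
    by rewrite lerBlDr ler_pdivrMr ?exprn_gt0.
  have -> : (x < i%:R / S ^+ 2 - S / 2 + (S ^+ 2)^-1) = (z < i.+1%:R).
    rewrite addrAC ltrBrDr -[i.+1%:R]natr1.
    have -> : i%:R / S ^+ 2 + (S ^+ 2)^-1 = (i%:R + 1) / S ^+ 2 by rewrite mulrDl mul1r.
    by rewrite ltr_pdivlMr ?exprn_gt0.
  by [].
exists (Ordinal jK) => j'; rewrite cellE; split => [/andP[h1 h2]|->/=]; last by apply/andP.
apply/val_inj => /=; apply/eqP; rewrite eqn_leq; apply/andP; split.
  by rewrite -ltnS -(ltr_nat R) (le_lt_trans h1 zj).
by rewrite -ltnS -(ltr_nat R) (le_lt_trans jz h2).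
Qed.

(** The averaging operator on an indicator of one variable; on the indicator of a box the operator
    is a product of these, see [smear_box]. *)
Definition smear1 (R : realType) (s : nat) (A : set R) (x : R) : R :=
  \sum_(j < (nfreq s).+1) \1_(cell s j) x *
    (s.+1%:R^-1 * fine (\int[lebesgue_measure]_(y in A) (kernel1 s j y)%:E)).

Lemma smear1E (R : realType) (s : nat) (A : set R) (x : R) : `|x| < s.+1%:R / 2 ->
  exists j, `|grid R s j - x| <= s.+1%:R^-1 /\
    smear1 s A x = s.+1%:R^-1 * fine (\int[lebesgue_measure]_(y in A) (kernel1 s j y)%:E).
Proof.
move=> /cell_index[j hj]; exists j; split.
  have /hj : j = j by []; rewrite /cell/= in_itv/= => /andP[h1 h2].
  rewrite distrC ger0_norm ?subr_ge0// lerBlDl (le_trans (ltW h2))// lerD2l.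
  rewrite lef_pV2 ?posrE ?exprn_gt0 ?ltr0n// -natrX ler_nat.
  by rewrite expnS expn1 leq_pmulr.
rewrite /smear1 (bigD1 j)//= big1 ?addr0.
  by rewrite indicE mem_set ?mul1r//; apply/hj.
by move=> j' jj'; rewrite indicE memNset ?mul0r// => /hj jE; rewrite jE eqxx in jj'.
Qed.

(** The point x is within 1/S <= 1 of its grid point, so [2 * r + 1 <= S / 2] keeps all of A within
    half a period of that grid point, where the kernel has mass at most S. *)
Lemma smear1_bound (R : realType) (s : nat) (r : R) (A : set R) (x : R) : measurable A ->
    (forall y, A y -> `|y| <= r) -> `|x| <= r -> 2 * r + 1 <= s.+1%:R / 2 ->
  0 <= smear1 s A x <= 1.
Proof.
move=> mA Ar xr rS.
have S1 : 1 <= s.+1%:R :> R by rewrite ler1n.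
have xS : `|x| < s.+1%:R / 2 by have := normr_ge0 x; lra.
have [j [jx ->]] := smear1E A xS.
have Sx : s.+1%:R^-1 <= 1 :> R by rewrite invf_le1// ltr0n.
set I := integral _ _ _.
have I0 : (0 <= I)%E by apply: integral_ge0 => y _; rewrite lee_fin kernel1_ge0.
have IS : (I <= s.+1%:R%:E)%E.
  apply: kernel1_le_period => // y /Ar yr.
  have h1 := ler_distD x (grid R s j) y; have h2 := ler_normB x y.
  rewrite (le_trans h1)// (le_trans (lerD jx (le_trans h2 (lerD xr yr))))//.
  have -> : r + r = 2 * r by ring.
  by rewrite (le_trans _ rS)// addrC lerD2l.
have If : I \is a fin_num by rewrite ge0_fin_numE// (le_lt_trans IS)// ltry.
rewrite mulr_ge0 ?invr_ge0 ?fine_ge0//= mulrC ler_pdivrMr ?ltr0n// mul1r.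
by rewrite -lee_fin fineK.
Qed.

Lemma smear1_cvg (R : realType) (a b x : R) : x != a -> x != b ->
  (fun s => smear1 s `]a, b]%classic x) @ \oo --> (\1_(`]a, b]%classic) x : R).
Proof.
move=> xa xb.
have [ba|ab] := leP b a.
  have -> : `]a, b]%classic = set0 :> set R by apply/eqP; rewrite set_itv_ge// bnd_simp -leNgt.
  rewrite indicE in_set0/=.
  rewrite (_ : (fun s => _) = cst 0); first exact: cvg_cst.
  apply/funext => s; rewrite /smear1 big1// => j _.
  by rewrite integral_set0/= mulr0 mulr0.
(* With a third of the distance to the endpoints and the grid point within d of x, the ball of
   radius d around the grid point stays on the same side of each endpoint as x. *)
pose d := Num.min `|x - a| `|x - b| / 3.
have d0 : 0 < d by rewrite divr_gt0// lt_min !normr_gt0 !subr_eq0 xa.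
have da : 3 * d <= `|x - a| by rewrite mulrC divfK// ge_min lexx.
have db : 3 * d <= `|x - b| by rewrite mulrC divfK// ge_min lexx orbT.
pose r := `|x| + `|a| + `|b|.
(* The error is at most d^-2 / S if x lies in the interval and (b - a) / (S^2 d^2) otherwise; the
   constant covers both. *)
have key s : d^-1 <= s.+1%:R -> 2 * r + 1 + d <= s.+1%:R / 2 ->
    `|smear1 s `]a, b]%classic x - \1_(`]a, b]%classic) x| <=
    (b - a + 1) / (d ^+ 2) * s.+1%:R^-1.
  set S : R := s.+1%:R => dS rS.
  have S1 : 1 <= S by rewrite ler1n.
  have S0 : 0 < S by rewrite ltr0n.
  have nx := normr_ge0 x; have na := normr_ge0 a; have nb := normr_ge0 b.
  have xS : `|x| < S / 2 by rewrite /r in rS; lra.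
  have [j [jx ->]] := smear1E `]a, b]%classic xS.
  have {}jx : `|grid R s j - x| <= d.
    by rewrite (le_trans jx)// -[leRHS]invrK lef_pV2 ?posrE ?invr_gt0.
  set I := integral _ _ _.
  have I0 : (0 <= I)%E by apply: integral_ge0 => y _; rewrite lee_fin kernel1_ge0.
  have mI : measurable `]a, b]%classic by exact: measurable_itv.
  have AS y : `]a, b]%classic y -> `|grid R s j - y| <= S / 2.
    rewrite /= in_itv/= => /andP[ay yb]; move: jx rS; rewrite /r.
    have := ler_norm a; have := ler_norm (- a); rewrite normrN.
    have := ler_norm b; have := ler_norm (- b); rewrite normrN.
    have := ler_norm x; have := ler_norm (- x); rewrite normrN.
    by rewrite !ler_norml => ? ? ? ? ? ? /andP[? ?] ?; apply/andP; split; lra.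
  have IS : (I <= S%:E)%E by exact: kernel1_le_period.
  have If : I \is a fin_num by rewrite ge0_fin_numE// (le_lt_trans IS)// ltry.
  have d20 : 0 < d ^+ 2 by rewrite exprn_gt0.
  have [xab|xab] := boolP (x \in `]a, b]%classic).
    have : (S%:E - (d ^- 2)%:E <= I)%E.
      apply: (kernel1_bulk d0 mI AS) => y jy.
      move: xab; rewrite inE /= in_itv/= => /andP[ax xb'].
      move: da db jx jy; rewrite ger0_norm; last lra.
      rewrite ler0_norm; last lra.
      rewrite ltr_norml ler_norml => ? ? /andP[? ?] /andP[? ?].
      by rewrite in_itv/=; apply/andP; split; lra.
    move: IS; rewrite -(fineK If) -EFinB !lee_fin => h1 h2.
    rewrite indicE xab/= distrC ger0_norm; last first.
      by rewrite subr_ge0 mulrC ler_pdivrMr// mul1r.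
    rewrite -(ler_pM2r S0) mulrBl mul1r mulfVK ?gt_eqF// mulrAC mulVf ?gt_eqF// mul1r.
    apply: (@le_trans _ _ (d ^- 2)); first lra.
    by rewrite -[leLHS]mul1r ler_pM2r ?invr_gt0//; lra.
  have : (I <= ((S * d ^+ 2)^-1)%:E * lebesgue_measure (`]a, b]%classic : set R))%E.
    apply: kernel1_tail => // y yab; rewrite AS// andbT.
    move: xab yab; rewrite notin_setE /= !in_itv/= => /negP; rewrite negb_and -leNgt -ltNge.
    move=> xab /andP[ay yb]; move: da db jx.
    rewrite ler_norml => h1 h2 /andP[h3 h4].
    case/orP : xab => h.
      move: h1; rewrite ler0_norm; last lra.
      by move=> h1; rewrite distrC ger0_norm; lra.
    move: h2; rewrite ger0_norm; last lra.
    by move=> h2; rewrite ger0_norm; lra.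
  rewrite lebesgue_measure_itv/= lte_fin ab -EFinB -EFinM -(fineK If) lee_fin => h.
  rewrite indicE (negbTE xab) subr0 /= ger0_norm; last by rewrite mulr_ge0 ?invr_ge0 ?(ltW S0)// fine_ge0.
  rewrite mulrC ler_pM2r ?invr_gt0// (le_trans h)//.
  have -> : (S * d ^+ 2)^-1 * (b - a) = S^-1 * ((b - a) / d ^+ 2) by field; rewrite !gt_eqF.
  have Sv : S^-1 <= 1 by rewrite invf_le1.
  apply: (@le_trans _ _ ((b - a) / d ^+ 2)).
    by rewrite ler_piMl// divr_ge0 ?(ltW d20)//; lra.
  by rewrite ler_pM2r ?invr_gt0//; lra.
apply/cvgrPdist_le => /= eps eps0.
near=> s.
rewrite distrC (le_trans (key s _ _))//.
- by rewrite (le_trans (ltW (truncnS_gt _)))// ler_nat ltnS; near: s; exact: nbhs_infty_ge.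
- rewrite ler_pdivlMr//.
  by rewrite (le_trans (ltW (truncnS_gt _)))// ler_nat ltnS; near: s; exact: nbhs_infty_ge.
- rewrite ler_pdivrMr ?ltr0n// -ler_pdivrMl//.
  by rewrite (le_trans (ltW (truncnS_gt _)))// ler_nat ltnS; near: s; exact: nbhs_infty_ge.
Unshelve. all: by end_near.
Qed.

(** * Smoothing by the Fejer kernel on a grid *)

Local Notation leb n := (lebesgue_rV n).
Local Notation freq n s := {ffun 'I_n -> 'I_(nfreq s).+1}.

Definition fejer_kernel (R : realType) (n s : nat) (j : freq n s)
  (v : 'rV[R]_n) : R := \prod_i kernel1 s (j i) (v ord0 i).

Definition cellv (R : realType) (n s : nat) (j : freq n s)
  (v : 'rV[R]_n) : R := \prod_i \1_(cell s (j i)) (v ord0 i).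

(* Piecewise constant on the cells of the grid; S^-n is the reciprocal of the
   integral of [fejer_kernel j] over a period. *)
Definition smear (R : realType) (n s : nat) (g : 'rV[R]_n -> R) (v : 'rV[R]_n) : R :=
  \sum_(j : freq n s) cellv j v * ((s.+1%:R ^+ n)^-1 * \int[leb n]_u (g u * fejer_kernel j u)).

Lemma fejer_kernel_ge0 (R : realType) (n s : nat) (j : freq n s)
  (v : 'rV[R]_n) : 0 <= fejer_kernel j v.
Proof. by apply: prodr_ge0 => i _; exact: kernel1_ge0. Qed.

Lemma cellv_ge0 (R : realType) (n s : nat) (j : freq n s)
  (v : 'rV[R]_n) : 0 <= cellv j v.
Proof. by apply: prodr_ge0 => i _; rewrite indicE. Qed.

Lemma measurable_fejer_kernel (R : realType) (n s : nat) (j : freq n s) :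
  measurable_fun setT (@fejer_kernel R n s j).
Proof.
apply: (@measurable_prod_coord R n (fun i => kernel1 s (j i))) => i.
exact: measurable_kernel1.
Qed.

Lemma measurable_cellv (R : realType) (n s : nat) (j : freq n s) :
  measurable_fun setT (@cellv R n s j).
Proof.
apply: (@measurable_prod_coord R n (fun i => \1_(cell s (j i)))) => i.
by apply: measurable_indic; exact: measurable_itv.
Qed.

Lemma sum_fejer_kernel (R : realType) (n s : nat) (v : 'rV[R]_n) :
  \sum_(j : freq n s) fejer_kernel j v = (s.+1%:R ^+ 3) ^+ n.
Proof.
rewrite -[RHS](_ : \prod_(i < n) \sum_(t < (nfreq s).+1) kernel1 s t (v ord0 i) = _).
  by rewrite bigA_distr_bigA.
under eq_bigr do rewrite sum_kernel1.
by rewrite prodr_const card_ord.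
Qed.

Lemma fejer_kernel_le (R : realType) (n s : nat) (j : freq n s)
  (v : 'rV[R]_n) : fejer_kernel j v <= (s.+1%:R ^+ 3) ^+ n.
Proof.
rewrite -(sum_fejer_kernel s v) (bigD1 j)//= lerDl sumr_ge0// => j' _; exact: fejer_kernel_ge0.
Qed.

Lemma integrable_fejer_kernel (R : realType) (n s : nat) (j : freq n s)
    (g : 'rV[R]_n -> R) : (leb n).-integrable setT (EFin \o g) ->
  (leb n).-integrable setT (EFin \o (fun u => g u * fejer_kernel j u)).
Proof.
move=> ig; have /integrableP[/measurable_EFinP mg _] := ig.
apply: (le_integrable _ _ _ (integrableZl measurableT ((s.+1%:R ^+ 3) ^+ n) ig)) => //.
  by apply/measurable_EFinP; apply: measurable_funM => //; exact: measurable_fejer_kernel.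
move=> u _ /=; rewrite lee_fin normrM mulrC normrM ler_wpM2r//.
by rewrite !ger0_norm ?exprn_ge0 ?fejer_kernel_ge0// fejer_kernel_le.
Qed.

Lemma lebesgue_measure_cell (R : realType) (s j : nat) :
  lebesgue_measure (@cell R s j) = ((s.+1%:R ^+ 2)^-1)%:E.
Proof.
rewrite /cell lebesgue_measure_itv/= lte_fin ltrDl invr_gt0 exprn_gt0 ?ltr0n//.
by rewrite -EFinB addrC addKr.
Qed.

Lemma integral_cellv (R : realType) (n s : nat) (j : freq n s) :
  (\int[leb n]_v (@cellv R n s j v)%:E = ((s.+1%:R ^+ 2) ^- n)%:E)%E.
Proof.
rewrite (@ge0_integral_prod_coord R n (fun i => \1_(cell s (j i)))); last 2 first.
- by move=> i; apply: measurable_indic; exact: measurable_itv.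
- by move=> i x; rewrite indicE.
rewrite (eq_bigr (fun=> ((s.+1%:R ^+ 2)^-1)%:E)); last first.
  move=> i _; rewrite integral_indic//; last exact: measurable_itv.
  by rewrite setIT; exact: lebesgue_measure_cell.
by rewrite -(big_morph EFin EFinM erefl) prodr_const card_ord exprVn.
Qed.

Lemma measurable_smear (R : realType) (n s : nat) (g : 'rV[R]_n -> R) :
  measurable_fun setT (smear s g).
Proof.
apply: measurable_sum => j; apply: measurable_funM => //; exact: measurable_cellv.
Qed.

(** After exchanging sum and integral, the kernels sum to S^(3n) at every point, and this cancels
    the normalisation S^-n and the cell volume S^(-2n). *)
Lemma smear_contraction (R : realType) (n s : nat) (g : 'rV[R]_n -> R) :
  (leb n).-integrable setT (EFin \o g) ->
  (\int[leb n]_v (`|smear s g v|)%:E <= \int[leb n]_v (`|g v|)%:E)%E.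
Proof.
move=> ig; have /integrableP[/measurable_EFinP mg _] := ig.
have mng : measurable_fun setT (fun v => `|g v|) by exact: measurableT_comp.
have ing : (leb n).-integrable setT (EFin \o (fun v => `|g v|)).
  exact: integrable_abse ig.
set c := (s.+1%:R ^+ n)^-1 : R.
have c0 : 0 <= c by rewrite invr_ge0 exprn_ge0.
pose I (j : freq n s) : R := \int[leb n]_u (`|g u| * fejer_kernel j u).
have I0 j : 0 <= I j by apply: Rintegral_ge0 => u _; rewrite mulr_ge0// fejer_kernel_ge0.
apply: (@le_trans _ _ (\int[leb n]_v (\sum_(j : freq n s) cellv j v * (c * I j))%:E)%E).
  apply: ge0_le_integral => //.
  - apply/measurable_EFinP; apply: measurableT_comp => //; exact: measurable_smear.
  - apply/measurable_EFinP; apply: measurable_sum => j.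
    by apply: measurable_funM => //; exact: measurable_cellv.
  - move=> v _; rewrite lee_fin (le_trans (ler_norm_sum _ _ _))//.
    apply: ler_sum => j _; rewrite normrM ger0_norm ?cellv_ge0//.
    apply: ler_wpM2l; first exact: cellv_ge0.
    rewrite normrM ger0_norm//; apply: ler_wpM2l => //.
    apply: (le_trans (le_normr_Rintegral _ _)) => //; first exact: integrable_fejer_kernel.
    apply: eq_leW; apply: eq_Rintegral => u _.
    by rewrite normrM [`|fejer_kernel j u|]ger0_norm ?fejer_kernel_ge0.
under eq_integral do rewrite -sumEFin.
rewrite ge0_integral_sum//; last 2 first.
- move=> j; apply/measurable_EFinP; apply: measurable_funM => //; exact: measurable_cellv.
- by move=> j v _; rewrite lee_fin !mulr_ge0// cellv_ge0.
have E j : (\int[leb n]_v (cellv j v * (c * I j))%:E =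
    (c * (s.+1%:R ^+ 2) ^- n)%:E * \int[leb n]_u (`|g u| * fejer_kernel j u)%:E)%E.
  under eq_integral do rewrite EFinM.
  rewrite ge0_integralZr//; last 3 first.
  - by apply/measurable_EFinP; exact: measurable_cellv.
  - by move=> v _; rewrite lee_fin cellv_ge0.
  - by rewrite lee_fin mulr_ge0.
  rewrite integral_cellv -EFinM mulrCA mulrA EFinM; congr (_ * _)%E.
  rewrite /I /Rintegral fineK//.
  by apply: integrable_fin_num => //; exact: integrable_fejer_kernel.
under eq_bigr do rewrite E.
rewrite -ge0_sume_distrr; last first.
  by move=> j _; apply: integral_ge0 => u _; rewrite lee_fin mulr_ge0// fejer_kernel_ge0.
rewrite -ge0_integral_sum//; last 2 first.
- move=> j; apply/measurable_EFinP; apply: measurable_funM => //; exact: measurable_fejer_kernel.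
- by move=> j u _; rewrite lee_fin mulr_ge0// fejer_kernel_ge0.
under eq_integral do rewrite sumEFin -mulr_sumr sum_fejer_kernel EFinM.
rewrite ge0_integralZr//; last exact/measurable_EFinP.
rewrite muleCA -EFinM (_ : c * _ * _ = 1) ?mule1//.
rewrite /c; set S : R := s.+1%:R; have S0 : S != 0 by rewrite pnatr_eq0.
rewrite [S ^+ 3]exprS [(S * S ^+ 2) ^+ n]exprMn.
have : S ^+ n != 0 by rewrite expf_neq0.
have : (S ^+ 2) ^+ n != 0 by rewrite !expf_neq0.
move: (S ^+ n) ((S ^+ 2) ^+ n) => x y y0 x0.
by rewrite mulrACA mulVf// mul1r mulVf.
Qed.

Lemma smearB (R : realType) (n s : nat) (g h : 'rV[R]_n -> R) (v : 'rV[R]_n) :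
  (leb n).-integrable setT (EFin \o g) -> (leb n).-integrable setT (EFin \o h) ->
  smear s (fun u => g u - h u) v = smear s g v - smear s h v.
Proof.
move=> ig ih; rewrite /smear -sumrB; apply: eq_bigr => j _.
rewrite -mulrBr -mulrBr; congr (_ * (_ * _)).
under eq_Rintegral do rewrite mulrBl.
by rewrite RintegralB//; exact: integrable_fejer_kernel.
Qed.

Lemma smearZ (R : realType) (n s : nat) (a : R) (g : 'rV[R]_n -> R) (v : 'rV[R]_n) :
  (leb n).-integrable setT (EFin \o g) ->
  smear s (fun u => a * g u) v = a * smear s g v.
Proof.
move=> ig; rewrite /smear mulr_sumr; apply: eq_bigr => j _.
under eq_Rintegral do rewrite -mulrA.
by rewrite RintegralZl//; [ring|exact: integrable_fejer_kernel].
Qed.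

Lemma smear_box (R : realType) (n s : nat) (A : 'I_n -> set R) (r : R) (v : 'rV[R]_n) :
  (forall i, measurable (A i)) -> (forall i x, A i x -> `|x| <= r) ->
  smear s (fun u => \prod_i \1_(A i) (u ord0 i)) v = \prod_i smear1 s (A i) (v ord0 i).
Proof.
move=> mA Ar.
rewrite /smear1 bigA_distr_bigA/=; apply: eq_bigr => j _.
rewrite [RHS]big_split/= ; congr (_ * _).
rewrite [RHS]big_split/= prodr_const card_ord exprVn; congr (_ * _).
rewrite /Rintegral.
under eq_integral do rewrite -big_split/=.
rewrite (@ge0_integral_prod_coord R n (fun i x => \1_(A i) x * kernel1 s (j i) x)); last 2 first.
- by move=> i; apply: measurable_funM; [exact: measurable_indic|exact: measurable_kernel1].
- by move=> i x; rewrite mulr_ge0 ?kernel1_ge0// indicE.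
have E i : (\int[lebesgue_measure]_x (\1_(A i) x * kernel1 s (j i) x)%:E =
    (fine (\int[lebesgue_measure]_(x in A i) (kernel1 s (j i) x)%:E))%:E)%E.
  rewrite fineK.
    rewrite [RHS]integral_mkcond; apply: eq_integral => x _.
    by rewrite patchE indicE; case: ifPn => _; rewrite ?mul1r// mul0r.
  rewrite ge0_fin_numE; last by apply: integral_ge0 => x _; rewrite lee_fin kernel1_ge0.
  apply: (@le_lt_trans _ _ (\int[lebesgue_measure]_(x in A i) (s.+1%:R ^+ 3)%:E)%E).
    apply: ge0_le_integral => //.
    - exact: mA.
    - by move=> x _; rewrite lee_fin kernel1_ge0.
    - by apply/measurable_EFinP; apply: measurable_funTS; exact: measurable_kernel1.
    - move=> x _; rewrite lee_fin -(sum_kernel1 s x) (bigD1 (j i))//= lerDl sumr_ge0// => k _.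
      exact: kernel1_ge0.
  rewrite integral_cst//; last exact: mA.
  rewrite lte_mul_pinfty ?lee_fin ?exprn_ge0//.
  apply: (@le_lt_trans _ _ (lebesgue_measure (`[(- r)%R, r]%classic : set R))).
    apply: (le_measure (@lebesgue_measure R)); rewrite ?inE.
    - exact: mA.
    - exact: measurable_itv.
    - by move=> x /Ar; rewrite /= in_itv/= ler_norml.
  by rewrite lebesgue_measure_itv/=; case: ifP => // _; rewrite -EFinB ltry.
rewrite (eq_bigr _ (fun i _ => E i)).
by rewrite -(big_morph EFin EFinM erefl).
Qed.

(** * Boxes, hyperplanes and windows *)

Definition setbox (R : realType) (n : nat) (A : 'I_n -> set R) : set 'rV[R]_n :=
  [set v | forall i, A i (v ord0 i)].

Lemma indic_setbox (R : realType) (n : nat) (A : 'I_n -> set R) (v : 'rV[R]_n) :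
  \1_(setbox A) v = \prod_i \1_(A i) (v ord0 i) :> R.
Proof.
rewrite indicE; have [/set_mem Av|/negP Av] := boolP (v \in setbox A).
  by rewrite big1// => i _; rewrite indicE mem_set.
have /existsNP[i Ai] : ~ setbox A v by move=> Av'; apply: Av; exact/mem_set.
by rewrite (bigD1 i)//= indicE memNset// mul0r.
Qed.

Lemma measurable_setbox (R : realType) (n : nat) (A : 'I_n -> set R) :
  (forall i, measurable (A i)) -> measurable (setbox A).
Proof.
move=> mA; rewrite (_ : setbox A =
    \bigcap_(i in [set: 'I_n]) ((fun v : 'rV[R]_n => v ord0 i) @^-1` A i)).
  apply: fin_bigcap_measurable => // i _; rewrite -[X in measurable X]setTI.
  exact: (measurable_coord i).
by apply/seteqP; split => v /= h i; [move=> _; exact: h|exact: h].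
Qed.

Lemma lebesgue_setbox (R : realType) (n : nat) (A : 'I_n -> set R) :
  (forall i, measurable (A i)) -> leb n (setbox A) = (\prod_i lebesgue_measure (A i))%E.
Proof.
move=> mA; rewrite -[setbox A]setIT -integral_indic//; last exact: measurable_setbox.
transitivity (\int[leb n]_v (\prod_i \1_(A i) (v ord0 i))%:E)%E.
  by apply: eq_integral => v _; rewrite /= indic_setbox.
rewrite (@ge0_integral_prod_coord R n (fun i => \1_(A i))); last 2 first.
- by move=> i; apply: measurable_indic; exact: mA.
- by move=> i x; rewrite indicE.
apply: eq_bigr => i _; rewrite integral_indic ?setIT//; exact: mA.
Qed.

Lemma measurable_hyperplane (R : realType) (n : nat) (i : 'I_n) (c : R) :
  measurable [set v : 'rV[R]_n | v ord0 i = c].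
Proof.
have := measurable_coord i measurableT (measurable_set1 c).
by rewrite setTI.
Qed.

Lemma lebesgue_hyperplane (R : realType) (n : nat) (i : 'I_n) (c : R) :
  leb n [set v | v ord0 i = c] = 0%E.
Proof.
rewrite [X in leb n X](_ : _ = setbox (fun k => if k == i then [set c] else setT)).
  rewrite lebesgue_setbox; last by move=> k; case: ifP => _; [exact: measurable_set1|exact: measurableT].
  by rewrite (bigD1 i)//= eqxx lebesgue_measure_set1 mul0e.
apply/seteqP; split => v /=.
  by move=> vi k; case: eqP => [->|].
by move=> /(_ i); rewrite eqxx.
Qed.

Definition window (R : realType) (n r : nat) : set 'rV[R]_n :=
  setbox (fun=> `]- r%:R, r%:R]%classic).

Lemma measurable_window (R : realType) (n r : nat) : measurable (@window R n r).
Proof. by apply: measurable_setbox => i; exact: measurable_itv. Qed.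

Lemma lebesgue_window (R : realType) (n r : nat) : (leb n (@window R n r) < +oo)%E.
Proof.
rewrite lebesgue_setbox; last by move=> i; exact: measurable_itv.
rewrite (eq_bigr (fun=> (r%:R + r%:R : R)%:E)).
  by rewrite -(big_morph EFin EFinM erefl) ltry.
move=> i _; rewrite lebesgue_measure_itv/= lte_fin.
case: ifPn; first by rewrite -EFinB opprK.
rewrite -leNgt => h; have r0 : 0 <= r%:R :> R by [].
by congr EFin; lra.
Qed.

Lemma bigcup_window (R : realType) (n : nat) (v : 'rV[R]_n) :
  \forall r \near \oo, window r v.
Proof.
near=> r; move=> i; rewrite /= in_itv/=.
have h : `|v ord0 i| < r%:R.
  apply: (@le_lt_trans _ _ (\sum_k `|v ord0 k|)).
    by rewrite (bigD1 i)//= lerDl sumr_ge0.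
  rewrite (lt_le_trans (truncnS_gt _))// ler_nat.
  by near: r; exact: nbhs_infty_ge.
by move: h; rewrite ltr_norml => /andP[-> /ltW ->].
Unshelve. all: by end_near. Qed.

(** * Convergence of the averages in L^1 on windows *)

Lemma ge0_cvge0P (R : realType) (u : (\bar R)^nat) : (forall k, 0 <= u k)%E ->
  u @ \oo --> 0%E <-> forall eps : R, 0 < eps -> \forall k \near \oo, (u k <= eps%:E)%E.
Proof.
move=> u0; split.
  move=> /fine_cvgP[uf /cvgrPdist_le h] eps eps0.
  near=> k; have ufk : u k \is a fin_num by near: k.
  rewrite -(fineK ufk) lee_fin.
  have : `|0 - fine (u k)| <= eps by near: k; exact: h.
  by rewrite sub0r normrN ger0_norm// fine_ge0.
move=> h; apply/fine_cvgP; split.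
  near=> k; rewrite ge0_fin_numE//.
  by apply: (@le_lt_trans _ _ 1%:E); [near: k; exact: h|exact: ltry].
apply/cvgrPdist_le => /= eps eps0; near=> k.
have uk : (u k <= eps%:E)%E by near: k; exact: h.
rewrite sub0r normrN ger0_norm ?fine_ge0//.
by rewrite -lee_fin fineK// ge0_fin_numE// (le_lt_trans uk)// ltry.
Unshelve. all: by end_near. Qed.

Lemma integrable_setbox (R : realType) (n : nat) (A : set 'rV[R]_n) : measurable A ->
  (leb n A < +oo)%E -> (leb n).-integrable setT (EFin \o \1_A).
Proof.
move=> mA fA; apply/integrableP; split.
  by apply/measurable_EFinP; exact: measurable_indic.
rewrite (_ : \int[_]_x _ = leb n A)%E//.
by rewrite -[in RHS](setIT A) -integral_indic//; apply: eq_integral => x _; rewrite /= ger0_norm.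
Qed.

(** Convergence in L^1 rather than pointwise, because by [smear_contraction] it is inherited by L^1
    limits; on windows, because their finite measure makes constants integrable dominating
    functions. *)
Definition smears (R : realType) (n : nat) (g : 'rV[R]_n -> R) : Prop :=
  forall r, (\int[leb n]_(v in window r) (`|smear s g v - g v|)%:E @[s --> \oo] --> 0)%E.

(** Off the finitely many hyperplanes carrying the faces, the one-variable factors converge; they
    lie in [0, 1], so dominated convergence applies. *)
Lemma smears_box (R : realType) (n : nat) (a b : 'I_n -> R) :
  smears (\1_(setbox (fun i => `]a i, b i]%classic))).
Proof.
move=> r.
set A : 'I_n -> set R := fun i => `]a i, b i]%classic.
have mA i : measurable (A i) by exact: measurable_itv.
pose rho : R := r%:R + \sum_i (`|a i| + `|b i|).
have rrho : r%:R <= rho by rewrite lerDl sumr_ge0// => i _; rewrite addr_ge0.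
have Arho i x : A i x -> `|x| <= rho.
  rewrite /A /= in_itv/= => /andP[ax xb].
  have : `|a i| + `|b i| <= rho.
    apply: (@le_trans _ _ (\sum_i (`|a i| + `|b i|))); last by rewrite lerDr.
    by rewrite (bigD1 i)//= lerDl sumr_ge0// => k _; rewrite addr_ge0.
  apply: le_trans; rewrite ler_norml.
  have := ler_norm (b i); have := ler_norm (- a i); rewrite normrN.
  have := normr_ge0 (a i); have := normr_ge0 (b i) => *.
  by apply/andP; split; lra.
have smE s : smear s (\1_(setbox A)) = smear s (fun u : 'rV[R]_n => \prod_i \1_(A i) (u ord0 i)).
  by congr smear; apply/funext => v; exact: indic_setbox.
(* From index s0 on, [smear1_bound] holds with the radius rho that covers both the window and the
   box. *)
pose s0 := Num.truncn (2 * (2 * rho + 1)).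
have s0P s : 2 * rho + 1 <= (s + s0).+1%:R / 2.
  rewrite ler_pdivlMr// mulrC (le_trans (ltW (truncnS_gt _)))// ler_nat ltnS.
  exact: leq_addl.
rewrite -(cvg_shiftn s0).
pose f_ s v : \bar R := (`|smear (s + s0) (\1_(setbox A)) v - \1_(setbox A) v|)%:E.
have mf_ s : measurable_fun (@window R n r) (f_ s).
  apply/measurable_EFinP; apply: measurable_funTS; apply: measurableT_comp => //.
  apply: measurable_funB; first exact: measurable_smear.
  by apply: measurable_indic; exact: measurable_setbox.
have ione : (leb n).-integrable (@window R n r) (cst 1%E).
  apply/integrableP; split; first exact: measurable_cst.
  rewrite (eq_integral (cst 1%E)) ?integral_cst ?mul1e.
  - exact: lebesgue_window.
  - exact: measurable_window.
  - by move=> v _; rewrite /= normr1.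
have cf : {ae leb n, forall v, window r v -> f_ ^~ v @ \oo --> (cst 0%E : 'rV[R]_n -> \bar R) v}.
  have : {ae leb n, forall v : 'rV[R]_n, forall i, v ord0 i != a i /\ v ord0 i != b i}.
    apply: filter_forall => i; apply: filterI.
      exists [set v : 'rV[R]_n | v ord0 i = a i]; split.
      - exact: measurable_hyperplane.
      - exact: lebesgue_hyperplane.
      - by move=> v /= /negP; rewrite negbK => /eqP.
    exists [set v : 'rV[R]_n | v ord0 i = b i]; split.
    - exact: measurable_hyperplane.
    - exact: lebesgue_hyperplane.
    - by move=> v /= /negP; rewrite negbK => /eqP.
  apply: filterS => v vab _.
  apply: cvg_EFin; first by near=> s.
  rewrite [X in X @ _ --> _](_ : _ = fun s => `|smear (s + s0) (\1_(setbox A)) v - \1_(setbox A) v|)//.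
  rewrite -[X in _ --> X](normr0 R) -(subrr (\1_(setbox A) v)); apply: cvg_norm.
  apply: cvgB; last exact: cvg_cst.
  rewrite (cvg_shiftn s0 (fun s => smear s (\1_(setbox A)) v)).
  under eq_fun do rewrite smE (smear_box _ v mA Arho).
  rewrite indic_setbox; apply: cvg_big => [|i _]; first exact: mul_continuous.
  by have [? ?] := vab i; exact: smear1_cvg.
have fb : {ae leb n, forall v s, window r v -> `|f_ s v| <= cst 1%E v}%E.
  apply: aeW => v s vr; rewrite /f_ abse_EFin normr_id lee_fin smE (smear_box _ v mA Arho) indic_setbox.
  have h i : 0 <= smear1 (s + s0) (A i) (v ord0 i) <= 1.
    apply: (smear1_bound (r := rho)) => //; first exact: Arho.
    have := vr i; rewrite /= in_itv/= => /andP[/ltW v1 v2].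
    by rewrite (le_trans _ rrho)// ler_norml v1.
  have p0 : 0 <= \prod_i smear1 (s + s0) (A i) (v ord0 i).
    by apply: prodr_ge0 => i _; case/andP: (h i).
  have p1 : \prod_i smear1 (s + s0) (A i) (v ord0 i) <= 1.
    by apply: prodr_ile1 => i _; exact: h.
  have q0 : 0 <= \prod_i \1_(A i) (v ord0 i) :> R.
    by apply: prodr_ge0 => i _; rewrite indicE.
  have q1 : \prod_i \1_(A i) (v ord0 i) <= 1 :> R.
    by apply: prodr_ile1 => i _; rewrite indicE ler0n lern1 leq_b1.
  by rewrite ler_norml; apply/andP; split; lra.
have [_ _] := dominated_convergence (@measurable_window R n r) mf_ (measurable_cst _) cf ione fb.
by rewrite integral0.
Unshelve. all: by end_near. Qed.

Lemma integrable_normB (R : realType) (n : nat) (g h : 'rV[R]_n -> R) :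
  (leb n).-integrable setT (EFin \o g) -> (leb n).-integrable setT (EFin \o h) ->
  (leb n).-integrable setT (EFin \o (fun v => g v - h v)).
Proof.
move=> ig ih; rewrite [X in integrable _ _ X](_ : _ = (EFin \o g) \- (EFin \o h))%E//.
exact: integrableB.
Qed.

(** A three-epsilon argument, in which the average of g - h is controlled uniformly in s by
    [smear_contraction]. *)
Lemma smears_closed (R : realType) (n : nat) (g : 'rV[R]_n -> R) :
  (leb n).-integrable setT (EFin \o g) ->
  (forall eps : R, 0 < eps -> exists h : 'rV[R]_n -> R,
    [/\ (leb n).-integrable setT (EFin \o h), smears h &
        (\int[leb n]_v (`|g v - h v|)%:E <= eps%:E)%E]) ->
  smears g.
Proof.
move=> ig H r; apply/ge0_cvge0P => [s|eps eps0]; first by apply: integral_ge0 => v _; rewrite lee_fin.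
have [h [ih Sh gh]] := H (eps / 3) (divr_gt0 eps0 (ltr0n _ 3)).
have e3 : 0 < eps / 3 by rewrite divr_gt0.
have h0 s : (0 <= \int[leb n]_(v in window r) (`|smear s h v - h v|)%:E)%E.
  by apply: integral_ge0 => v _; rewrite lee_fin.
have /(ge0_cvge0P h0)/(_ _ e3) := Sh r; apply: filterS => s hs.
have mg := (integrableP _ _ _ ig).1; have mh := (integrableP _ _ _ ih).1.
move/measurable_EFinP in mg; move/measurable_EFinP in mh.
have mW := @measurable_window R n r.
have m1 : measurable_fun setT (fun v => (`|smear s (fun u => g u - h u) v|)%:E).
  by apply/measurable_EFinP; apply: measurableT_comp => //; exact: measurable_smear.
have m2 : measurable_fun setT (fun v => (`|smear s h v - h v|)%:E).
  apply/measurable_EFinP; apply: measurableT_comp => //; apply: measurable_funB => //.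
  exact: measurable_smear.
have m3 : measurable_fun setT (fun v => (`|g v - h v|)%:E).
  by apply/measurable_EFinP; apply: measurableT_comp => //; exact: measurable_funB.
apply: (@le_trans _ _ (\int[leb n]_(v in window r)
  ((`|smear s (fun u => g u - h u) v|)%:E + (`|smear s h v - h v|)%:E + (`|g v - h v|)%:E))%E).
  apply: ge0_le_integral => //.
  - apply/measurable_EFinP; apply: measurable_funTS; apply: measurableT_comp => //.
    by apply: measurable_funB => //; exact: measurable_smear.
  - by apply: emeasurable_funD; [apply: emeasurable_funD|]; exact: measurable_funTS.
  - move=> v _; rewrite -!EFinD lee_fin smearB//.
    have -> : smear s g v - g v = smear s g v - smear s h v + (smear s h v - h v) + (h v - g v).
      by ring.
    rewrite (le_trans (ler_normD _ _))// [`|h v - g v|]distrC lerD2r.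
    exact: ler_normD.
rewrite ge0_integralD//; last 3 first.
- by move=> v _; rewrite -EFinD lee_fin addr_ge0.
- by apply: emeasurable_funD; exact: measurable_funTS.
- exact: measurable_funTS.
rewrite ge0_integralD//; last 2 first.
- exact: measurable_funTS.
- exact: measurable_funTS.
have -> : eps%:E = ((eps / 3)%:E + (eps / 3)%:E + (eps / 3)%:E)%E by rewrite -!EFinD; congr EFin; lra.
apply: leeD; first apply: leeD => //.
- apply: (@le_trans _ _ (\int[leb n]_v (`|smear s (fun u => g u - h u) v|)%:E)%E).
    by apply: ge0_subset_integral.
  apply: (le_trans (smear_contraction _ _)) => //.
  exact: integrable_normB.
- apply: le_trans gh.
  by apply: ge0_subset_integral.
Qed.

Lemma smearsB (R : realType) (n : nat) (g h : 'rV[R]_n -> R) :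
  (leb n).-integrable setT (EFin \o g) -> (leb n).-integrable setT (EFin \o h) ->
  smears g -> smears h -> smears (fun v => g v - h v).
Proof.
move=> ig ih Sg Sh r.
have mg := (integrableP _ _ _ ig).1; have mh := (integrableP _ _ _ ih).1.
move/measurable_EFinP in mg; move/measurable_EFinP in mh.
have mW := @measurable_window R n r.
have m s (k : 'rV[R]_n -> R) : measurable_fun setT k ->
    measurable_fun (window r) (fun v => (`|smear s k v - k v|)%:E).
  move=> mk; apply/measurable_EFinP; apply: measurable_funTS; apply: measurableT_comp => //.
  by apply: measurable_funB => //; exact: measurable_smear.
have cv : ((\int[leb n]_(v in window r) (`|smear s g v - g v|)%:E) +
    (\int[leb n]_(v in window r) (`|smear s h v - h v|)%:E) @[s --> \oo] --> 0)%E.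
  by rewrite -[X in _ --> X](adde0 0%E); apply: cvgeD; [|exact: Sg|exact: Sh].
apply: (squeeze_cvge _ (cvg_cst 0%E) cv).
near=> s; apply/andP; split; first by apply: integral_ge0 => v _; rewrite lee_fin.
rewrite -ge0_integralD//; [|exact: m|exact: m].
apply: ge0_le_integral => //.
- by apply: m; exact: measurable_funB.
- by apply: emeasurable_funD; exact: m.
- move=> v _; rewrite -EFinD lee_fin smearB//.
  have -> : smear s g v - smear s h v - (g v - h v) = (smear s g v - g v) - (smear s h v - h v).
    by ring.
  exact: ler_normB.
Unshelve. all: by end_near. Qed.

Lemma smearsZ (R : realType) (n : nat) (a : R) (g : 'rV[R]_n -> R) :
  (leb n).-integrable setT (EFin \o g) -> smears g -> smears (fun v => a * g v).
Proof.
move=> ig Sg r.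
have mg := (integrableP _ _ _ ig).1; move/measurable_EFinP in mg.
have mW := @measurable_window R n r.
have -> : (fun s => \int[leb n]_(v in window r) (`|smear s (fun v => a * g v) v - a * g v|)%:E)%E =
    (fun s => (`|a|)%:E * \int[leb n]_(v in window r) (`|smear s g v - g v|)%:E)%E.
  apply/funext => s; rewrite -ge0_integralZl//.
    by apply: eq_integral => v _; rewrite smearZ// -mulrBr normrM EFinM.
  apply/measurable_EFinP; apply: measurable_funTS; apply: measurableT_comp => //.
  by apply: measurable_funB => //; exact: measurable_smear.
by rewrite -[X in _ --> X](mule0 (`|a|)%:E); apply: cvgeZl => //; exact: Sg.
Qed.

Lemma smearsD (R : realType) (n : nat) (g h : 'rV[R]_n -> R) :
  (leb n).-integrable setT (EFin \o g) -> (leb n).-integrable setT (EFin \o h) ->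
  smears g -> smears h -> smears (fun v => g v + h v).
Proof.
move=> ig ih Sg Sh.
have -> : (fun v => g v + h v) = (fun v => g v - (-1) * h v).
  by apply/funext => v; rewrite mulN1r opprK.
apply: smearsB => //; last exact: smearsZ.
by have := integrableZl measurableT (-1) ih.
Qed.

Lemma integrable_setboxI (R : realType) (n m : nat) (A : set 'rV[R]_n) : measurable A ->
  (leb n).-integrable setT (EFin \o \1_(A `&` window m)).
Proof.
move=> mA; have mW := @measurable_window R n m.
apply: integrable_setbox; first exact: measurableI.
by rewrite (le_lt_trans _ (lebesgue_window R n m))// le_measure ?inE//; exact: measurableI.
Qed.

Definition half_open (R : realType) : set (set R) :=
  [set A | A = setT \/ exists a b, A = `]a, b]%classic].

Lemma setI_itv_oc (R : realType) (a b c d : R) :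
  `]a, b]%classic `&` `]c, d]%classic = `]Num.max a c, Num.min b d]%classic.
Proof.
apply/seteqP; split => x /=; rewrite !in_itv/= gt_max le_min.
  by move=> [/andP[-> ->] /andP[-> ->]].
by move=> /andP[/andP[-> ->] /andP[-> ->]].
Qed.

Lemma half_openI (R : realType) (A B : set R) :
  half_open A -> half_open B -> half_open (A `&` B).
Proof.
move=> [->|[a [b ->]]]; first by rewrite setTI.
move=> [->|[c [d ->]]]; first by rewrite setIT; right; exists a, b.
by right; rewrite setI_itv_oc; eexists; eexists.
Qed.

Definition half_open_boxes (R : realType) (n : nat) : set (set 'rV[R]_n) :=
  [set E | exists2 A : 'I_n -> set R, (forall i, half_open (A i)) & E = setbox A].

Lemma setboxI (R : realType) (n : nat) (A B : 'I_n -> set R) :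
  setbox A `&` setbox B = setbox (fun i => A i `&` B i).
Proof.
by apply/seteqP; split => v /= => [[h1 h2] i|h]; [split|split=> i; case: (h i)].
Qed.

Lemma half_open_boxesI (R : realType) (n : nat) : setI_closed (@half_open_boxes R n).
Proof.
move=> _ _ [A hA ->] [B hB ->]; exists (fun i => A i `&` B i); last exact: setboxI.
by move=> i; exact: half_openI.
Qed.

Lemma sigma_half_open_boxes (R : realType) (n : nat) (E : set 'rV[R]_n) :
  measurable E -> <<s setT, @half_open_boxes R n >> E.
Proof.
move=> mE; have : g_sigma_preimage (fun (i : 'I_n) (v : 'rV[R]_n) => v ord0 i) E by [].
apply: smallest_sub; first exact: smallest_sigma_algebra.
rewrite -bigcup_seq => _ [i _ [B mB <-]]; rewrite setTI.
suff : <<s setT, @ocitv R >> `<=`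
    [set B | <<s setT, @half_open_boxes R n >> ((fun v : 'rV[R]_n => v ord0 i) @^-1` B)].
  by apply.
apply: smallest_sub.
  have SA : sigma_algebra setT <<s setT, @half_open_boxes R n >> by exact: smallest_sigma_algebra.
  split=> /=.
  - by rewrite preimage_set0; exact: sigma_algebra0.
  - move=> X hX; have := sigma_algebraCD hX.
    by rewrite !setTD preimage_setC.
  - by move=> F hF; rewrite preimage_bigcup; apply: sigma_algebra_bigcup.
move=> _ [[a b] _ <-]; apply: sub_sigma_algebra.
exists (fun k => if k == i then `]a, b]%classic else setT) => /=.
  by move=> k; case: eqP => _; [right; exists a, b|left].
apply/seteqP; split => v /=.
  by move=> h k; case: eqP => [->|].
by move=> /(_ i); rewrite eqxx.
Qed.

(** Dynkin's argument: half-open boxes are stable under intersection and generate the sigma-algebra,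
    while the sets with the property form a lambda-system. The window keeps all indicators
    integrable. *)
Lemma smears_set (R : realType) (n m : nat) (E : set 'rV[R]_n) :
  measurable E -> smears (\1_(E `&` window m) : 'rV[R]_n -> R).
Proof.
move=> /sigma_half_open_boxes.
suff : <<s setT, @half_open_boxes R n >> `<=`
    [set E | measurable E /\ smears (\1_(E `&` window m) : 'rV[R]_n -> R)].
  by move=> h /h [].
have mW := @measurable_window R n m.
apply: lambda_system_subset => //; first exact: half_open_boxesI.
  split => //=.
  - rewrite setTI; split; first exact: measurableT.
    exact: (@smears_box R n (fun=> - m%:R) (fun=> m%:R)).
  - move=> A B BA [mA SA] [mB SB]; split; first exact: measurableD.
    rewrite [X in smears X](_ : _ = (fun v => \1_(A `&` window m) v - \1_(B `&` window m) v)).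
      by apply: smearsB => //; exact: integrable_setboxI.
    apply/funext => v; rewrite !indicE.
    have [/set_mem wv|/negP wv] := boolP (v \in window m); last first.
      have nw X : (v \in (X `&` window m)) = false.
        by apply/negP => /set_mem[_ w]; apply: wv; exact/mem_set.
      by rewrite !nw subr0.
    have ww X : (v \in X `&` window m) = (v \in X).
      by apply/idP/idP => [/set_mem[? _]|/set_mem ?]; apply/mem_set.
    rewrite !ww in_setD; have [/set_mem Bv|] := boolP (v \in B); last by rewrite subr0 andbT.
    by rewrite andbF mem_set ?subrr//; exact: BA.
  - move=> F ndF hF; have mF k : measurable (F k) by case: (hF k).
    have mUF : measurable (\bigcup_k F k) by exact: bigcupT_measurable.
    split => //; apply: smears_closed; first exact: integrable_setboxI.
    move=> eps eps0.
    (* The part not yet reached by [F k] decreases to the empty set inside a window of finite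
       measure, so its measure, which is the L^1 distance of the indicators, tends to 0. *)
    pose D k := (\bigcup_k F k `&` window m) `\` (F k `&` window m).
    have mD k : measurable (D k) by apply: measurableD; exact: measurableI.
    have cD : leb n (D k) @[k --> \oo] --> 0%E.
      rewrite -(@measure0 _ _ _ (leb n)) (_ : set0 = \bigcap_k D k).
        apply: nonincreasing_cvg_mu => //.
        + rewrite (le_lt_trans _ (lebesgue_window R n m))// le_measure ?inE//.
          by move=> v [[_ ?] _].
        + exact: bigcapT_measurable.
        + move=> i j ij; apply/subsetPset => v [[Uv Wv] nv]; split => // -[Fv _]; apply: nv.
          by split => //; have /subsetPset := ndF _ _ ij; exact.
      apply/seteqP; split => // v Dv; have [[[k _ Fk] Wv] _] := Dv 0%N I.
      by have [_] := Dv k I; apply.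
    have D0 k : (0 <= leb n (D k))%E by exact: measure_ge0.
    have /(ge0_cvge0P D0)/(_ _ eps0)[k _ /(_ k (leqnn k)) hk] := cD.
    exists (\1_(F k `&` window m)); split.
    + exact: integrable_setboxI.
    + by case: (hF k).
    + rewrite (le_trans _ hk)// -[D k]setIT -integral_indic//.
      apply: eq_leW; apply: eq_integral => v _.
      congr EFin; rewrite !indicE in_setD.
      have [/set_mem [Fv Wv]|] := boolP (v \in F k `&` window m).
        by rewrite mem_set ?subrr ?normr0//; split => //; exists k.
      by rewrite subr0 andbT ger0_norm.
move=> _ [A hA ->] /=; split.
  apply: measurable_setbox => i; case: (hA i) => [->|[a [b ->]]]; first exact: measurableT.
  exact: measurable_itv.
rewrite /window setboxI.
have : forall i, exists ab : R * R, A i `&` `]- m%:R, m%:R]%classic = `]ab.1, ab.2]%classic.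
  move=> i; case: (hA i) => [->|[a [b ->]]]; last by rewrite setI_itv_oc; eexists (_, _).
  by rewrite setTI; exists (- m%:R, m%:R).
move=> /choice[ab hab]; under [X in setbox X]funext do rewrite hab.
exact: smears_box.
Qed.

Import HBSimple.

Lemma smears_sfun (R : realType) (n m : nat) (h : {sfun 'rV[R]_n >-> R}) :
  (leb n).-integrable setT (EFin \o (fun v => h v * \1_(window m) v)) /\
  smears (fun v => h v * \1_(window m) v).
Proof.
pose L : seq R := finmap.enum_fset (fset_set (range h)).
have -> : (fun v => h v * \1_(window m) v) =
    (fun v => \sum_(y <- L) y * \1_(h @^-1` [set y] `&` window m) v).
  apply/funext => v; rewrite fimfunE fsbig_finite//= mulr_suml.
  by apply: eq_bigr => y _; rewrite indicI -mulrA.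
elim: L => [|y l [il Sl]].
  (* The zero function is written as a product so that [smearZ] evaluates its average. *)
  have -> : (fun v : 'rV[R]_n => \sum_(y <- [::]) y * \1_(h @^-1` [set y] `&` window m) v) = (fun=> 0 * 0).
    by apply/funext => v; rewrite big_nil mul0r.
  have i0 : (leb n).-integrable setT (EFin \o (fun=> 0 : R)) by exact: integrable0.
  split; first by rewrite mul0r.
  move=> r; rewrite [X in X @ _ --> _](_ : _ = fun=> 0%E); first exact: cvg_cst.
  apply/funext => s; apply: integral0_eq => v _.
  by rewrite smearZ// !mul0r subrr normr0.
have -> : (fun v => \sum_(z <- y :: l) z * \1_(h @^-1` [set z] `&` window m) v) =
    (fun v => y * \1_(h @^-1` [set y] `&` window m) v +
       \sum_(z <- l) z * \1_(h @^-1` [set z] `&` window m) v).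
  by apply/funext => v; rewrite big_cons.
have my : measurable (h @^-1` [set y]) by rewrite -[X in measurable X]setTI; exact: measurable_funP.
have iy := integrable_setboxI m my.
have iyZ : (leb n).-integrable setT
    (EFin \o (fun v => y * \1_(h @^-1` [set y] `&` window m) v)).
  by have := integrableZl measurableT y iy.
split; first by have := integrableD measurableT iyZ il.
by apply: smearsD => //; apply: smearsZ => //; exact: smears_set.
Qed.

(** Simple functions cut off to windows are dense in L^1, and [smears_closed] extends the
    convergence to the closure. *)
Theorem smear_cvg (R : realType) (n : nat) (g : 'rV[R]_n -> R) :
  (leb n).-integrable setT (EFin \o g) -> smears g.
Proof.
move=> ig; apply: smears_closed => // eps eps0.
have e2 : 0 < eps / 2 by rewrite divr_gt0.
have [h_ [ih _ ch]] := approximation_sfun_integrable measurableT ig.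
have c0 k : (0 <= \int[leb n]_(z in setT) `|(g z)%:E - (h_ k z)%:E|)%E.
  by apply: integral_ge0 => z _; exact: abse_ge0.
have /(ge0_cvge0P c0)/(_ _ e2)[k _ /(_ k (leqnn k)) hk] := ch.
have mg : measurable_fun setT g by have /integrableP[/measurable_EFinP] := ig.
have mW m := @measurable_window R n m.
have mgW m : measurable_fun setT (fun v => g v * \1_(window m) v : R).
  by apply: measurable_funM => //; exact: measurable_indic.
have gW : (\int[leb n]_v (`|g v - g v * \1_(window m) v|)%:E @[m --> \oo] --> 0)%E.
  pose f_ m v : \bar R := (`|g v - g v * \1_(window m) v|)%:E.
  have mf_ m : measurable_fun setT (f_ m).
    by apply/measurable_EFinP; apply: measurableT_comp => //; exact: measurable_funB.
  have cf : {ae leb n, forall v, setT v -> f_ ^~ v @ \oo --> (cst 0%E : 'rV[R]_n -> \bar R) v}.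
    apply: aeW => v _; apply: (@cvg_trans _ ((fun=> 0%E : \bar R) @ \oo)); last exact: cvg_cst.
    apply: near_eq_cvg; near=> m; rewrite /f_ indicE mem_set; last first.
      by near: m; exact: bigcup_window.
    by rewrite mulr1 subrr normr0.
  have fb : {ae leb n, forall v m, setT v -> `|f_ m v| <= abse (EFin (g v))}%E.
    apply: aeW => v m _; rewrite /f_ /= normr_id lee_fin indicE.
    by case: (v \in _); rewrite ?mulr1 ?subrr ?normr0// mulr0 subr0.
  have [_ _] := dominated_convergence measurableT mf_ (measurable_cst _) cf (integrable_abse ig) fb.
  by rewrite integral0.
have w0 m : (0 <= \int[leb n]_v (`|g v - g v * \1_(window m) v|)%:E)%E.
  by apply: integral_ge0 => z _; rewrite lee_fin.
have /(ge0_cvge0P w0)/(_ _ e2)[m _ /(_ m (leqnn m)) hm] := gW.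
have [ihm Shm] := smears_sfun m (h_ k).
exists (fun v => h_ k v * \1_(window m) v); split => //.
have -> : eps%:E = ((eps / 2)%:E + (eps / 2)%:E)%E by rewrite -EFinD; congr EFin; lra.
apply: le_trans (leeD hm hk).
have mh : measurable_fun setT (h_ k) by [].
rewrite -ge0_integralD//; last 2 first.
- by apply/measurable_EFinP; apply: measurableT_comp => //; exact: measurable_funB.
- by apply/measurable_EFinP; apply: measurableT_comp => //; exact: measurable_funB.
apply: ge0_le_integral => //.
- apply/measurable_EFinP; apply: measurableT_comp => //; apply: measurable_funB => //.
  by apply: measurable_funM => //; exact: measurable_indic.
- by apply: emeasurable_funD; apply/measurable_EFinP; apply: measurableT_comp => //; exact: measurable_funB.
- move=> v _; rewrite -EFinB abse_EFin -EFinD lee_fin indicE.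
  by case: (v \in _); rewrite ?mulr1 ?subrr ?normr0 ?add0r// !mulr0 !subr0 lerDl.
Unshelve. all: by end_near. Qed.

(** * Borel representatives *)

Section completion.
Context d (T : measurableType d) (R : realType) (mu : {measure set T -> \bar R}).

Lemma ae_all_rat (P : rat -> T -> Prop) :
  (forall q, {ae mu, forall x, P q x}) -> {ae mu, forall x, forall q, P q x}.
Proof.
move=> h.
have : {ae mu, forall x, forall n : nat, if unpickle n is Some q then P q x else True}.
  by apply/ae_foralln => n; case: unpickle => [q|]; [exact: h|exact: aeW].
by apply: filterS => x hx q; have := hx (pickle q); rewrite pickleK.
Qed.

(** For each rational q the set where g < q is a measurable set [(A q).1] up to a subset of a null
    set [(A q).2]. Setting g to 0 on the union M of these null sets leaves strict sublevel sets that
    are countable unions over rationals, hence measurable. *)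
Lemma completed_measurable_representative (g : T -> R) : completed_measurable_fun mu g ->
  exists2 h : T -> R, measurable_fun setT h & {ae mu, forall x, g x = h x}.
Proof.
move=> mg.
have /choice[A hA] (q : rat) : exists AM : set T * set T,
    [/\ measurable AM.1, measurable AM.2, mu AM.2 = 0%E, AM.1 `<=` [set x | g x < ratr q] &
        [set x | g x < ratr q] `<=` AM.1 `|` AM.2].
  have [A mA [N [M [mM M0 NM]] AN]] := mg `]-oo, ratr q[%classic (measurable_itv _).
  exists (A, M); split => //=.
  - by move=> x Ax; have : (A `|` N) x by [left]; rewrite AN /= in_itv.
  - move=> x /= gx; have : (g @^-1` `]-oo, ratr q[%classic) x by rewrite /= in_itv.
    by rewrite -AN => -[?|/NM ?]; [left|right].
pose M := \bigcup_q (A q).2.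
have mM : measurable M by apply: bigcupT_measurable_rat => q; case: (hA q).
exists (fun x => if x \in M then 0 else g x).
  apply: (measurability (@RGenInftyO.G R)); first exact: RGenInftyO.measurableE.
  move=> _ [_ [c ->] <-]; rewrite setTI.
  have -> : (fun x => if x \in M then 0 else g x) @^-1` `]-oo, c[%classic =
      (M `&` [set x | 0 < c]) `|` \bigcup_q (((A q).1 `\` M) `&` [set x | ratr q < c]).
    apply/seteqP; split => x /=; rewrite in_itv/=.
      case: ifPn => [/set_mem Mx c0|/negP xM gxc]; first by left.
      right; have [q] := rat_in_itvoo gxc; rewrite in_itv/= => /andP[gq qc].
      exists q => //; split => //; split; last by move=> /mem_set.
      have [_ _ _ _ h] := hA q; have [//|Aq] := h x gq.
      by exfalso; apply: xM; apply/mem_set; exists q.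
    case=> [[Mx c0]|[q _ [[Aq Mx] qc]]]; first by rewrite mem_set.
    rewrite memNset//; have [_ _ _ h _] := hA q.
    by rewrite (lt_trans (h _ Aq)).
  have mb (b : bool) : measurable [set x : T | b].
    have [->|->] : [set x : T | b] = setT \/ [set x : T | b] = set0; [|exact: measurableT|exact: measurable0].
    by case: b; [left|right]; apply/seteqP; split.
  apply: measurableU; first exact: measurableI.
  apply: bigcupT_measurable_rat => q; apply: measurableI => //.
  by apply: measurableD => //; case: (hA q).
have M0 : {ae mu, forall x, forall q, ~ (A q).2 x}.
  apply: ae_all_rat => q; exists (A q).2; have [_ mAq Aq0 _ _] := hA q; split => //.
  by move=> x /= /contrapT.
apply: filterS M0 => x Mx; rewrite memNset// => -[q _]; exact: Mx.
Qed.

End completion.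

(** * Smooth bump functions *)

(** Only the existence of k successive derivatives is recorded. Continuity of each comes from the
    existence of the next, so the condition for all k means smoothness. *)
Fixpoint Ck (R : realType) (k : nat) (g : R -> R) : Prop :=
  if k is k'.+1 then exists2 g' : R -> R, (forall x : R, is_derive x 1 g (g' x)) & Ck k' g'
  else True.

Lemma Ck_pred (R : realType) (k : nat) (g : R -> R) : Ck k.+1 g -> Ck k g.
Proof.
elim: k g => [//|k IH] g [g' dg Cg']; exists g' => //; exact: IH.
Qed.

Lemma CkD (R : realType) (k : nat) (f g : R -> R) :
  Ck k f -> Ck k g -> Ck k (fun x => f x + g x).
Proof.
elim: k f g => [//|k IH] f g [f' df Cf'] [g' dg Cg'].
by exists (fun x => f' x + g' x); [move=> x; exact: is_deriveD|exact: IH].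
Qed.

Lemma CkM (R : realType) (k : nat) (f g : R -> R) :
  Ck k f -> Ck k g -> Ck k (fun x => f x * g x).
Proof.
elim: k f g => [//|k IH] f g Cf Cg.
have Cf1 := Ck_pred Cf; have Cg1 := Ck_pred Cg.
case: Cf => f' df Cf'; case: Cg => g' dg Cg'.
exists (fun x => f x * g' x + g x * f' x); last by apply: CkD; exact: IH.
by move=> x; exact: is_deriveM.
Qed.

Lemma Ck_cst (R : realType) (k : nat) (c : R) : Ck k (fun=> c).
Proof.
elim: k c => [//|k IH] c; exists (fun=> 0) => // x; exact: is_derive_cst.
Qed.

Lemma Ck_affine (R : realType) (k : nat) (a b : R) (g : R -> R) :
  Ck k g -> Ck k (fun x => g (a * x + b)).
Proof.
elim: k g => [//|k IH] g [g' dg Cg'].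
exists (fun x => g' (a * x + b) * a); last by apply: CkM; [exact: IH|exact: Ck_cst].
move=> x; apply: (@is_derive1_comp _ g (fun x => a * x + b)).
have := is_deriveD (is_deriveZ a (is_derive_id x (1 : R))) (is_derive_cst b x (1 : R)).
by rewrite addr0 /GRing.scale/= mulr1.
Qed.

Lemma Ck_derive (R : realType) (g : R -> R) : (forall k, Ck k g) ->
  (forall x : R, is_derive x 1 g (derive1 g x)) /\ forall k, Ck k (derive1 g).
Proof.
move=> Cg; split=> [x|k].
  have [g' dg _] := Cg 1%N; have := dg x => dgx.
  by apply: DeriveDef; [exact: ex_derive|rewrite derive1E].
have [g' dg Cg'] := Cg k.+1.
rewrite (_ : (derive1 g) = g')//; apply/funext => x.
by rewrite derive1E; have := dg x => dgx; exact: derive_val.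
Qed.

(** x^-j e^(-1/x) extended by 0. The exponent j makes the family closed under differentiation up to
    linear combinations, so that smoothness follows by induction for all j at once. *)
Definition flat (R : realType) (j : nat) (x : R) : R :=
  if 0 < x then x^-1 ^+ j * expR (- x^-1) else 0.

Lemma flat_le (R : realType) (j : nat) (x : R) :
  0 <= flat j x <= (j.+2)`!%:R * x ^+ 2.
Proof.
rewrite /flat; case: ifPn => [x0|_]; last by rewrite lexx mulr_ge0// sqr_ge0.
have t0 : 0 < x^-1 by rewrite invr_gt0.
rewrite mulr_ge0 ?expR_ge0 ?exprn_ge0 ?(ltW t0)//=.
(* For t = 1/x the term t^(j+2) / (j+2)! of the exponential series absorbs t^j and leaves t^-2 =
   x^2. *)
have := expR_ge1Dxn j.+1 (ltW t0).
set F : R := _`!%:R; have F0 : 0 < F by rewrite ltr0n fact_gt0.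
move=> h; have {}h : x^-1 ^+ j.+2 <= F * expR x^-1.
  by rewrite mulrC -ler_pdivrMr// (le_trans _ h)// lerDr.
rewrite expRN -ler_pdivlMr ?invr_gt0 ?expR_gt0// invrK.
rewrite -(ler_pM2r (x := x^-1 ^+ 2)) ?exprn_gt0// -exprD addn2 (le_trans h)//.
rewrite [leRHS](_ : _ = F * expR x^-1 * (x * x^-1) ^+ 2); last by rewrite exprMn; ring.
by rewrite mulfV ?gt_eqF// expr1n mulr1.
Qed.

(* At 0 the quotient tends to 0 because [flat j x] is O(x^2). *)
Lemma is_derive_flat (R : realType) (j : nat) (x : R) :
  is_derive x 1 (@flat R j) (- j%:R * flat j.+1 x + flat j.+2 x).
Proof.
have [x0|x0|->] := ltgtP x 0.
- have -> : - j%:R * flat j.+1 x + flat j.+2 x = 0.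
    by rewrite /flat ltNge (ltW x0)/= mulr0 addr0.
  apply: near_eq_is_derive (is_derive_cst (0 : R) x (1 : R)).
  near=> y; rewrite /flat ltNge ltW//.
  by near: y; exact: lt_nbhsl.
- have dinv : is_derive x 1 (fun y : R => y^-1) (- x ^- 2 *: 1).
    by apply: (@is_deriveV _ id) => //; rewrite gt_eqF.
  have dN := is_deriveN dinv.
  have dE := is_derive1_comp (is_derive_expR _) dN.
  have := is_deriveM (is_deriveX j dinv) dE.
  set D := (X in is_derive _ _ _ X -> _) => dD.
  have -> : - j%:R * flat j.+1 x + flat j.+2 x = D.
    rewrite /D /flat x0 /GRing.scale/= fctE -exprVn.
    by case: j {dD D} => [|j]; rewrite ?mul0r/= ?exprS; ring.
  apply: near_eq_is_derive dD.
  near=> y; rewrite /flat; have -> : 0 < y by near: y; exact: lt_nbhsr.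
  by rewrite !fctE; congr (_ * _); rewrite exprfctE.
- have f0 k : flat k (0 : R) = 0 by rewrite /flat ltxx.
  rewrite !f0 mulr0 addr0.
  have c0 : (fun h : R => h^-1 *: (flat j (h *: 1 + 0) - flat j 0)) @ 0^' --> (0 : R).
    pose F : R := (j.+2)`!%:R.
    apply/cvgrPdist_le => eps eps0; near=> h.
    have h0 : h != 0 by near: h; exact: nbhs_dnbhs_neq.
    rewrite f0 subr0 sub0r normrN /GRing.scale/= mulr1 addr0 normrM normfV.
    have /andP[p1 p2] := flat_le j h.
    rewrite (ger0_norm p1) mulrC ler_pdivrMr ?normr_gt0//.
    rewrite (le_trans p2)// -real_normK ?num_real// expr2 mulrA ler_wpM2r//.
    rewrite -ler_pdivlMl ?ltr0n ?fact_gt0//.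
    near: h; apply: dnbhs0_le; rewrite mulr_gt0// invr_gt0 ltr0n fact_gt0//.
  apply: DeriveDef; first by apply/cvg_ex; exists 0.
  exact: cvg_lim.
Unshelve. all: by end_near. Qed.

Lemma Ck_flat (R : realType) (k j : nat) : Ck k (@flat R j).
Proof.
elim: k j => [//|k IH] j; exists (fun x => - j%:R * flat j.+1 x + flat j.+2 x).
  exact: is_derive_flat.
apply: CkD; last exact: IH.
by apply: CkM; [exact: Ck_cst|exact: IH].
Qed.

Definition sbump (R : realType) (x : R) : R := flat 0 x * flat 0 (1 - x).

Lemma Ck_sbump (R : realType) (k : nat) : Ck k (@sbump R).
Proof.
apply: CkM; first exact: Ck_flat.
rewrite (_ : (fun x => _) = fun x : R => flat 0 (-1 * x + 1)).
  by apply: Ck_affine; exact: Ck_flat.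
by apply/funext => x; rewrite mulN1r addrC.
Qed.

Lemma flat0_le1 (R : realType) (x : R) : 0 <= flat 0 x <= 1.
Proof.
rewrite /flat; case: ifP => [x0|_]; last by rewrite lexx ler01.
by rewrite expr0 mul1r expR_ge0/= -expR0 ler_expR oppr_le0 invr_ge0 ltW.
Qed.

Lemma sbump_ge0 (R : realType) (x : R) : 0 <= sbump x.
Proof. by apply: mulr_ge0; [case/andP: (flat0_le1 x)|case/andP: (flat0_le1 (1 - x))]. Qed.

Lemma sbump_le1 (R : realType) (x : R) : sbump x <= 1.
Proof.
by have /andP[? ?] := flat0_le1 x; have /andP[? ?] := flat0_le1 (1 - x); exact: mulr_ile1.
Qed.

Lemma sbump_neq0 (R : realType) (x : R) : sbump x != 0 -> 0 < x < 1.
Proof.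
rewrite /sbump /flat subr_gt0; case: ifP; last by rewrite mul0r eqxx.
by case: ifP => //; rewrite mulr0 eqxx.
Qed.

(** On this interval 1/x and 1/(1 - x) are both at most 4, whence the exponent -8. *)
Lemma sbump_lower (R : realType) (x : R) : 4^-1 <= x <= 3 / 4 -> expR (- 8) <= sbump x.
Proof.
move=> /andP[x1 x2]; have x0 : 0 < x by lra.
have y0 : 0 < 1 - x by lra.
rewrite /sbump /flat x0 y0 !expr0 !mul1r -expRD ler_expR.
have i1 : x^-1 <= 4 by rewrite -[4]invrK lef_pV2 ?posrE//.
have i2 : (1 - x)^-1 <= 4 by rewrite -[4]invrK lef_pV2 ?posrE//; lra.
by lra.
Qed.

(** Finite sums of products of one-variable functions are stable under partial derivatives, each of
    which differentiates one factor; smoothness in n variables is thus reduced to [Ck]. *)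
Definition tensor (R : realType) (n : nat) (C : finType) (w : C -> R)
    (U : C -> 'I_n -> R -> R) (y : 'rV[R]_n) : R :=
  \sum_c w c * \prod_i U c i (y ord0 i).

Lemma continuous_tensor (R : realType) (n : nat) (C : finType) (w : C -> R)
    (U : C -> 'I_n -> R -> R) : (forall c i, continuous (U c i)) -> continuous (tensor w U).
Proof.
move=> cU y; have Fy : Filter (nbhs y) by exact: nbhs_filter.
rewrite /tensor; apply: cvg_big => [|c _]; first exact: add_continuous.
apply: cvgM; first exact: cvg_cst.
apply: cvg_big => [|i _]; first exact: mul_continuous.
have coordU : continuous (U c i \o (fun v : 'rV[R]_n => v ord0 i)).
  by move=> v; apply: continuous_comp; [exact: coord_continuous|exact: cU].
exact: coordU.
Qed.

Lemma is_derive_tensor (R : realType) (n : nat) (C : finType) (w : C -> R)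
    (U : C -> 'I_n -> R -> R) (dU : C -> R) (x : 'rV[R]_n) (i : 'I_n) :
  (forall c, is_derive (x ord0 i) (1 : R) (U c i) (dU c)) ->
  is_derive x (delta_mx ord0 i) (tensor w U)
    (\sum_c w c * (dU c * \prod_(k | k != i) U c k (x ord0 k))).
Proof.
move=> dUi.
set D := \sum_c _.
have cD : (fun h : R => h^-1 *: (tensor w U (h *: delta_mx ord0 i + x) - tensor w U x)) @ 0^' --> D.
  have E h : h^-1 *: (tensor w U (h *: delta_mx ord0 i + x) - tensor w U x) =
      \sum_c w c * (h^-1 *: (U c i (h *: 1 + x ord0 i) - U c i (x ord0 i)) *
        \prod_(k | k != i) U c k (x ord0 k)).
    rewrite /tensor -sumrB scaler_sumr; apply: eq_bigr => c _.
    rewrite (bigD1 i)//= (bigD1 (F := fun i => U c i (x ord0 i)) i)//=.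
    rewrite !mxE !eqxx/= /GRing.scale/= mulr1.
    rewrite (eq_bigr (fun k => U c k (x ord0 k))); last first.
      by move=> k ki; rewrite !mxE (negbTE ki) mulr0 add0r.
    by ring.
  under eq_fun do rewrite E.
  apply: cvg_big => [|c _]; first exact: add_continuous.
  apply: cvgM; first exact: cvg_cst.
  apply: cvgM; last exact: cvg_cst.
  have := dUi c => dc; have := @ex_derive _ _ _ _ _ _ _ dc.
  by rewrite -[X in _ --> X](@derive_val _ _ _ _ _ _ _ dc).
apply: DeriveDef; first by apply/cvg_ex; exists D.
exact: cvg_lim.
Qed.

Lemma Ck_continuous (R : realType) (g : R -> R) : (forall k, Ck k g) -> continuous g.
Proof.
move=> /Ck_derive[dg _] x; apply: differentiable_continuous; apply/derivable1_diffP.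
by have := dg x => dx; exact: ex_derive.
Qed.

Lemma iter_partial_tensor (R : realType) (n : nat) (C : finType) (w : C -> R)
    (U : C -> 'I_n -> R -> R) (s : seq 'I_n) : (forall c i k, Ck k (U c i)) ->
  exists2 V : C -> 'I_n -> R -> R, forall c i k, Ck k (V c i) &
    iter_partial s (tensor w U) = tensor w V.
Proof.
move=> cU; elim: s => [|i s [V cV IH]]; first by exists U.
exists (fun c k => if k == i then derive1 (V c k) else V c k).
  by move=> c k m; case: eqP => _ //; have [_] := Ck_derive (cV c k); apply.
rewrite /= -/(iter_partial s _) IH; apply/funext => x.
have dV c : is_derive (x ord0 i) (1 : R) (V c i) (derive1 (V c i) (x ord0 i)).
  by have [] := Ck_derive (cV c i).
rewrite (@derive_val _ _ _ _ _ _ _ (is_derive_tensor w dV)).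
apply: eq_bigr => c _; rewrite [in RHS](bigD1 i)//= eqxx; congr (_ * (_ * _)).
by apply: eq_bigr => k /negbTE ->.
Qed.

Lemma smooth_tensor (R : realType) (n : nat) (C : finType) (w : C -> R)
    (U : C -> 'I_n -> R -> R) : (forall c i k, Ck k (U c i)) -> smooth (tensor w U).
Proof.
move=> cU s; have [V cV ->] := iter_partial_tensor w s cU; split.
  by apply: continuous_tensor => c i; exact: Ck_continuous.
move=> x i.
have dV c : is_derive (x ord0 i) (1 : R) (V c i) (derive1 (V c i) (x ord0 i)).
  by have [] := Ck_derive (cV c i).
exact: (@ex_derive _ _ _ _ _ _ _ (is_derive_tensor w dV)).
Qed.

Lemma compact_closure_bounded (R : realType) (n : nat) (A : set 'rV[R]_n) (r : R) :
  (forall v, A v -> forall i, `|v ord0 i| <= r) -> compact (closure A).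
Proof.
move=> Ar; pose B := [set v : 'rV[R]_n | forall i, `[- r, r]%classic (v ord0 i)].
have cB : compact B.
  by apply: (@rV_compact R n (fun=> `[- r, r]%classic)) => i; exact: segment_compact.
apply: (subclosed_compact _ cB); first exact: closed_closure.
rewrite [X in _ `<=` X](closure_id B).1.
  apply: closure_subset => v Av i; rewrite /= in_itv/= -ler_norml; exact: Ar.
by apply: compact_closed => //; exact: norm_hausdorff.
Qed.

(** * Integrals of complex functions *)

Lemma Re_mul (R : realType) (z w : R[i]) :
  complex.Re (z * w) = complex.Re z * complex.Re w - complex.Im z * complex.Im w.
Proof. by case: z; case: w. Qed.

Lemma Im_mul (R : realType) (z w : R[i]) :
  complex.Im (z * w) = complex.Re z * complex.Im w + complex.Im z * complex.Re w.
Proof. by case: z; case: w. Qed.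

Lemma Re_add (R : realType) (z w : R[i]) :
  complex.Re (z + w) = complex.Re z + complex.Re w.
Proof. by case: z; case: w. Qed.

Lemma Im_add (R : realType) (z w : R[i]) :
  complex.Im (z + w) = complex.Im z + complex.Im w.
Proof. by case: z; case: w. Qed.

Lemma Im_sum (R : realType) (I : Type) (r : seq I) (F : I -> R[i]) :
  complex.Im (\sum_(i <- r) F i) = \sum_(i <- r) complex.Im (F i).
Proof. by elim/big_rec2: _ => // i x y _ <-; rewrite Im_add. Qed.

Lemma complex_eq (R : realType) (z w : R[i]) :
  complex.Re z = complex.Re w -> complex.Im z = complex.Im w -> z = w.
Proof. by case: z => a b; case: w => c d /= -> ->. Qed.

Lemma Re_cintegral d (T : measurableType d) (R : realType) (mu : {measure set T -> \bar R})
  (f : T -> R[i]) : complex.Re (cintegral mu f) = \int[mu]_x complex.Re (f x).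
Proof. by []. Qed.

Lemma Im_cintegral d (T : measurableType d) (R : realType) (mu : {measure set T -> \bar R})
  (f : T -> R[i]) : complex.Im (cintegral mu f) = \int[mu]_x complex.Im (f x).
Proof. by []. Qed.

Section complex_integrable.
Context d (T : measurableType d) (R : realType) (mu : {measure set T -> \bar R}).
Implicit Types f g : T -> R[i].

(** Unlike [cintegrable], this demands measurability for the sigma-algebra itself, not its
    completion, which is the setting of linearity and translation of the integral. *)
Definition cint f : Prop :=
  mu.-integrable setT (EFin \o (fun x => complex.Re (f x))) /\
  mu.-integrable setT (EFin \o (fun x => complex.Im (f x))).

Lemma cintZ (c : R[i]) f : cint f -> cint (fun x => c * f x).
Proof.
move=> [rf jf].
have Z (r : R) (g : T -> R) : mu.-integrable setT (EFin \o g) ->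
    mu.-integrable setT (EFin \o (fun x => r * g x)).
  exact: integrableZl.
split.
  rewrite (_ : _ \o _ = (EFin \o (fun x => complex.Re c * complex.Re (f x))%R) \-
    (EFin \o (fun x => complex.Im c * complex.Im (f x))%R))%E.
    by apply: integrableB => //; exact: Z.
  by apply/funext => x; rewrite /= Re_mul.
rewrite (_ : _ \o _ = (EFin \o (fun x => complex.Re c * complex.Im (f x))%R) \+
  (EFin \o (fun x => complex.Im c * complex.Re (f x))%R))%E.
  by apply: integrableD => //; exact: Z.
by apply/funext => x; rewrite /= Im_mul.
Qed.

Lemma cintD f g : cint f -> cint g -> cint (fun x => f x + g x).
Proof.
move=> [rf jf] [rg jg]; split.
  rewrite (_ : _ \o _ = (EFin \o (fun x => complex.Re (f x))) \+
    (EFin \o (fun x => complex.Re (g x))))%E; first exact: integrableD.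
  by apply/funext => x; rewrite /= Re_add.
rewrite (_ : _ \o _ = (EFin \o (fun x => complex.Im (f x))) \+
  (EFin \o (fun x => complex.Im (g x))))%E; first exact: integrableD.
by apply/funext => x; rewrite /= Im_add.
Qed.

Lemma cintegralZ (c : R[i]) f : cint f -> cintegral mu (fun x => c * f x) = c * cintegral mu f.
Proof.
move=> [rf jf]; apply: complex_eq; rewrite /cintegral/=.
  rewrite Re_mul/= -!RintegralZl// -RintegralB//.
  - by apply: eq_Rintegral => x _; rewrite Re_mul.
  - exact: (integrableZl _ _ rf).
  - exact: (integrableZl _ _ jf).
rewrite Im_mul/= -!RintegralZl// -RintegralD//.
- by apply: eq_Rintegral => x _; rewrite Im_mul.
- exact: (integrableZl _ _ jf).
- exact: (integrableZl _ _ rf).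
Qed.

Lemma cintegralD f g : cint f -> cint g ->
  cintegral mu (fun x => f x + g x) = cintegral mu f + cintegral mu g.
Proof.
move=> [rf jf] [rg jg]; apply: complex_eq; rewrite /cintegral/=.
  by rewrite -RintegralD//; apply: eq_Rintegral => x _; rewrite Re_add.
by rewrite -RintegralD//; apply: eq_Rintegral => x _; rewrite Im_add.
Qed.

Lemma cintegral_sum (I : Type) (r : seq I) (F : I -> T -> R[i]) :
  (forall i, cint (F i)) ->
  cint (fun x => \sum_(i <- r) F i x) /\
  cintegral mu (fun x => \sum_(i <- r) F i x) = \sum_(i <- r) cintegral mu (F i).
Proof.
move=> iF; elim: r => [|i r [ir IH]].
  have -> : (fun x => \sum_(i <- [::]) F i x) = (fun=> 0) by apply/funext => x; rewrite big_nil.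
  rewrite big_nil; split; first by split; exact: integrable0.
  apply: complex_eq; rewrite /cintegral/= /Rintegral; by rewrite integral0_eq.
have -> : (fun x => \sum_(k <- i :: r) F k x) = (fun x => F i x + \sum_(k <- r) F k x).
  by apply/funext => x; rewrite big_cons.
by split; [exact: cintD|rewrite cintegralD// IH big_cons].
Qed.

End complex_integrable.

Lemma integral_rV_translate (R : realType) (n : nat) (w : 'rV[R]_n) (f : 'rV[R]_n -> \bar R) :
  measurable_fun setT f -> (\int[leb n]_v f (v + w)%R = \int[leb n]_v f v)%E.
Proof.
move=> mf; rewrite integralE [RHS]integralE.
rewrite -(ge0_integral_rV_translate w (measurable_funepos mf) (fun v => funepos_ge0 f v)).
rewrite -(ge0_integral_rV_translate w (measurable_funeneg mf) (fun v => funeneg_ge0 f v)).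
by congr (_ - _)%E; apply: eq_integral => v _; rewrite ?funeposE ?funenegE.
Qed.

Lemma integrable_rV_translate (R : realType) (n : nat) (w : 'rV[R]_n) (f : 'rV[R]_n -> \bar R) :
  (leb n).-integrable setT f -> (leb n).-integrable setT (fun v => f (v + w)%R).
Proof.
move=> /integrableP[mf foo]; apply/integrableP; split.
  by apply: measurableT_comp => //; exact: measurable_rV_translate.
by rewrite (ge0_integral_rV_translate w (f := fun v => `|f v|%E))//; exact: measurableT_comp.
Qed.

Lemma cint_translate (R : realType) (n : nat) (w : 'rV[R]_n) (f : 'rV[R]_n -> R[i]) :
  cint (leb n) f -> cint (leb n) (fun v => f (v + w)).
Proof. by move=> [/(integrable_rV_translate w) ? /(integrable_rV_translate w) ?]. Qed.

Lemma cintegral_translate (R : realType) (n : nat) (w : 'rV[R]_n) (f : 'rV[R]_n -> R[i]) :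
  cint (leb n) f -> cintegral (leb n) (fun v => f (v + w)) = cintegral (leb n) f.
Proof.
move=> [/integrableP[rf _] /integrableP[jf _]].
apply: complex_eq; rewrite /cintegral/= /Rintegral.
  by rewrite (integral_rV_translate w rf).
by rewrite (integral_rV_translate w jf).
Qed.

(** * Bumps and finite sums of their translates *)

Definition bumpv (R : realType) (n m : nat) (y : 'rV[R]_n) : R :=
  \prod_i sbump (m.+1%:R * y ord0 i).

Lemma continuous_sbump (R : realType) : continuous (@sbump R).
Proof. by apply: Ck_continuous => k; exact: Ck_sbump. Qed.

Lemma measurable_sbump_scale (R : realType) (a : R) : measurable_fun setT (fun x => sbump (a * x)).
Proof.
apply: (measurableT_comp (f := @sbump R)).
  by apply: continuous_measurable_fun; exact: (@continuous_sbump R).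
exact: mulrl_measurable.
Qed.

Lemma measurable_bumpv (R : realType) (n m : nat) : measurable_fun setT (@bumpv R n m).
Proof.
apply: (@measurable_prod_coord R n (fun=> fun x => sbump (m.+1%:R * x))) => i.
exact: measurable_sbump_scale.
Qed.

Lemma bumpv_ge0 (R : realType) (n m : nat) (y : 'rV[R]_n) : 0 <= bumpv m y.
Proof. by apply: prodr_ge0 => i _; exact: sbump_ge0. Qed.

Lemma bumpv_le1 (R : realType) (n m : nat) (y : 'rV[R]_n) : bumpv m y <= 1.
Proof. by apply: prodr_ile1 => i _; rewrite sbump_ge0 sbump_le1. Qed.

Lemma bumpv_neq0 (R : realType) (n m : nat) (y : 'rV[R]_n) : bumpv m y != 0 ->
  forall i, 0 < y ord0 i < m.+1%:R^-1.
Proof.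
move=> /prodf_neq0 h i; have /sbump_neq0/andP[] := h i isT.
by rewrite pmulr_rgt0// => -> /=; rewrite mulrC -ltr_pdivlMr// mul1r.
Qed.

Lemma bumpv_le_box (R : realType) (n m : nat) (y : 'rV[R]_n) :
  bumpv m y <= \1_(setbox (fun=> `]0, m.+1%:R^-1]%classic)) y.
Proof.
have [->|/bumpv_neq0 h] := eqVneq (bumpv m y) 0; first by rewrite indicE.
rewrite indicE mem_set ?bumpv_le1// => i.
by rewrite /= in_itv/=; have /andP[-> /ltW ->] := h i.
Qed.

Lemma integral_bumpv_le (R : realType) (n m : nat) :
  (\int[leb n]_y (bumpv m y)%:E <= ((m.+1%:R ^+ n)^-1 : R)%:E)%E.
Proof.
set B : set 'rV[R]_n := setbox (fun=> `]0, m.+1%:R^-1]%classic).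
have mB : measurable B by apply: measurable_setbox => i; exact: measurable_itv.
apply: (@le_trans _ _ (\int[leb n]_y (\1_B y)%:E)%E).
  apply: ge0_le_integral => //.
  - by move=> y _; rewrite lee_fin bumpv_ge0.
  - by apply/measurable_EFinP; exact: measurable_bumpv.
  - by apply/measurable_EFinP; exact: measurable_indic.
  - by move=> y _; rewrite lee_fin; exact: bumpv_le_box.
apply: (@le_trans _ _ (leb n B)); first by rewrite integral_indic// setIT.
rewrite /B lebesgue_setbox; last by move=> i; exact: measurable_itv.
rewrite (eq_bigr (fun=> (m.+1%:R^-1 : R)%:E)).
  by rewrite -(big_morph EFin EFinM erefl) prodr_const card_ord exprVn.
by move=> i _; rewrite lebesgue_measure_itv/= lte_fin invr_gt0 ltr0n/= sube0.
Qed.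

Lemma integrable_bumpv (R : realType) (n m : nat) :
  (leb n).-integrable setT (EFin \o @bumpv R n m).
Proof.
apply/integrableP; split; first by apply/measurable_EFinP; exact: measurable_bumpv.
apply: (@le_lt_trans _ _ (\int[leb n]_y (@bumpv R n m y)%:E)%E).
  apply: eq_leW; apply: eq_integral => y _.
  by rewrite /= ger0_norm ?bumpv_ge0.
by rewrite (le_lt_trans (integral_bumpv_le _ _ _))// ltry.
Qed.

Lemma integral_bumpv_ge (R : realType) (n m : nat) :
  (((expR (- 8) / 2) ^+ n / m.+1%:R ^+ n : R)%:E <= \int[leb n]_y (bumpv m y)%:E)%E.
Proof.
set M : R := m.+1%:R; have M0 : 0 < M by rewrite ltr0n.
rewrite (@ge0_integral_prod_coord R n (fun=> fun x => sbump (M * x))); last 2 first.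
- by move=> i; exact: measurable_sbump_scale.
- by move=> i x; exact: sbump_ge0.
rewrite -exprVn -exprMn.
set c : R := expR (- 8) / 2 * M^-1.
rewrite -[n in c ^+ n]card_ord -prodr_const (big_morph EFin EFinM erefl).
have h : (c%:E <= \int[lebesgue_measure]_x (sbump (M * x))%:E)%E.
  (* The middle half of the side [0, 1/M]: it has length 1/(2M), and [sbump_lower] applies there. *)
  set A : set R := `]1 / (4 * M), 3 / (4 * M)]%classic.
  apply: (@le_trans _ _ (\int[lebesgue_measure]_(x in A) (expR (- 8))%:E)%E).
    rewrite integral_cst//; last exact: measurable_itv.
    rewrite [X in (_ * X)%E]lebesgue_measure_itv/= lte_fin ltr_pM2r ?invr_gt0 ?mulr_gt0//.
    rewrite ltr1n/= -EFinB -EFinM lee_fin; apply: eq_leW.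
    by rewrite /c; field; rewrite gt_eqF.
  apply: (@le_trans _ _ (\int[lebesgue_measure]_(x in A) (sbump (M * x))%:E)%E).
    apply: ge0_le_integral => //.
    - exact: measurable_itv.
    - by apply/measurable_EFinP; apply: measurable_funTS; exact: measurable_sbump_scale.
    - move=> x; rewrite /A /= in_itv/= => /andP[/ltW x1 x2].
      rewrite lee_fin; apply: sbump_lower; apply/andP; split.
        by move: x1; rewrite ler_pdivrMr ?mulr_gt0//; lra.
      by move: x2; rewrite ler_pdivlMr ?mulr_gt0//; lra.
  apply: ge0_subset_integral => //.
  - exact: measurable_itv.
  - by apply/measurable_EFinP; exact: measurable_sbump_scale.
  - by move=> x _; rewrite lee_fin sbump_ge0.
have c0 : (0 <= c%:E)%E by rewrite lee_fin mulr_ge0 ?divr_ge0 ?expR_ge0 ?invr_ge0 ?ltW.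
pose P (x y : \bar R) := (0 <= x)%E /\ (x <= y)%E.
suff [] : P (\prod_(i in 'I_n) c%:E)%E
  (\prod_(i < n) \int[lebesgue_measure]_x (sbump (M * x))%:E)%E by [].
apply: (big_ind2 P) => // x1 x2 y1 y2 [x0 x12] [y0 y12].
by split; [exact: mule_ge0|exact: lee_pmul].
Qed.

Lemma dotDl (R : realType) (n : nat) (x y xi : 'rV[R]_n) : dot (x + y) xi = dot x xi + dot y xi.
Proof. by rewrite /dot -big_split/=; apply: eq_bigr => i _; rewrite mxE mulrDl. Qed.

Lemma measurable_dot (R : realType) (n : nat) (xi : 'rV[R]_n) :
  measurable_fun setT (fun y : 'rV[R]_n => dot y xi).
Proof.
apply: measurable_sum => i; apply: measurable_funM => //; exact: measurable_coord.
Qed.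

Lemma cint_wave (R : realType) (n m : nat) (xi : 'rV[R]_n) :
  cint (leb n) (fun y => expi (- (2 * pi * dot y xi)) * (bumpv m y)%:C%C).
Proof.
have mt : measurable_fun setT (fun y : 'rV[R]_n => - (2 * pi * dot y xi)).
  by apply: measurableT_comp => //; apply: measurable_funM => //; exact: measurable_dot.
have main (f : R -> R) : measurable_fun setT f -> (forall t, `|f t| <= 1) ->
    (leb n).-integrable setT (EFin \o (fun y : 'rV[R]_n => f (- (2 * pi * dot y xi)) * bumpv m y)).
  move=> mf f1; apply: (le_integrable _ _ _ (@integrable_bumpv R n m)) => //.
    apply/measurable_EFinP; apply: measurable_funM; last exact: measurable_bumpv.
    exact: measurableT_comp.
  by move=> y _; rewrite /= lee_fin normrM ler_piMl.
split.
  rewrite (_ : _ \o _ = EFin \o (fun y => cos (- (2 * pi * dot y xi)) * bumpv m y)).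
    apply: main; last exact: cos_max.
    by apply: continuous_measurable_fun; exact: continuous_cos.
  by apply/funext => y; congr EFin; rewrite Re_mul/= mulr0 subr0.
rewrite (_ : _ \o _ = EFin \o (fun y => sin (- (2 * pi * dot y xi)) * bumpv m y)).
  apply: main; last exact: sin_max.
  by apply: continuous_measurable_fun; exact: continuous_sin.
by apply/funext => y; congr EFin; rewrite Im_mul/= mulr0 add0r.
Qed.

Definition bumpc (R : realType) (n m : nat) (t y : 'rV[R]_n) : R[i]^o := (bumpv m (y - t))%:C%C.

(** Every test function of the proof has this form; in particular it covers both the packets and the
    sums over b alone obtained by freezing b'. *)
Definition csum (R : realType) (n m : nat) (C : finType) (w : C -> R[i]) (t : C -> 'rV[R]_n)
  : 'rV[R]_n -> R[i]^o := fun y => \sum_c w c * bumpc m (t c) y.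

Lemma fourier_csum (R : realType) (n m : nat) (C : finType) (w : C -> R[i])
    (t : C -> 'rV[R]_n) (xi : 'rV[R]_n) :
  fourier (csum m w t) xi =
  (\sum_c w c * expi (- (2 * pi * dot (t c) xi))) * fourier (bumpc m 0) xi.
Proof.
pose W (y : 'rV[R]_n) : R[i] := expi (- (2 * pi * dot y xi)) * (bumpv m y)%:C%C.
have iW : cint (leb n) W by exact: cint_wave.
have W0 : fourier (bumpc m 0) xi = cintegral (leb n) W.
  by rewrite /fourier; congr cintegral; apply/funext => y; rewrite /bumpc subr0.
pose F c (y : 'rV[R]_n) : R[i] := (w c * expi (- (2 * pi * dot (t c) xi))) * W (y - t c).
have iF c : cint (leb n) (F c) by apply: cintZ; exact: cint_translate.
rewrite W0 mulr_suml.
transitivity (cintegral (leb n) (fun y => \sum_c F c y)).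
  rewrite /fourier; congr cintegral; apply/funext => y.
  rewrite /csum mulr_sumr; apply: eq_bigr => c _.
  rewrite /F /W /bumpc mulrCA -!mulrA; congr (_ * _).
  rewrite [RHS]mulrA -expiD; congr (expi _ * _).
  have -> : dot y xi = dot (t c) xi + dot (y - t c) xi by rewrite -dotDl addrC subrK.
  by ring.
rewrite (cintegral_sum _ iF).2; apply: eq_bigr => c _.
by rewrite /F (cintegralZ _ (cint_translate (- t c) iW)) (cintegral_translate (- t c) iW).
Qed.

Lemma csum_bounded (R : realType) (n m : nat) (C : finType) (w : C -> R[i])
    (t : C -> 'rV[R]_n) : exists B r : R, [/\ 0 <= B, 0 <= r &
  forall y, normc (csum m w t y) <= B * \1_(setbox (fun=> `[- r, r]%classic)) y].
Proof.
exists (\sum_c normc (w c)), (1 + \sum_c \sum_i `|t c ord0 i|); split.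
- by apply: sumr_ge0 => c _; exact: normc_ge0.
- by rewrite addr_ge0// sumr_ge0// => c _; exact: sumr_ge0.
move=> y; rewrite mulr_suml (le_trans (ler_normc_sum _ _ _))//; apply: ler_sum => c _.
rewrite normcM ler_wpM2l ?normc_ge0// /bumpc normc_real ?bumpv_ge0//.
have [->|/bumpv_neq0 h] := eqVneq (bumpv m (y - t c)) 0; first by rewrite indicE.
rewrite indicE mem_set ?bumpv_le1// => i.
have /andP[h1 h2] := h i; rewrite !mxE in h1 h2.
have h3 : m.+1%:R^-1 <= 1 :> R by rewrite invf_le1 ?ltr0n// ler1n.
have h4 : `|t c ord0 i| <= \sum_c \sum_i `|t c ord0 i|.
  rewrite (bigD1 c)//= (bigD1 i)//= -addrA lerDl addr_ge0 ?sumr_ge0// => k _.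
  exact: sumr_ge0.
rewrite /= in_itv/= -ler_norml.
have -> : y ord0 i = (y ord0 i - t c ord0 i) + t c ord0 i by rewrite subrK.
by rewrite (le_trans (ler_normD _ _))// lerD// gtr0_norm// (le_trans (ltW h2)).
Qed.

Lemma measurable_bumpv_shift (R : realType) (n m : nat) (t : 'rV[R]_n) :
  measurable_fun setT (fun y : 'rV[R]_n => bumpv m (y - t)).
Proof. by apply: measurableT_comp; [exact: measurable_bumpv|exact: measurable_rV_translate]. Qed.

Lemma Re_csum (R : realType) (n m : nat) (C : finType) (w : C -> R[i])
    (t : C -> 'rV[R]_n) y :
  complex.Re (csum m w t y) = \sum_c complex.Re (w c) * bumpv m (y - t c).
Proof. by rewrite Re_sum; apply: eq_bigr => c _; rewrite Re_mul/= mulr0 subr0. Qed.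

Lemma Im_csum (R : realType) (n m : nat) (C : finType) (w : C -> R[i])
    (t : C -> 'rV[R]_n) y :
  complex.Im (csum m w t y) = \sum_c complex.Im (w c) * bumpv m (y - t c).
Proof. by rewrite Im_sum; apply: eq_bigr => c _; rewrite Im_mul/= mulr0 add0r. Qed.

Lemma measurable_Re_csum (R : realType) (n m : nat) (C : finType) (w : C -> R[i])
    (t : C -> 'rV[R]_n) : measurable_fun setT (fun y => complex.Re (csum m w t y)).
Proof.
under eq_fun do rewrite Re_csum.
by apply: measurable_sum => c; apply: measurable_funM => //; exact: measurable_bumpv_shift.
Qed.

Lemma measurable_Im_csum (R : realType) (n m : nat) (C : finType) (w : C -> R[i])
    (t : C -> 'rV[R]_n) : measurable_fun setT (fun y => complex.Im (csum m w t y)).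
Proof.
under eq_fun do rewrite Im_csum.
by apply: measurable_sum => c; apply: measurable_funM => //; exact: measurable_bumpv_shift.
Qed.

Lemma measurable_normc (R : realType) d (T : measurableType d) (f : T -> R[i]) :
  measurable_fun setT (fun x => complex.Re (f x)) ->
  measurable_fun setT (fun x => complex.Im (f x)) ->
  measurable_fun setT (fun x => normc (f x)).
Proof.
move=> mr mi.
rewrite (_ : (fun x => _) =
    Num.sqrt \o (fun x => complex.Re (f x) ^+ 2 + complex.Im (f x) ^+ 2)).
  apply: measurableT_comp.
    by apply: continuous_measurable_fun; exact: sqrt_continuous.
  by apply: measurable_funD; exact: measurable_funX.
by apply/funext => x; rewrite /=; case: (f x).
Qed.

Lemma test_function_csum (R : realType) (n m : nat) (C : finType) (w : C -> R[i])
    (t : C -> 'rV[R]_n) : test_function (csum m w t).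
Proof.
pose U c (i : 'I_n) (x : R) := sbump (m.+1%:R * x + (- (m.+1%:R * t c ord0 i))).
have CU c i k : Ck k (U c i) by apply: Ck_affine; exact: Ck_sbump.
have E c y : bumpv m (y - t c) = \prod_i U c i (y ord0 i).
  by apply: eq_bigr => i _; rewrite /U !mxE mulrBr.
split.
- rewrite (_ : (fun x => _) = tensor (fun c => complex.Re (w c)) U).
    exact: smooth_tensor.
  by apply/funext => y; rewrite Re_csum; apply: eq_bigr => c _; rewrite E.
- rewrite (_ : (fun x => _) = tensor (fun c => complex.Im (w c)) U).
    exact: smooth_tensor.
  by apply/funext => y; rewrite Im_csum; apply: eq_bigr => c _; rewrite E.
- have [B [r [B0 r0 Br]]] := csum_bounded m w t.
  apply: (@compact_closure_bounded _ _ _ r) => v /= v0 i.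
  have := Br v; rewrite indicE.
  have [/set_mem vr _|_] := boolP (v \in _).
    by have := vr i; rewrite /= in_itv/= ler_norml.
  rewrite mulr0 => h; have : normc (csum m w t v) = 0.
    by apply/eqP; rewrite eq_le h normc_ge0.
  by move=> /ComplexField.Normc.eq0_normc v0'; rewrite v0' eqxx in v0.
Qed.

Lemma completed_measurable (R : realType) d (T : measurableType d)
    (mu : {measure set T -> \bar R}) (f : T -> R) :
  measurable_fun setT f -> completed_measurable_fun mu f.
Proof.
move=> mf B mB; have := mf measurableT B mB; rewrite setTI => mfB.
exists (f @^-1` B) => //; exists set0; last by rewrite setU0.
exact: negligible_set0.
Qed.

Lemma Lp_csum (R : realType) (n m : nat) (C : finType) (w : C -> R[i])
    (t : C -> 'rV[R]_n) (q : R) : 1 <= q -> Lp (leb n) q (csum m w t).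
Proof.
move=> q1; have q0 : 0 < q by rewrite (lt_le_trans ltr01).
split.
  split; apply: completed_measurable; [exact: measurable_Re_csum|exact: measurable_Im_csum].
have [B [r [B0 r0 Br]]] := csum_bounded m w t.
rewrite /Lp_norm unlock/=.
rewrite poweR_lty//.
set A := setbox _ in Br.
have mA : measurable A by apply: measurable_setbox => i; exact: measurable_itv.
apply: (@le_lt_trans _ _ (\int[leb n]_y ((B `^ q)%:E * (\1_A y)%:E))%E).
  apply: ge0_le_integral => //.
  - apply/measurable_EFinP; apply: (@measurableT_comp _ _ _ _ _ _ (fun x : R => x `^ q)).
      exact: measurable_powR.
    apply: measurableT_comp => //; apply: measurable_normc.
      exact: measurable_Re_csum.
    exact: measurable_Im_csum.
  - apply/measurable_EFinP; apply: measurable_funM => //; exact: measurable_indic.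
  - move=> y _; rewrite /= -EFinM lee_fin ger0_norm ?normc_ge0//.
    apply: (@le_trans _ _ ((B * \1_A y) `^ q)).
      by apply: ge0_ler_powR; rewrite ?nnegrE ?normc_ge0 ?mulr_ge0 ?(ltW q0).
    rewrite powRM// indicE; case: (y \in A); last by rewrite powR0 ?gt_eqF.
    by rewrite powR1.
rewrite ge0_integralZl//; last 2 first.
- by apply/measurable_EFinP; exact: measurable_indic.
- by rewrite lee_fin powR_ge0.
rewrite integral_indic// setIT lte_mul_pinfty ?lee_fin ?powR_ge0//.
have -> // : (leb n A < +oo)%E.
rewrite /A lebesgue_setbox; last by move=> i; exact: measurable_itv.
rewrite (eq_bigr (fun=> (r + r)%:E)).
  by rewrite -(big_morph EFin EFinM erefl) ltry.
move=> i _; rewrite lebesgue_measure_itv/= lte_fin.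
case: ifPn; first by rewrite -EFinB opprK.
by rewrite -leNgt => h; congr EFin; lra.
Qed.

(** * Wave packets and functionals on L^q *)

Lemma count_nat_itv (R : realType) (K : nat) (x L : R) : 0 <= L ->
  \sum_(b < K) ((x < b%:R < x + L)%R)%:R <= L + 1 :> R.
Proof.
move=> L0; set c := \sum_(_ < _) _.
(* The second bound strengthens the induction: once an integer has been counted, all counted ones
   lie between x and K. If the next integer K is also counted, K - x < L bounds the new total by L +
   1. *)
suff [->|[]//] : c = 0 \/ (c <= L + 1 /\ c <= K%:R - x) by rewrite addr_ge0.
rewrite {}/c; elim: K => [|K IH]; first by left; rewrite big_ord0.
rewrite big_ord_recr/=; move: IH; set c := \sum_(_ < _) _ => IH.
rewrite -[K.+1]addn1 natrD.
case: (boolP (x < K%:R < x + L)) => [/andP[h1 h2]|_].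
  by rewrite /= mulr1n; right; case: IH => [->|[h3 h4]]; split; lra.
by rewrite /= mulr0n addr0; case: IH => [->|[h3 h4]]; [left|right; split; lra].
Qed.

(** Jensen's inequality with weights v, from the tangent of x^q at the weighted mean t = X / V; the
    tangent lies below the power by Young's inequality for x and t^(q-1). *)
Lemma weighted_power_mean (R : realType) (I : finType) (x v : I -> R) (p q : R) :
  2 <= q -> p^-1 + q^-1 = 1 -> (forall i, 0 <= x i) -> (forall i, 0 <= v i) ->
  (\sum_i x i * v i) `^ q <= (\sum_i x i `^ q * v i) * (\sum_i v i) `^ (q - 1).
Proof.
move=> q2 pq x0 v0; have q0 : 0 < q by lra.
have qn : q != 0 by rewrite gt_eqF.
have q1n : q - 1 != 0 by apply/lt0r_neq0; lra.
set V := \sum_i v i; have V0 : 0 <= V by exact: sumr_ge0.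
have [VE|Vn] := eqVneq V 0.
  have vE i : v i = 0.
    have := @psumr_eq0P _ _ xpredT v (fun i _ => v0 i) VE; exact.
  rewrite [\sum_i x i * v i]big1 => [|i _]; last by rewrite vE mulr0.
  rewrite powR0 ?gt_eqF// mulr_ge0 ?powR_ge0// sumr_ge0// => i _.
  by rewrite mulr_ge0 ?powR_ge0.
have Vp : 0 < V by rewrite lt_neqAle eq_sym Vn.
set X := \sum_i x i * v i; have X0 : 0 <= X by apply: sumr_ge0 => i _; exact: mulr_ge0.
set t := X / V; have t0 : 0 <= t by rewrite divr_ge0.
have pE : p = q / (q - 1).
  have -> : p = (p^-1)^-1 by rewrite invrK.
  have -> : p^-1 = 1 - q^-1 by lra.
  by field; rewrite ?qn ?q1n.
have p0 : 0 < p by rewrite pE divr_gt0//; lra.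
have key i : t `^ q + q * t `^ (q - 1) * (x i - t) <= x i `^ q.
  have := conjugate_powR (x0 i) (powR_ge0 t (q - 1)) q0 p0.
  rewrite addrC pq => /(_ erefl).
  rewrite -powRrM (_ : (q - 1) * p = q); last first.
    by rewrite pE mulrC divfK.
  have -> : x i * t `^ (q - 1) <= x i `^ q / q + t `^ q / p =
      (q * (x i * t `^ (q - 1)) <= x i `^ q + (q - 1) * t `^ q).
    rewrite -(ler_pM2l q0); congr (_ <= _); rewrite [in p^-1]pE invf_div; field.
    by rewrite ?qn.
  have : t `^ (q - 1) * t = t `^ q.
    have [->|tn] := eqVneq t 0; first by rewrite mulr0 powR0.
    rewrite -{2}(powRr1 t0) -powRD ?subrK//.
    by rewrite tn implybT.
  move=> tE h; rewrite mulrBr -mulrA -(mulrA q) tE.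
  by move: h; rewrite [x i * _]mulrC; lra.
have XE : X = t * V by rewrite /t divfK.
have h : t `^ q * V <= \sum_i x i `^ q * v i.
  apply: (@le_trans _ _ (\sum_i (t `^ q + q * t `^ (q - 1) * (x i - t)) * v i)); last first.
    by apply: ler_sum => i _; rewrite ler_wpM2r.
  rewrite (eq_bigr (fun i => t `^ q * v i + q * t `^ (q - 1) * (x i * v i - t * v i))); last first.
    by move=> i _; ring.
  rewrite big_split/= -!mulr_sumr -/V.
  by rewrite sumrB -mulr_sumr -/X -/V XE subrr mulr0 addr0.
rewrite XE powRM// (_ : V `^ q = V * V `^ (q - 1)).
  by rewrite mulrA ler_wpM2r ?powR_ge0.
by rewrite -{2}(powRr1 V0) -powRD ?Vn ?implybT// addrC subrK.
Qed.

Definition shift (R : realType) (n s : nat) (b b' : freq n s) : 'rV[R]_n :=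
  \row_i (((b i)%:R - (b' i)%:R) / s.+1%:R).

(** A translate is nonzero at y only if each b_i lies in an open interval of length S/M. It contains
    at most S/M + 1 integers, which is at most 2 S/M because m <= s. *)
Lemma sum_bumpv_shift (R : realType) (n m s : nat) (b' : freq n s) (y : 'rV[R]_n) :
  (m <= s)%N -> \sum_b bumpv m (y - shift R b b') <= (2 * s.+1%:R / m.+1%:R) ^+ n.
Proof.
move=> ms; set S : R := s.+1%:R; set M : R := m.+1%:R.
have S0 : 0 < S by rewrite ltr0n.
have M0 : 0 < M by rewrite ltr0n.
have MS : M <= S by rewrite ler_nat.
pose F (i : 'I_n) (k : 'I_(nfreq s).+1) : R :=
  ((S * y ord0 i + (b' i)%:R - S / M < k%:R < S * y ord0 i + (b' i)%:R - S / M + S / M)%R)%:R.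
apply: (@le_trans _ _ (\sum_(b : freq n s) \prod_i F i (b i))).
  apply: ler_sum => b _.
  have [->|h] := eqVneq (bumpv m (y - shift R b b')) 0.
    by apply: prodr_ge0 => i _; rewrite ler0n.
  rewrite (le_trans (bumpv_le1 _ _))// big1// => i _.
  have /andP[h1 h2] := bumpv_neq0 h i.
  rewrite /F; have -> // : (S * y ord0 i + (b' i)%:R - S / M < (b i)%:R <
    S * y ord0 i + (b' i)%:R - S / M + S / M).
  move: h1 h2; rewrite !mxE -/S -/M => h1 h2.
  move: h1; rewrite subr_gt0 ltr_pdivrMr// => h1.
  have h3 : y ord0 i * S - ((b i)%:R - (b' i)%:R) < S / M.
    have : (y ord0 i - ((b i)%:R - (b' i)%:R) / S) * S < M^-1 * S by rewrite ltr_pM2r.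
    by rewrite mulrBl divfK ?gt_eqF// [M^-1 * _]mulrC.
  move: h1 h3; rewrite [y ord0 i * S]mulrC.
  move: (S * y ord0 i) (S / M) (b i)%:R (b' i)%:R => u1 u2 u3 u4 h1 h3.
  by apply/andP; split; lra.
rewrite -(bigA_distr_bigA F) -[n in _ ^+ n]card_ord -prodr_const.
apply: ler_prod => i _; apply/andP; split; first by apply: sumr_ge0 => k _; rewrite ler0n.
have SM0 : 0 <= S / M by rewrite divr_ge0// ltW.
apply: (le_trans (count_nat_itv _ _ SM0)).
have : 1 <= S / M by rewrite ler_pdivlMr// mul1r.
by rewrite -mulrA; move: (S / M) => u h; lra.
Qed.

(** The power mean inequality with the translated bumps as weights trades the overlap of the
    translates for the factor of [sum_bumpv_shift] to the power q - 1; what remains to integrate is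
    linear in the bumps, each of integral at most M^-n. *)
Lemma integral_csum_shift (R : realType) (n m s : nat) (b' : freq n s) (p q : R)
    (d : freq n s -> R[i]) : 2 <= q -> p^-1 + q^-1 = 1 -> (m <= s)%N ->
  (\int[leb n]_y (normc (csum m d (fun b => shift R b b') y) `^ q)%:E <=
   (((2 * s.+1%:R / m.+1%:R) ^+ n) `^ (q - 1) / m.+1%:R ^+ n *
     \sum_b normc (d b) `^ q)%:E)%E.
Proof.
move=> q2 pq ms; set D := (_ ^+ n) `^ (q - 1).
have D0 : 0 <= D by exact: powR_ge0.
apply: (@le_trans _ _
  (\int[leb n]_y (\sum_b normc (d b) `^ q * D * bumpv m (y - shift R b b'))%:E)%E).
  apply: ge0_le_integral => //.
  - by move=> y _; rewrite lee_fin powR_ge0.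
  - apply/measurable_EFinP; apply: (@measurableT_comp _ _ _ _ _ _ (fun x : R => x `^ q)).
      exact: measurable_powR.
    by apply: measurable_normc; [exact: measurable_Re_csum|exact: measurable_Im_csum].
  - apply/measurable_EFinP; apply: measurable_sum => b; apply: measurable_funM => //.
    exact: measurable_bumpv_shift.
  - move=> y _; rewrite lee_fin.
    apply: (@le_trans _ _ ((\sum_b normc (d b) * bumpv m (y - shift R b b')) `^ q)).
      apply: ge0_ler_powR; rewrite ?nnegrE ?normc_ge0//; first by lra.
        by apply: sumr_ge0 => b _; rewrite mulr_ge0 ?normc_ge0 ?bumpv_ge0.
      rewrite (le_trans (ler_normc_sum _ _ _))//; apply: ler_sum => b _.
      by rewrite normcM /bumpc normc_real ?bumpv_ge0.
    apply: (le_trans (weighted_power_mean q2 pq _ _)).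
    - by move=> b; exact: normc_ge0.
    - by move=> b; exact: bumpv_ge0.
    rewrite mulr_suml; apply: ler_sum => b _; rewrite -!mulrA ler_wpM2l ?powR_ge0//.
    rewrite mulrC ler_wpM2r ?bumpv_ge0//.
    apply: ge0_ler_powR; rewrite ?nnegrE; first by lra.
    - by apply: sumr_ge0 => k _; exact: bumpv_ge0.
    - by rewrite exprn_ge0// divr_ge0// mulr_ge0.
    - exact: sum_bumpv_shift.
under eq_integral do rewrite -sumEFin.
rewrite ge0_integral_sum//; last 2 first.
- move=> b; apply/measurable_EFinP; apply: measurable_funM => //; exact: measurable_bumpv_shift.
- by move=> b y _; rewrite lee_fin mulr_ge0 ?bumpv_ge0// mulr_ge0 ?powR_ge0.
rewrite mulr_sumr -sumEFin; apply: lee_sum => b _.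
under eq_integral do rewrite EFinM.
have mb : measurable_fun setT (fun y : 'rV[R]_n => (bumpv m (y - shift R b b'))%:E).
  by apply/measurable_EFinP; exact: measurable_bumpv_shift.
rewrite ge0_integralZl//; last 2 first.
- by move=> y _; rewrite lee_fin bumpv_ge0.
- by rewrite lee_fin mulr_ge0// powR_ge0.
rewrite (ge0_integral_rV_translate (- shift R b b') (f := fun y => (bumpv m y)%:E)); last 2 first.
- by apply/measurable_EFinP; exact: measurable_bumpv.
- by move=> y; rewrite lee_fin bumpv_ge0.
apply: (@le_trans _ _ ((normc (d b) `^ q * D)%:E * (((m.+1%:R ^+ n)^-1 : R)%:E))%E).
  apply: lee_wpmul2l; first by rewrite lee_fin mulr_ge0// powR_ge0.
  exact: integral_bumpv_le.
by rewrite -EFinM lee_fin [leRHS]mulrC mulrA.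
Qed.

Section functional.
Context {R : realType} {n : nat}.
Variables (m : nat) (q : R) (l : ('rV[R]_n -> R[i]^o) -> R[i]).
Hypotheses (q1 : 1 <= q) (dl : dual (Lp (leb n) q) (Lp_norm (leb n) q) l).

Let norm := fine (dual_norm (Lp (leb n) q) (Lp_norm (leb n) q) l).

Lemma dual_csum (C : finType) (w : C -> R[i]) (t : C -> 'rV[R]_n) :
  l (csum m w t) = \sum_c w c * l (bumpc m (t c)).
Proof.
have [lin _] := dl.
(* Linearity is available one term at a time, so the induction runs over sequences of indices
   counted with multiplicity; in the full enumeration all multiplicities are 1. *)
pose W (r : seq C) c := w c * (count_mem c r)%:R.
have E0 : csum m (W [::]) t = 0.
  by apply/funext => y; rewrite /csum big1// => c _; rewrite /W mulr0 mul0r.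
have l0 : l 0 = 0.
  have L0 : Lp (leb n) q 0 by rewrite -E0; exact: Lp_csum.
  have := lin 1 _ _ L0 L0; rewrite scale1r addr0 mul1r => /eqP.
  by rewrite -subr_eq0 opprD addrA subrr sub0r oppr_eq0 => /eqP.
have Eb c : Lp (leb n) q (bumpc m (t c)).
  rewrite (_ : bumpc _ _ = csum m (fun _ : 'I_1 => 1) (fun=> t c)); first exact: Lp_csum.
  by apply/funext => y; rewrite /csum big_ord1 mul1r.
have ind (r : seq C) : l (csum m (W r) t) = \sum_(c <- r) w c * l (bumpc m (t c)).
  elim: r => [|c r IH]; first by rewrite E0 l0 big_nil.
  rewrite big_cons -IH -lin//; last exact: Lp_csum.
  congr l; apply/funext => y; rewrite /= /csum.
  transitivity (\sum_d (w d * (c == d)%:R * bumpc m (t d) y + W r d * bumpc m (t d) y)).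
    by apply: eq_bigr => d _; rewrite /W /= natrD mulrDr mulrDl.
  rewrite big_split/=; congr (_ + _).
  rewrite (bigD1 c)//= eqxx mulr1 big1 ?addr0// => d dc.
  by rewrite eq_sym (negbTE dc) mulr0 mul0r.
have -> : csum m w t = csum m (W (index_enum C)) t.
  apply/funext => y; apply: eq_bigr => c _; congr (_ * _).
  by rewrite /W count_uniq_mem ?index_enum_uniq// mem_index_enum mulr1.
exact: ind.
Qed.

Lemma dual_norm_fin :
  (0 <= dual_norm (Lp (leb n) q) (Lp_norm (leb n) q) l)%E /\
  dual_norm (Lp (leb n) q) (Lp_norm (leb n) q) l \is a fin_num.
Proof.
have [_ [M lM]] := dl.
have d0 : (0 <= dual_norm (Lp (leb n) q) (Lp_norm (leb n) q) l)%E.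
  pose z : 'rV[R]_n -> R[i]^o := csum m (fun _ : 'I_1 => 0) (fun=> 0).
  apply: (@le_trans _ _ (normc (l z))%:E); first by rewrite lee_fin normc_ge0.
  apply: ereal_sup_ubound; exists z => //; split; first exact: Lp_csum.
  rewrite /Lp_norm (_ : (fun x => _) = cst 0%E).
    by rewrite Lnorm0// eqe gt_eqF// (lt_le_trans ltr01).
  apply/funext => y; rewrite /z /csum big_ord1 mul0r; congr EFin.
  exact: ComplexField.Normc.normc0.
split => //; rewrite ge0_fin_numE//.
(* The constant in [dual] carries no sign, and monotonicity in the norm requires a nonnegative
   one. *)
apply: (@le_lt_trans _ _ (Num.max M 0)%:E); last exact: ltry.
apply: ge_ereal_sup => _ [v [Ev Nv] <-].
apply: (le_trans (lM v Ev)).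
apply: (@le_trans _ _ ((Num.max M 0)%:E * Lp_norm (leb n) q v)%E).
  by apply: lee_wpmul2r; [exact: Lnorm_ge0|rewrite lee_fin le_max lexx].
by rewrite -[leRHS]mule1; apply: lee_wpmul2l => //; rewrite lee_fin le_max lexx orbT.
Qed.

Lemma dual_csum_le (C : finType) (w : C -> R[i]) (t : C -> 'rV[R]_n) (B : R) : 0 <= B ->
  (\int[leb n]_y (normc (csum m w t y) `^ q)%:E <= (B `^ q)%:E)%E ->
  normc (l (csum m w t)) <= norm * B.
Proof.
have q0 : 0 < q by rewrite (lt_le_trans ltr01).
have [d0 dfin] := dual_norm_fin.
move=> B0 hB.
have NE (w' : C -> R[i]) : Lp_norm (leb n) q (csum m w' t) =
    ((\int[leb n]_y (normc (csum m w' t y) `^ q)%:E) `^ q^-1)%E.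
  rewrite /Lp_norm unlock/=; congr poweR; apply: eq_integral => y _.
  by rewrite /= ger0_norm ?normc_ge0.
have [B00|Bn] := eqVneq B 0.
  (* For B = 0 the vector has norm 0 and cannot be rescaled to the unit ball; continuity of l gives
     the value 0 directly. *)
  have [_ [M lM]] := dl.
  have := lM _ (Lp_csum m w t q1); rewrite NE.
  have -> : (\int[leb n]_y (normc (csum m w t y) `^ q)%:E = 0)%E.
    apply/eqP; rewrite eq_le integral_ge0 ?andbT => [|y _]; last by rewrite lee_fin powR_ge0.
    by rewrite (le_trans hB)// B00 powR0 ?gt_eqF.
  rewrite poweR0r ?gt_eqF ?invr_gt0// mule0 lee_fin => h.
  by rewrite B00 mulr0.
have Bp : 0 < B by rewrite lt_neqAle eq_sym Bn.
have Bi : 0 <= B^-1 by rewrite invr_ge0.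
pose w' c := (B^-1)%:C%C * w c.
have wE y : csum m w' t y = (B^-1)%:C%C * csum m w t y.
  by rewrite /csum mulr_sumr; apply: eq_bigr => c _; rewrite mulrA.
have N1 : (Lp_norm (leb n) q (csum m w' t) <= 1)%E.
  rewrite NE (_ : 1%E = (1%:E `^ q^-1)%E :> \bar R); last by rewrite poweR_EFin powR1.
  apply: ge0_ler_poweR; first by rewrite invr_ge0 ltW.
    by apply: integral_ge0 => y _; rewrite lee_fin powR_ge0.
  under eq_integral do rewrite wE normc_realM// powRM ?normc_ge0// EFinM.
  rewrite ge0_integralZl//.
  - apply: (@le_trans _ _ ((B^-1 `^ q)%:E * (B `^ q)%:E)%E).
      by apply: lee_wpmul2l => //; rewrite lee_fin powR_ge0.
    by rewrite -EFinM -powRM// mulVf// powR1.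
  - apply/measurable_EFinP; apply: (@measurableT_comp _ _ _ _ _ _ (fun x : R => x `^ q)).
      exact: measurable_powR.
    by apply: measurable_normc; [exact: measurable_Re_csum|exact: measurable_Im_csum].
  - by move=> y _; rewrite lee_fin powR_ge0.
  - by rewrite lee_fin powR_ge0.
have : ((normc (l (csum m w' t)))%:E <= dual_norm (Lp (leb n) q) (Lp_norm (leb n) q) l)%E.
  by apply: ereal_sup_ubound; exists (csum m w' t) => //; split => //; exact: Lp_csum.
rewrite -(fineK dfin) lee_fin -/norm.
have -> : l (csum m w' t) = (B^-1)%:C%C * l (csum m w t).
  by rewrite !dual_csum mulr_sumr; apply: eq_bigr => c _; rewrite mulrA.
by rewrite normc_realM// mulrC ler_pdivrMr.
Qed.

(* The phase is that of the shift (b - b') / S against the j-th grid point. *)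
Definition packet_weight (s : nat) (j : freq n s) (bb : freq n s * freq n s) : R[i] :=
  (((nfreq s).+1%:R ^+ n)^-1 : R)%:C%C * e (dft_phase (fun i => (bb.2 i)%:R) bb.1 j).

Definition packet (s : nat) (j : freq n s) : 'rV[R]_n -> R[i]^o :=
  csum m (packet_weight j) (fun bb => shift R bb.1 bb.2).

(** The q-th power of a norm bound: the Hausdorff-Young factor of the transform in j times the
    overlap factor of [integral_csum_shift]. *)
Definition packet_const (s : nat) : R :=
  HY_const' q * ((nfreq s).+1 ^ n)%:R *
    (((2 * s.+1%:R / m.+1%:R) ^+ n) `^ (q - 1) / m.+1%:R ^+ n).

Lemma packet_const_ge0 (s : nat) : 2 <= q -> 0 <= packet_const s.
Proof.
move=> q2; apply: mulr_ge0; first by rewrite mulr_ge0 ?HY_const'_ge0.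
by rewrite divr_ge0 ?powR_ge0// exprn_ge0.
Qed.

(** For coefficients c, the sum of the c_j l(f_j) is the mean over b' of values of l at sums of
    translates indexed by b, whose coefficients are the discrete Fourier transform of c with offset
    b'. Hausdorff-Young bounds these in l^q by the l^p norm of c, uniformly in b', and
    [finite_dual_norm] converts the estimate into an l^q bound on the l(f_j). *)
Lemma dual_packet_le (s : nat) (p : R) : 2 <= q -> p^-1 + q^-1 = 1 -> (m <= s)%N ->
  \sum_(j : freq n s) normc (l (packet j)) `^ q <= norm `^ q * packet_const s.
Proof.
move=> q2 pq ms; have q0 : 0 < q by lra.
have [d0 dfin] := dual_norm_fin.
have n0 : 0 <= norm by exact: fine_ge0.
have pc0 := packet_const_ge0 s q2.
have p0 : 0 < p.
  have : q^-1 <= 2^-1 by rewrite lef_pV2 ?posrE.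
  by move=> h; rewrite -invr_gt0; lra.
set K : nat := (nfreq s).+1.
have K0 : 0 < (K%:R ^+ n : R) by rewrite exprn_gt0// ltr0n.
have -> : norm `^ q * packet_const s = (norm * packet_const s `^ q^-1) `^ q.
  by rewrite powRM ?powR_ge0// -powRrM mulVf ?gt_eqF// powRr1.
apply: (finite_dual_norm q2 pq); first by rewrite mulr_ge0 ?powR_ge0.
move=> c; set X := \sum_j normc (c j) `^ p.
have X0 : 0 <= X by apply: sumr_ge0 => j _; exact: powR_ge0.
pose d (b' b : freq n s) : R[i] := \sum_j e (dft_phase (fun i => (b' i)%:R) b j) * c j.
have -> : \sum_j c j * l (packet j) =
    \sum_(b' : freq n s) ((K%:R ^+ n)^-1 : R)%:C%C * l (csum m (d b') (fun b => shift R b b')).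
  under eq_bigr do rewrite /packet dual_csum mulr_sumr.
  rewrite exchange_big/= -(pair_big xpredT xpredT (fun b b' =>
    \sum_(j : freq n s) c j * (packet_weight j (b, b') * l (bumpc m (shift R b b')))))/=.
  rewrite exchange_big/=; apply: eq_bigr => b' _.
  rewrite dual_csum mulr_sumr; apply: eq_bigr => b _.
  rewrite /d mulr_suml mulr_sumr; apply: eq_bigr => j _.
  by rewrite /packet_weight/= -/K; ring.
apply: (le_trans (ler_normc_sum _ _ _)).
set B : R := norm * packet_const s `^ q^-1 * X `^ p^-1.
apply: (@le_trans _ _ (\sum_(b' : freq n s) (K%:R ^+ n)^-1 * B)); last first.
  rewrite sumr_const card_ffun !card_ord -[_ *+ (_ ^ _)]mulr_natl natrX -/K mulrA mulfV ?mul1r//.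
  by rewrite gt_eqF.
apply: ler_sum => b' _; rewrite normc_realM ?invr_ge0 ?(ltW K0)// ler_wpM2l ?invr_ge0 ?(ltW K0)//.
rewrite /B -mulrA; apply: dual_csum_le; first by rewrite mulr_ge0 ?powR_ge0.
apply: (le_trans (integral_csum_shift _ _ q2 pq ms)); rewrite lee_fin.
rewrite powRM ?powR_ge0// -!powRrM mulVf ?gt_eqF// powRr1// [p^-1 * q]mulrC.
rewrite /packet_const [leRHS]mulrAC [leLHS]mulrC ler_wpM2r//.
exact: dft_hausdorff_young.
Qed.

End functional.

(** Translation by the shifts becomes modulation, and in each coordinate the double sum over b and
    b' is a squared modulus, so the kernel is real and nonnegative. The weight K^-n is the
    normalisation of [fejer]. *)
Lemma fourier_packet (R : realType) (n m s : nat) (j : freq n s) (xi : 'rV[R]_n) :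
  fourier (packet m j) xi = ((fejer_kernel j xi)%:C)%C * fourier (bumpc m 0) xi.
Proof.
rewrite fourier_csum; congr (_ * _).
set K : nat := (nfreq s).+1; set S : R := s.+1%:R.
have S0 : S != 0 by rewrite pnatr_eq0.
have KE : K%:R = S ^+ 3 :> R by exact: nfreqR.
pose F i (x y : 'I_K) : R[i] := e ((x%:R - y%:R) * ((grid R s (j i) - xi ord0 i) / S)).
have E (b b' : freq n s) : packet_weight j (b, b') * expi (- (2 * pi * dot (shift R b b') xi)) =
    ((K%:R ^+ n)^-1 : R)%:C%C * \prod_i F i (b i) (b' i).
  rewrite /packet_weight -mulrA; congr (_ * _).
  rewrite -expiD /F -expi_sum; congr expi.
  rewrite /dft_phase /dot -mulrBr -sumrB -mulr_sumr; congr (_ * _).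
  apply: eq_bigr => i _; rewrite !mxE /= -/S -/K KE /grid -/S.
  by field.
rewrite -(pair_big xpredT xpredT (fun b b' : freq n s => packet_weight j (b, b') *
  expi (- (2 * pi * dot (shift R b b') xi))))/=.
under eq_bigr do under eq_bigr do rewrite E.
rewrite exchange_big/=.
under eq_bigr do rewrite -mulr_sumr.
rewrite -mulr_sumr.
transitivity (((K%:R ^+ n)^-1 : R)%:C%C * \prod_i \sum_(y < K) \sum_(x < K) F i x y).
  congr (_ * _); rewrite bigA_distr_bigA/=; apply: eq_bigr => b' _.
  by rewrite bigA_distr_bigA.
rewrite /fejer_kernel rmorph_prod/=.
rewrite -[n in _ ^+ n]card_ord -prodr_const -prodfV rmorph_prod/= -big_split/=.
apply: eq_bigr => i _; rewrite /kernel1 /fejer -/K -/S rmorphM/=; congr (_ * _).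
by rewrite sqr_normc_expi_sum exchange_big.
Qed.

(** * Lower bound for the Fourier transform of a bump *)

Lemma Re_le_normc (R : realType) (z : R[i]) : complex.Re z <= normc z.
Proof.
case: z => x y /=; rewrite (le_trans (ler_norm x))// -sqrtr_sqr ler_wsqrtr//.
by rewrite lerDl sqr_ge0.
Qed.

Lemma normr_Re_le (R : realType) (z : R[i]) : `|complex.Re z| <= normc z.
Proof.
by case: z => x y /=; rewrite -sqrtr_sqr ler_wsqrtr// lerDl sqr_ge0.
Qed.

Lemma normr_Im_le (R : realType) (z : R[i]) : `|complex.Im z| <= normc z.
Proof.
by case: z => x y /=; rewrite -sqrtr_sqr ler_wsqrtr// lerDr sqr_ge0.
Qed.

Lemma normc_le (R : realType) (z : R[i]) : normc z <= `|complex.Re z| + `|complex.Im z|.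
Proof.
case: z => x y /=; rewrite -(ger0_norm (addr_ge0 (normr_ge0 x) (normr_ge0 y))) -sqrtr_sqr.
rewrite ler_wsqrtr// sqrrD !real_normK ?num_real// -addrA [_ *+ 2 + _]addrC addrA lerDl.
by rewrite mulrn_wge0// mulr_ge0.
Qed.

Lemma cos_ge_cos1 (R : realType) (x : R) : `|x| <= 1 -> cos 1 <= cos x.
Proof.
move=> x1; have -> : cos x = cos `|x| by have [//|_] := ger0P x; rewrite cosN.
have pi1 : (1 : R) <= pi by have := pi_ge2 R; lra.
by rewrite leNgt ltr_cos ?in_itv/= ?normr_ge0/= ?(le_trans x1)// ?ler01// -leNgt.
Qed.

Definition fourier_lower (R : realType) (n : nat) : R := cos 1 * (expR (- 8) / 2) ^+ n.

Lemma fourier_lower_gt0 (R : realType) (n : nat) : 0 < fourier_lower R n.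
Proof. by rewrite mulr_gt0 ?cos1_gt0// exprn_gt0// divr_gt0// expR_gt0. Qed.

(** Once M >= 2 pi sum_i |xi_i|, the phase is at most 1 in absolute value on the support of the
    bump, so the real part of the transform is at least cos 1 times the integral of the bump, itself
    bounded below by [integral_bumpv_ge]. *)
Lemma fourier_bump_ge (R : realType) (n : nat) (xi : 'rV[R]_n) :
  \forall m \near \oo,
    fourier_lower R n <= m.+1%:R ^+ n * normc (fourier (bumpc m (0 : 'rV[R]_n)) xi).
Proof.
near=> m; set M : R := m.+1%:R; have M0 : 0 < M by rewrite ltr0n.
have hM : 2 * pi * \sum_i `|xi ord0 i| <= M.
  rewrite (le_trans (ltW (truncnS_gt _)))// ler_nat ltnS.
  by near: m; exact: nbhs_infty_ge.
rewrite mulrC -ler_pdivrMr ?exprn_gt0// (le_trans _ (Re_le_normc _))//.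
rewrite Re_cintegral.
have E : (fun y : 'rV[R]_n => complex.Re (expi (- (2 * pi * dot y xi)) * bumpc m 0 y)) =
    (fun y => cos (- (2 * pi * dot y xi)) * bumpv m y).
  by apply/funext => y; rewrite Re_mul/= subr0 mulr0 subr0.
rewrite E; have [iW _] := @cint_wave R n m xi.
have {}iW : (leb n).-integrable setT
    (EFin \o (fun y : 'rV[R]_n => cos (- (2 * pi * dot y xi)) * bumpv m y)).
  rewrite -E; move: iW; congr integrable; apply/funext => y.
  by rewrite /= /bumpc subr0.
have ib := integrable_bumpv R n m.
apply: (@le_trans _ _ (cos 1 * \int[leb n]_y bumpv m y)).
  rewrite /fourier_lower -mulrA ler_wpM2l ?(ltW (cos1_gt0 R))// /Rintegral.
  rewrite -lee_fin fineK; first exact: integral_bumpv_ge.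
  exact: integrable_fin_num.
rewrite -RintegralZl//; apply: le_Rintegral => //.
  exact: (integrableZl _ _ ib).
move=> y _; have [->|/bumpv_neq0 h] := eqVneq (bumpv m y) 0; first by rewrite !mulr0.
rewrite ler_wpM2r ?bumpv_ge0//; apply: cos_ge_cos1.
rewrite normrN normrM ger0_norm ?mulr_ge0 ?pi_ge0//.
apply: (@le_trans _ _ (2 * pi * (M^-1 * \sum_i `|xi ord0 i|))).
  rewrite ler_wpM2l ?mulr_ge0 ?pi_ge0// /dot mulr_sumr.
  rewrite (le_trans (ler_norm_sum _ _ _))//; apply: ler_sum => i _.
  have /andP[h1 h2] := h i; rewrite normrM ler_wpM2r// gtr0_norm//; exact: ltW.
by rewrite mulrCA mulrC ler_pdivrMr// mul1r.
Unshelve. all: by end_near. Qed.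

(** * Measurability and null sets on the product *)

Lemma measurable_Rintegral d1 d2 (X : measurableType d1) (Y : measurableType d2)
    (R : realType) (nu : {sigma_finite_measure set Y -> \bar R}) (F : X * Y -> R) :
  measurable_fun setT F -> measurable_fun setT (fun x => \int[nu]_y F (x, y)).
Proof.
move=> mF; have mE : measurable_fun setT (EFin \o F) by apply/measurable_EFinP.
rewrite /Rintegral; apply: (@measurableT_comp _ _ _ _ _ _ (@fine R)).
  exact: fine_measurable.
(* Tonelli gives the measurability of the positive and the negative part separately; they are
   subtracted in the extended reals before [fine] is applied. *)
under eq_fun do rewrite integralE.
apply: emeasurable_funB.
  rewrite (_ : (fun x => _) = fubini_F nu (EFin \o F)^\+%E); last first.
    by apply/funext => x; apply: eq_integral => y _; rewrite !funeposE.
  exact: (measurable_fun_fubini_tonelli_F _ (measurable_funepos mE) (fun z => funepos_ge0 _ z)).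
rewrite (_ : (fun x => _) = fubini_F nu (EFin \o F)^\-%E); last first.
  by apply/funext => x; apply: eq_integral => y _; rewrite !funenegE.
exact: (measurable_fun_fubini_tonelli_F _ (measurable_funeneg mE) (fun z => funeneg_ge0 _ z)).
Qed.

Lemma measurable_fourier_bump (R : realType) (n m : nat) :
  measurable_fun setT (fun xi => complex.Re (fourier (bumpc m (0 : 'rV[R]_n)) xi)) /\
  measurable_fun setT (fun xi => complex.Im (fourier (bumpc m (0 : 'rV[R]_n)) xi)).
Proof.
have mdot : measurable_fun setT (fun z : 'rV[R]_n * 'rV[R]_n => - (2 * pi * dot z.2 z.1)).
  apply: measurableT_comp => //; apply: measurable_funM => //.
  apply: measurable_sum => i; apply: measurable_funM.
    by apply: (measurableT_comp (measurable_coord i)); exact: measurable_snd.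
  by apply: (measurableT_comp (measurable_coord i)); exact: measurable_fst.
have mb : measurable_fun setT (fun z : 'rV[R]_n * 'rV[R]_n => bumpv m (z.2 - 0)).
  apply: (measurableT_comp (f := fun y : 'rV[R]_n => bumpv m (y - 0))).
    exact: measurable_bumpv_shift.
  exact: measurable_snd.
split.
  under eq_fun do rewrite Re_cintegral.
  apply: (@measurable_Rintegral _ _ _ _ _ (leb n) (fun z =>
    complex.Re (expi (- (2 * pi * dot z.2 z.1)) * bumpc m 0 z.2))).
  under eq_fun do rewrite Re_mul/= mulr0 subr0.
  apply: measurable_funM => //; apply: measurableT_comp => //.
  by apply: continuous_measurable_fun; exact: continuous_cos.
under eq_fun do rewrite Im_cintegral.
apply: (@measurable_Rintegral _ _ _ _ _ (leb n) (fun z =>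
  complex.Im (expi (- (2 * pi * dot z.2 z.1)) * bumpc m 0 z.2))).
under eq_fun do rewrite Im_mul/= mulr0 add0r.
apply: measurable_funM => //; apply: measurableT_comp => //.
by apply: continuous_measurable_fun; exact: continuous_sin.
Qed.

Lemma ae_fst d1 d2 (X : measurableType d1) (Y : measurableType d2) (R : realType)
    (mu : {sigma_finite_measure set X -> \bar R})
    (nu : {sigma_finite_measure set Y -> \bar R}) (P : X -> Prop) :
  {ae mu, forall x, P x} -> {ae (mu \x nu)%E, forall z, P z.1}.
Proof.
move=> [N [mN N0 PN]]; exists (N `*` setT); split.
- exact: measurableX.
- rewrite (product_measure1E mu nu mN measurableT).
  by transitivity (mu N * nu setT)%E => //; rewrite N0 mul0e.
- by move=> z /= Pz; split => //; exact: PN.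
Qed.

Lemma ae_swap d1 d2 (X : measurableType d1) (Y : measurableType d2) (R : realType)
    (mu : {sigma_finite_measure set X -> \bar R})
    (nu : {sigma_finite_measure set Y -> \bar R}) (P : X * Y -> Prop) :
  {ae (mu \x nu)%E, forall z, P z} -> {ae (nu \x mu)%E, forall z, P (z.2, z.1)}.
Proof.
move=> [N [mN N0 PN]].
have ms : measurable_fun setT (fun z : Y * X => (z.2, z.1)).
  by apply/measurable_fun_pairP; split; [exact: measurable_snd|exact: measurable_fst].
set N' : set (Y * X) := (fun z : Y * X => (z.2, z.1)) @^-1` N.
have mN' : measurable N' by rewrite -[X in measurable X]setTI; exact: ms.
exists N'; split => //.
  have mf : measurable_fun [set: X * Y] (EFin \o \1_N : X * Y -> \bar R).
    by apply/measurable_EFinP; exact: measurable_indic.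
  have f0 z : (0 <= (EFin \o \1_N : X * Y -> \bar R) z)%E by rewrite lee_fin.
  have mg : measurable_fun [set: Y * X] (EFin \o \1_N' : Y * X -> \bar R).
    by apply/measurable_EFinP; exact: measurable_indic.
  have g0 z : (0 <= (EFin \o \1_N' : Y * X -> \bar R) z)%E by rewrite lee_fin.
  have := @fubini_tonelli1 _ _ _ _ _ nu mu _ mg g0; rewrite integral_indic// setIT => h1.
  apply: (etrans h1).
  have := @fubini_tonelli2 _ _ _ _ _ mu nu _ mf f0; rewrite integral_indic// setIT => h.
  have {}h := etrans (esym N0) h.
  by rewrite [RHS]h; apply: eq_integral => y _; apply: eq_integral => x _.
by move=> z /= Pz; exact: PN.
Qed.

(** * Nuclear operators on the wave packets *)

Lemma cmeasurable_representative d (T : measurableType d) (R : realType)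
    (mu : {measure set T -> \bar R}) (f : T -> R[i]) : cmeasurable mu f ->
  exists g : T -> R[i], [/\ measurable_fun setT (fun x => complex.Re (g x)),
    measurable_fun setT (fun x => complex.Im (g x)) & {ae mu, forall x, f x = g x}].
Proof.
move=> [/completed_measurable_representative[hr mr er]].
move=> /completed_measurable_representative[hi mi ei].
exists (fun x => Complex (hr x) (hi x)); split => //.
by move: er ei; apply: filterS2 => x rx ix; apply: complex_eq.
Qed.

(** Let W be the positive part of |F| - H, where H is the dominating series. For every m, W <= |F -
    sum_(k < m) c_k y_k| almost everywhere, so the L^p norm of W is below every remainder norm and
    thus 0. Where H is infinite, W vanishes by definition. *)
Lemma nuclear_pointwise d (T : measurableType d) (R : realType)
    (mu : {measure set T -> \bar R}) (p : R) (F : T -> R[i]^o) (y : nat -> T -> R[i]^o)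
    (c : nat -> R[i]) (Y : nat -> T -> R) :
  1 <= p -> cmeasurable mu F ->
  (forall k, measurable_fun setT (Y k)) -> (forall k x, 0 <= Y k x) ->
  (forall k, {ae mu, forall x, normc (y k x) = Y k x}) ->
  (Lp_norm mu p (F - \sum_(0 <= k < m) c k *: y k) @[m --> \oo] --> 0%E) ->
  {ae mu, forall x, (normc (F x))%:E <= \sum_(0 <= k <oo) (normc (c k) * Y k x)%:E}%E.
Proof.
move=> p1 /cmeasurable_representative[G [mGr mGi FG]] mY Y0 yY cv.
have p0 : 0 < p by rewrite (lt_le_trans ltr01).
pose g x : R := normc (G x).
have mg : measurable_fun setT g by exact: measurable_normc.
pose H x : \bar R := (\sum_(0 <= k <oo) (normc (c k) * Y k x)%:E)%E.
have t0 k x : (0 <= (normc (c k) * Y k x)%:E)%E by rewrite lee_fin mulr_ge0 ?normc_ge0.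
have H0 x : (0 <= H x)%E by apply: nneseries_ge0 => k _ _; exact: t0.
have mH : measurable_fun setT H.
  apply: ge0_emeasurable_sum => [k x _ _|k _]; first exact: t0.
  by apply/measurable_EFinP; exact: measurable_funM.
pose W x : \bar R := maxe 0%E ((g x)%:E - H x)%E.
have W0 x : (0 <= W x)%E by rewrite le_max lexx.
have mW : measurable_fun setT W.
  apply: measurable_maxe; first exact: measurable_cst.
  by apply: emeasurable_funB => //; exact/measurable_EFinP.
pose D m : T -> R[i]^o := F - \sum_(0 <= k < m) c k *: y k.
have yY' := ae_foralln yY.
have WD m : {ae mu, forall x, W x `^ p <= (normc (D m x) `^ p)%:E}%E.
  move: FG yY'; apply: filterS2 => x FGx yYx.
  rewrite -poweR_EFin; apply: ge0_ler_poweR => //; first exact: ltW.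
  rewrite ge_max lee_fin normc_ge0/=.
  have gD : ((g x)%:E <= (normc (D m x))%:E + H x)%E.
    apply: (@le_trans _ _ ((normc (D m x))%:E + \sum_(0 <= k < m) (normc (c k) * Y k x)%:E)%E).
      rewrite sumEFin -EFinD lee_fin /g -FGx.
      have -> : F x = D m x + \sum_(0 <= k < m) c k * y k x.
        by rewrite /D -[(F - _) x]/(F x - _ x) fct_sumE subrK.
      rewrite (le_trans (ler_normcD _ _))// lerD2l (le_trans (ler_normc_sum _ _ _))//.
      by apply: ler_sum => k _; rewrite normcM yYx.
    by apply: leeD => //; exact: nneseries_lim_ge.
  case: (H x) (H0 x) gD => [h| |] //=; last by rewrite leNye.
  by rewrite -EFinD -EFinB !lee_fin lerBlDr.
have NW m : ((\int[mu]_x (W x `^ p)) `^ p^-1 <= Lp_norm mu p (D m))%E.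
  rewrite /Lp_norm unlock/=.
  apply: ge0_ler_poweR; first by rewrite invr_ge0 ltW.
    by apply: integral_ge0 => x _; exact: poweR_ge0.
  apply: ae_le_integral => [x|x|]; [exact: poweR_ge0|by rewrite lee_fin powR_ge0|].
  apply: filterS (WD m) => x; rewrite /= ger0_norm ?normc_ge0//.
have N0 m : (0 <= Lp_norm mu p (D m))%E by exact: Lnorm_ge0.
have I0 : (0 <= \int[mu]_x (W x `^ p))%E by apply: integral_ge0 => x _; exact: poweR_ge0.
have IW : (\int[mu]_x (W x `^ p) = 0)%E.
  have : ((\int[mu]_x (W x `^ p)) `^ p^-1 <= 0)%E.
    apply/lee_addgt0Pr => eps eps0; rewrite add0e.
    have /(ge0_cvge0P N0)/(_ _ eps0)[m _ /(_ m (leqnn m))] := cv.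
    exact: le_trans.
  move=> h; have /poweR_eq0_eq0 := @le_anti _ _ (_ `^ _)%E 0%E (introT andP (conj h (poweR_ge0 _ _))).
  exact.
have : ae_eq mu setT (fun x => W x `^ p)%E (cst 0%E).
  apply/(ae_eq_integral_abs mu measurableT).
    exact: measurableT_comp (measurable_poweR p) mW.
  by under eq_integral do rewrite gee0_abs ?poweR_ge0//.
move: FG; apply: filterS2 => x FGx /(_ I)/= /(poweR_eq0_eq0 (W0 x)) Wx.
have : ((g x)%:E - H x <= 0)%E by rewrite -Wx le_max lexx orbT.
by rewrite sube_le0 ?fin_numE//= /g -FGx.
Qed.

Lemma cell_uniq (R : realType) (s j j' : nat) (x : R) : cell s j x -> cell s j' x -> j = j'.
Proof.
rewrite /cell /grid /= !in_itv/=; set S2 : R := s.+1%:R ^+ 2.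
have S20 : 0 < S2 by rewrite exprn_gt0// ltr0n.
have aux (k : nat) : (k%:R / S2 - s.+1%:R / 2 <= x < k%:R / S2 - s.+1%:R / 2 + S2^-1) ->
    k%:R <= (x + s.+1%:R / 2) * S2 < k.+1%:R.
  rewrite lerBlDr ler_pdivrMr// => /andP[-> /=] h.
  rewrite -ltr_pdivlMr// -[k.+1]addn1 natrD mulrDl mul1r.
  by rewrite -ltrBrDr addrAC.
move=> /aux/andP[h1 h2] /aux/andP[h3 h4].
have := le_lt_trans h1 h4; have := le_lt_trans h3 h2.
by rewrite !ltr_nat !ltnS => a b; apply/eqP; rewrite eqn_leq b a.
Qed.

Lemma cellv_select (R : realType) (n s : nat) (v : 'rV[R]_n) :
  (forall j : freq n s, cellv j v = 0) \/
  exists j0 : freq n s, forall j, cellv j v = (j == j0)%:R.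
Proof.
have cE (j : freq n s) : cellv j v != 0 -> forall i, cell s (j i) (v ord0 i).
  move=> /prodf_neq0 h i; have := h i isT.
  by rewrite indicE; have [/set_mem|_] := boolP (_ \in _); rewrite ?eqxx.
have [/forallP h|/forallPn[j0 hj0]] := boolP [forall j : freq n s, cellv j v == 0].
  by left => j; exact/eqP.
right; exists j0 => j; have [->|jj0] := eqVneq j j0.
  by rewrite /cellv big1// => i _; rewrite indicE mem_set//; exact: cE.
apply: contraNeq jj0 => hj; apply/eqP/ffunP => i; apply: val_inj => /=.
exact: cell_uniq (cE j hj i) (cE j0 hj0 i).
Qed.

(** At most one cell contains a given point, so the power acts on a single term of the sum. *)
Lemma integral_cellv_powR (R : realType) (n s : nat) (al : freq n s -> R) (q : R) : 0 < q ->
  (\int[leb n]_v ((\sum_j cellv j v * al j) `^ q)%:E =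
   ((s.+1%:R ^+ 2) ^- n * \sum_j al j `^ q)%:E)%E.
Proof.
move=> q0; transitivity (\int[leb n]_v (\sum_j (cellv j v * al j `^ q)%:E))%E.
  apply: eq_integral => v _; rewrite sumEFin; congr EFin.
  have [c0|[j0 cj]] := cellv_select s v.
    rewrite !big1 ?powR0 ?gt_eqF// => j _; by rewrite c0 mul0r.
  rewrite (bigD1 j0)//= (bigD1 (F := fun j => cellv j v * al j `^ q) j0)//=.
  by rewrite !big1 ?addr0 ?cj ?eqxx ?mul1r// => j /negbTE jj; rewrite cj jj mul0r.
have mc (j : freq n s) : measurable_fun setT (fun v : 'rV[R]_n => (cellv j v)%:E).
  by apply/measurable_EFinP; exact: measurable_cellv.
rewrite ge0_integral_sum//; last 2 first.
- by move=> j; apply/measurable_EFinP; apply: measurable_funM => //; exact: measurable_cellv.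
- by move=> j v _; rewrite lee_fin mulr_ge0 ?powR_ge0// cellv_ge0.
rewrite mulr_sumr -sumEFin; apply: eq_bigr => j _.
under eq_integral do rewrite EFinM.
rewrite ge0_integralZr//; last 2 first.
- by move=> v _; rewrite lee_fin cellv_ge0.
- by rewrite lee_fin powR_ge0.
by rewrite integral_cellv.
Qed.

(* Dominates |a(x, .)| after multiplication by |y_k(x)| and summation over k; the
   prefactor compensates the size (m+1)^-n of the Fourier transform of the bump. *)
Definition majorant (R : realType) (n m s : nat) (l : ('rV[R]_n -> R[i]^o) -> R[i])
    (xi : 'rV[R]_n) : R :=
  (fourier_lower R n)^-1 * m.+1%:R ^+ n *
    \sum_(j : freq n s) cellv j xi * ((s.+1%:R ^+ n)^-1 * normc (l (packet m j))).

Lemma majorant_ge0 (R : realType) (n m s : nat) (l : ('rV[R]_n -> R[i]^o) -> R[i])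
  (xi : 'rV[R]_n) : 0 <= majorant m s l xi.
Proof.
apply: mulr_ge0.
  by rewrite mulr_ge0 ?invr_ge0 ?exprn_ge0// ltW// fourier_lower_gt0.
apply: sumr_ge0 => j _; apply: mulr_ge0; first exact: cellv_ge0.
by rewrite mulr_ge0 ?invr_ge0 ?exprn_ge0 ?normc_ge0.
Qed.

Lemma measurable_majorant (R : realType) (n m s : nat) (l : ('rV[R]_n -> R[i]^o) -> R[i]) :
  measurable_fun setT (majorant m s l).
Proof.
apply: measurable_funM => //; apply: measurable_sum => j; apply: measurable_funM => //.
exact: measurable_cellv.
Qed.

Definition majorant_const (R : realType) (n : nat) (q : R) : R :=
  (fourier_lower R n)^-1 * (HY_const' q * (2 ^+ n) `^ (q - 1)) `^ q^-1.

(** The source of uniformity: with A = (s+1)^n and B = (m+1)^n, the exponents of A add up to -q - 2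
    + 3 + (q - 1) = 0 and those of B to q - (q - 1) - 1 = 0. *)
Lemma majorant_constE (R : realType) (n m s : nat) (q : R) : 2 <= q ->
  ((fourier_lower R n)^-1 * m.+1%:R ^+ n * (s.+1%:R ^+ n)^-1) `^ q *
    ((s.+1%:R ^+ 2) ^- n * @packet_const R n m q s) =
  majorant_const n q `^ q.
Proof.
move=> q2; have q0 : 0 < q by lra.
have f0 := fourier_lower_gt0 R n.
have fi0 : 0 <= (fourier_lower R n)^-1 by rewrite invr_ge0 ltW.
rewrite /majorant_const /packet_const.
rewrite natrX nfreqR.
set F := (fourier_lower R n)^-1.
have -> : ((2 * s.+1%:R / m.+1%:R) ^+ n : R) = 2 ^+ n * s.+1%:R ^+ n * (m.+1%:R ^+ n)^-1.
  by rewrite !exprMn exprVn.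
have -> : ((s.+1%:R ^+ 3) ^+ n : R) = (s.+1%:R ^+ n) ^+ 3 by rewrite -!exprM mulnC.
have -> : ((s.+1%:R ^+ 2) ^- n : R) = (s.+1%:R ^+ n) ^- 2 by rewrite -!exprM mulnC.
have A0 : 0 < (s.+1%:R ^+ n : R) by rewrite exprn_gt0// ltr0n.
have B0 : 0 < (m.+1%:R ^+ n : R) by rewrite exprn_gt0// ltr0n.
move: (s.+1%:R ^+ n) (m.+1%:R ^+ n) A0 B0 => A B A0 B0.
have T0 : 0 <= (2 ^+ n : R) by rewrite exprn_ge0.
set T := 2 ^+ n in T0 *; set H := HY_const' q; have H0 : 0 <= H by exact: HY_const'_ge0.
have inv (x r : R) : 0 < x -> x^-1 `^ r = (x `^ r)^-1.
  move=> x0; apply: (mulIf (lt0r_neq0 (powR_gt0 r x0))).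
  by rewrite mulVf ?gt_eqF ?powR_gt0// -powRM ?invr_ge0 ?ltW// mulVf ?gt_eqF// powR1.
have pred (x : R) : 0 < x -> x `^ q = x * x `^ (q - 1).
  move=> x0; rewrite [X in X * _](_ : x = x `^ 1); last by rewrite powRr1 ?ltW.
  by rewrite -powRD; [rewrite addrC subrK|rewrite (lt0r_neq0 x0) implybT].
rewrite [RHS]powRM ?powR_ge0// -powRrM mulVf ?gt_eqF// powRr1; last first.
  by rewrite mulr_ge0 ?powR_ge0.
have Ai : 0 <= A^-1 by rewrite invr_ge0 ltW.
have Bi : 0 <= B^-1 by rewrite invr_ge0 ltW.
rewrite [(F * B * A^-1) `^ q]powRM ?mulr_ge0 ?(ltW B0)// [(F * B) `^ q]powRM ?(ltW B0)//.
rewrite [(T * A * B^-1) `^ _]powRM ?mulr_ge0 ?(ltW A0)// [(T * A) `^ _]powRM ?(ltW A0)//.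
rewrite (inv A)// (inv B)// (pred A)// (pred B)//.
have a0 := powR_gt0 (q - 1) A0; have b0 := powR_gt0 (q - 1) B0.
move: (A `^ (q - 1)) (B `^ (q - 1)) (F `^ q) (T `^ (q - 1)) a0 b0 => a b f t a0 b0.
by field; rewrite !gt_eqF.
Qed.

Lemma Lnorm_majorant (R : realType) (n m s : nat) (p q : R)
    (l : ('rV[R]_n -> R[i]^o) -> R[i]) :
  2 <= q -> p^-1 + q^-1 = 1 -> (m <= s)%N ->
  dual (Lp (leb n) q) (Lp_norm (leb n) q) l ->
  ((\int[leb n]_xi ((majorant m s l xi)%:E `^ q)) `^ q^-1 <=
    (majorant_const n q * fine (dual_norm (Lp (leb n) q) (Lp_norm (leb n) q) l))%:E)%E.
Proof.
move=> q2 pq ms dl; have q0 : 0 < q by lra.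
have q1 : 1 <= q by lra.
set N := fine _; have [d0 _] := dual_norm_fin m q1 dl.
have N0 : 0 <= N by exact: fine_ge0.
have C0 : 0 <= majorant_const n q.
  by rewrite mulr_ge0 ?powR_ge0// invr_ge0 ltW// fourier_lower_gt0.
have -> : (majorant_const n q * N)%:E = (((majorant_const n q * N) `^ q)%:E `^ q^-1)%E.
  by rewrite poweR_EFin -powRrM mulfV ?gt_eqF// powRr1// mulr_ge0.
apply: ge0_ler_poweR; first by rewrite invr_ge0 ltW.
  by apply: integral_ge0 => xi _; exact: poweR_ge0.
set c := (fourier_lower R n)^-1 * m.+1%:R ^+ n * (s.+1%:R ^+ n)^-1.
have c0 : 0 <= c.
  by rewrite mulr_ge0 ?invr_ge0 ?exprn_ge0// mulr_ge0 ?invr_ge0 ?exprn_ge0// ltW// fourier_lower_gt0.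
rewrite (eq_integral (fun xi => ((\sum_(j : freq n s) cellv j xi * (c * normc (l (packet m j)))) `^ q)%:E)).
  rewrite integral_cellv_powR// lee_fin powRM// -(majorant_constE n m s q2) -/c.
  under eq_bigr do rewrite powRM ?normc_ge0//.
  rewrite -mulr_sumr.
  apply: (@le_trans _ _ ((s.+1%:R ^+ 2) ^- n * (c `^ q * (N `^ q * packet_const m q s)))).
    rewrite ler_wpM2l ?invr_ge0 ?exprn_ge0// ler_wpM2l ?powR_ge0//.
    exact: (dual_packet_le q1 dl q2 pq ms).
  apply: eq_leW; ring.
move=> xi _; rewrite poweR_EFin; congr (_ `^ _)%:E.
rewrite /majorant mulr_sumr; apply: eq_bigr => j _; rewrite /c; ring.
Qed.

(** * Pointwise recovery along a sequence of resolutions *)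

Lemma cvg0_of_nneseries (R : realType) (u : nat -> R) : (forall k, 0 <= u k) ->
  (\sum_(0 <= k <oo) (u k)%:E < +oo)%E -> u @ \oo --> 0.
Proof.
move=> u0 uoo; apply: cvg_series_cvg_0; apply: nondecreasing_is_cvgn.
  by apply: nondecreasing_series => k _ _.
have s0 : (0 <= \sum_(0 <= k <oo) (u k)%:E)%E by apply: nneseries_ge0 => k _ _; rewrite lee_fin.
exists (fine (\sum_(0 <= k <oo) (u k)%:E)%E) => _ [N _ <-].
rewrite -lee_fin fineK ?ge0_fin_numE// /series/= -sumEFin.
by apply: nneseries_lim_ge => k _ _; rewrite lee_fin.
Qed.

Lemma measurable_smear2 (R : realType) (n s : nat) (W : 'rV[R]_n * 'rV[R]_n -> R) :
  measurable_fun setT W ->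
  measurable_fun setT (fun z : 'rV[R]_n * 'rV[R]_n => smear s (fun u => W (z.1, u)) z.2).
Proof.
move=> mW; apply: measurable_sum => j; apply: measurable_funM.
  apply: (measurableT_comp (f := @cellv R n s j)); first exact: measurable_cellv.
  exact: measurable_snd.
apply: measurable_funM => //.
apply: (measurableT_comp (f := fun x : 'rV[R]_n => \int[leb n]_u (W (x, u) * fejer_kernel j u))).
  apply: (@measurable_Rintegral _ _ _ _ _ (leb n) (fun z => W z * fejer_kernel j z.2)).
  apply: measurable_funM => //.
  apply: (measurableT_comp (f := @fejer_kernel R n s j)); first exact: measurable_fejer_kernel.
  exact: measurable_snd.
exact: measurable_fst.
Qed.

Definition csmear (R : realType) (n s : nat) (g : 'rV[R]_n -> R[i]) (v : 'rV[R]_n) : R[i] :=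
  Complex (smear s (fun u => complex.Re (g u)) v) (smear s (fun u => complex.Im (g u)) v).

Lemma csmear_cvg (R : realType) (n r : nat) (g : 'rV[R]_n -> R[i]) : cint (leb n) g ->
  (\int[leb n]_(v in window r) (normc (csmear s g v - g v))%:E @[s --> \oo] --> 0)%E.
Proof.
move=> [ir ii].
have mW := @measurable_window R n r.
have /integrableP[/measurable_EFinP mr _] := ir.
have /integrableP[/measurable_EFinP mi _] := ii.
have cv : ((\int[leb n]_(v in window r)
      (`|smear s (fun u => complex.Re (g u)) v - complex.Re (g v)|)%:E) +
    (\int[leb n]_(v in window r)
      (`|smear s (fun u => complex.Im (g u)) v - complex.Im (g v)|)%:E) @[s --> \oo] --> 0)%E.
  by rewrite -[X in _ --> X](adde0 0%E); apply: cvgeD; [|exact: smear_cvg|exact: smear_cvg].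
apply: (squeeze_cvge _ (cvg_cst 0%E) cv).
near=> s; apply/andP; split; first by apply: integral_ge0 => v _; rewrite lee_fin normc_ge0.
have m (k : 'rV[R]_n -> R) : measurable_fun setT k ->
    measurable_fun (window r) (fun v => (`|smear s k v - k v|)%:E).
  move=> mk; apply/measurable_EFinP; apply: measurable_funTS; apply: measurableT_comp => //.
  by apply: measurable_funB => //; exact: measurable_smear.
rewrite -ge0_integralD//; [|exact: m|exact: m].
apply: ge0_le_integral => //.
- by move=> v _; rewrite lee_fin normc_ge0.
- apply/measurable_EFinP; apply: measurable_funTS; apply: measurable_normc.
    apply: (@eq_measurable_fun _ _ _ _ _ (fun v => smear s (fun u => complex.Re (g u)) v - complex.Re (g v))).
      by move=> v _; case: (g v).
    by apply: measurable_funB => //; exact: measurable_smear.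
  apply: (@eq_measurable_fun _ _ _ _ _ (fun v => smear s (fun u => complex.Im (g u)) v - complex.Im (g v))).
    by move=> v _; case: (g v).
  by apply: measurable_funB => //; exact: measurable_smear.
- by apply: emeasurable_funD; exact: m.
- by move=> v _; rewrite -EFinD lee_fin (le_trans (normc_le _))//; case: (g v).
Unshelve. all: by end_near. Qed.

(** For fixed m and almost every x the averages converge in L^1 on windows in xi; dominated
    convergence in x makes the truncated error integrable over the product with integral tending to
    0. Choosing [sg m] so that this integral is at most 2^-(m+1) makes the errors summable almost
    everywhere. The weight [beta m] is part of the error, so its growth is absorbed in the
    choice. *)
Lemma csmear_choice (R : realType) (n : nat) (W : nat -> 'rV[R]_n * 'rV[R]_n -> R[i])
    (beta : nat -> R) :
  (forall m, 0 <= beta m) ->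
  (forall m, measurable_fun setT (fun z => complex.Re (W m z))) ->
  (forall m, measurable_fun setT (fun z => complex.Im (W m z))) ->
  {ae leb n, forall x, forall m, cint (leb n) (fun u => W m (x, u))} ->
  exists sg : nat -> nat, (forall m, (m <= sg m)%N) /\
    {ae (leb n \x leb n)%E, forall z, 
      beta m * normc (csmear (sg m) (fun u => W m (z.1, u)) z.2 - W m z) @[m --> \oo] --> 0}.
Proof.
move=> b0 mr mi iW.
pose t m s z := beta m * normc (csmear s (fun u => W m (z.1, u)) z.2 - W m z).
have t0 m s z : 0 <= t m s z by rewrite mulr_ge0 ?normc_ge0.
have mn m s : measurable_fun setT (fun z =>
    normc (csmear s (fun u => W m (z.1, u)) z.2 - W m z)).
  apply: measurable_normc.
    apply: (@eq_measurable_fun _ _ _ _ _ (fun z : 'rV[R]_n * 'rV[R]_n =>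
      smear s (fun u => complex.Re (W m (z.1, u))) z.2 - complex.Re (W m z))).
      by move=> z _; rewrite /csmear; case: (W m z).
    apply: measurable_funB => //.
    exact: (measurable_smear2 s (mr m)).
  apply: (@eq_measurable_fun _ _ _ _ _ (fun z : 'rV[R]_n * 'rV[R]_n =>
    smear s (fun u => complex.Im (W m (z.1, u))) z.2 - complex.Im (W m z))).
    by move=> z _; rewrite /csmear; case: (W m z).
  apply: measurable_funB => //.
  exact: (measurable_smear2 s (mi m)).
have mt m s : measurable_fun setT (t m s) by exact: measurable_funM.
pose w m (x : 'rV[R]_n) : R := \1_(window m) x.
have mw m : measurable_fun setT (w m).
  by apply: measurable_indic; exact: measurable_window.
have w0 m x : 0 <= w m x by rewrite /w indicE.
have w1 m x : w m x <= 1 by rewrite /w indicE; case: (_ \in _).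
(* The integrals of W m in xi come with no bound in x. Truncation at 1 and the windows in both
   variables supply the dominating function; neither matters at a given point for large m. *)
pose D m s (z : 'rV[R]_n * 'rV[R]_n) := Num.min 1 (t m s z) * (w m z.1 * w m z.2).
have D0 m s z : 0 <= D m s z.
  by rewrite mulr_ge0 ?mulr_ge0// le_min ler01/=.
have mD m s : measurable_fun setT (D m s).
  apply: measurable_funM; first by apply: measurable_minr.
  apply: measurable_funM.
    by apply: (measurableT_comp (mw m)); exact: measurable_fst.
  by apply: (measurableT_comp (mw m)); exact: measurable_snd.
have mDE m s : measurable_fun setT (EFin \o D m s) by exact/measurable_EFinP.
have DE0 m s z : (0 <= (EFin \o D m s) z)%E by rewrite lee_fin.
have ID m : (\int[(leb n \x leb n)%E]_z (D m s z)%:E @[s --> \oo] --> 0)%E.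
  pose f_ s x : \bar R := fubini_F (leb n) (EFin \o D m s) x.
  rewrite (_ : (fun s => _) = (fun s => \int[leb n]_x f_ s x)%E); last first.
    apply/funext => s.
    exact: (fubini_tonelli1 (m1 := leb n) (m2 := leb n) _ (mDE m s) (DE0 m s)).
  have f0 s x : (0 <= f_ s x)%E by apply: integral_ge0 => y _; exact: DE0.
  have mf s : measurable_fun setT (f_ s).
    exact: (measurable_fun_fubini_tonelli_F _ (mDE m s) (DE0 m s)).
  have lw := lebesgue_window R n m.
  have lwf : leb n (@window R n m) \is a fin_num by rewrite ge0_fin_numE.
  pose g x : R := fine (leb n (@window R n m)) * w m x.
  have ig : (leb n).-integrable setT (EFin \o g).
    have iw := integrable_setbox (@measurable_window R n m) lw.
    by have := integrableZl measurableT (fine (leb n (@window R n m))) iw.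
  have fg s x : (f_ s x <= (g x)%:E)%E.
    apply: (@le_trans _ _ (\int[leb n]_u ((w m x)%:E * (w m u)%:E))%E).
      apply: ge0_le_integral => //.
      - exact: measurableT_comp (mDE m s) (measurable_pair1 x).
      - by apply/measurable_EFinP; apply: measurable_funM => //.
      - move=> u _; rewrite /= -EFinM lee_fin /D ler_piMl ?mulr_ge0//.
        by rewrite ge_min lexx.
    rewrite ge0_integralZl//; last 3 first.
    - by apply/measurable_EFinP.
    - by move=> u _; rewrite lee_fin.
    - by rewrite lee_fin.
    rewrite integral_indic//; last exact: measurable_window.
    by rewrite setIT /g muleC EFinM fineK.
  have cf : {ae leb n, forall x, setT x -> f_ ^~ x @ \oo --> (cst 0%E : 'rV[R]_n -> \bar R) x}.
    apply: filterS iW => x /(_ m) iWx _.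
    have := cvgeZl _ (csmear_cvg m iWx) => /(_ (beta m)%:E isT); rewrite mule0 => cv.
    apply: (squeeze_cvge _ (cvg_cst 0%E) cv).
    near=> s; rewrite f0/=.
    have mWm := @measurable_window R n m.
    have mk : measurable_fun setT (fun u => t m s (x, u)).
      exact: measurableT_comp (mt m s) (measurable_pair1 x).
    have mc : measurable_fun (window m) (fun v =>
        (normc (csmear s (fun u => W m (x, u)) v - W m (x, v)))%:E).
      apply/measurable_EFinP; apply: measurable_funTS.
      exact: measurableT_comp (mn m s) (measurable_pair1 x).
    have -> : ((beta m)%:E * \int[leb n]_(v in window m)
        (normc (csmear s (fun u => W m (x, u)) v - W m (x, v)))%:E =
        \int[leb n]_u (t m s (x, u) * w m u)%:E)%E.
      rewrite -ge0_integralZl//; last 2 first.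
      - by move=> u _; rewrite lee_fin normc_ge0.
      - by rewrite lee_fin.
      rewrite integral_mkcond; apply: eq_integral => u _; rewrite patchE /w indicE.
      by case: ifP => _; rewrite ?mulr1 ?mulr0.
    apply: ge0_le_integral => //.
    - exact: measurableT_comp (mDE m s) (measurable_pair1 x).
    - by apply/measurable_EFinP; exact: measurable_funM.
    - move=> u _; rewrite lee_fin /D /= mulrA ler_wpM2r//.
      apply: (@le_trans _ _ (Num.min 1 (t m s (x, u)))); last by rewrite ge_min lexx orbT.
      by apply: ler_piMr => //; rewrite le_min ler01/=.
  have fb : {ae leb n, forall x s, setT x -> `|f_ s x| <= (EFin \o g) x}%E.
    by apply: aeW => x s _; rewrite gee0_abs.
  have [_ _] := dominated_convergence measurableT mf (measurable_cst _) cf ig fb.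
  by rewrite integral0.
have ID0 m s : (0 <= \int[(leb n \x leb n)%E]_z (D m s z)%:E)%E.
  by apply: integral_ge0 => z _; exact: DE0.
have : forall m, exists s, (m <= s)%N /\
    (\int[(leb n \x leb n)%E]_z (D m s z)%:E <= (1 / (2 ^ m.+1)%:R)%:E)%E.
  move=> m; have e0 : 0 < 1 / (2 ^ m.+1)%:R :> R by rewrite divr_gt0// ltr0n expn_gt0.
  have /(ge0_cvge0P (ID0 m))/(_ _ e0)[N _ hN] := ID m.
  exists (maxn m N); split; first exact: leq_maxl.
  by apply: hN; exact: leq_maxr.
move=> /choice[sg hsg]; exists sg; split; first by move=> m; case: (hsg m).
have IS : (\int[(leb n \x leb n)%E]_z (\sum_(0 <= m <oo) (D m (sg m) z)%:E) < +oo)%E.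
  have -> : (\int[(leb n \x leb n)%E]_z (\sum_(0 <= m <oo) (D m (sg m) z)%:E) =
      \sum_(0 <= m <oo) \int[(leb n \x leb n)%E]_z (D m (sg m) z)%:E)%E.
    exact: (integral_nneseries _ measurableT (fun m => mDE m (sg m)) (fun m z _ => DE0 m (sg m) z)).
  apply: (@le_lt_trans _ _ 1%:E); last exact: ltry.
  apply: le_trans (epsilon_trick0 xpredT ler01).
  apply: lee_nneseries => m _; first by move=> _; exact: ID0.
  by case: (hsg m).
have S0 z : (0 <= \sum_(0 <= m <oo) (D m (sg m) z)%:E)%E.
  by apply: nneseries_ge0 => m _ _; exact: DE0.
have iS : (leb n \x leb n)%E.-integrable setT (fun z => \sum_(0 <= m <oo) (D m (sg m) z)%:E)%E.
  apply/integrableP; split.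
    by apply: ge0_emeasurable_sum => m *; [exact: DE0|exact: mDE].
  by under eq_integral do rewrite gee0_abs//.
apply: filterS (integrable_ae measurableT iS) => z /(_ I) Sz.
have Dz : D m (sg m) z @[m --> \oo] --> 0.
  by apply: (cvg0_of_nneseries (fun m => D0 m (sg m) z)); rewrite -ge0_fin_numE.
apply/cvgrPdist_le => eps eps0.
(* Below 1/2 the truncation at 1 is inactive, so smallness of D gives smallness of the error
   itself. *)
have e1 : 0 < Num.min (2^-1) eps by rewrite lt_min invr_gt0 ltr0n.
have /cvgrPdist_le/(_ _ e1) De := Dz.
near=> m; rewrite sub0r normrN ger0_norm ?t0//.
have : `|0 - D m (sg m) z| <= Num.min (2^-1) eps by near: m.
rewrite sub0r normrN ger0_norm ?D0// /D.
have -> : w m z.1 = 1.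
  by rewrite /w indicE mem_set//; near: m; exact: bigcup_window.
have -> : w m z.2 = 1.
  by rewrite /w indicE mem_set//; near: m; exact: bigcup_window.
rewrite !mulr1 le_min !ge_min => /andP[h1 h2].
have h3 : t m (sg m) z <= 2^-1.
  by case/orP: h1 => // h1; exfalso; move: h1; rewrite leNgt invf_lt1 ?ltr1n ?ltr0n.
case/orP: h2 => // h2; apply: le_trans h2; apply: (le_trans h3).
by rewrite invf_le1 ?ltr0n// ler1n.
Unshelve. all: by end_near. Qed.

Lemma le_limn_einf (R : realType) (x : R) (u : (\bar R)^nat) :
  (forall eps : R, 0 < eps -> \forall m \near \oo, (x%:E <= u m + eps%:E)%E) ->
  (x%:E <= limn_einf u)%E.
Proof.
move=> h; apply/lee_addgt0Pr => eps eps0; have [N _ hN] := h _ eps0.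
rewrite -leeBlDr//.
rewrite limn_einf_lim (cvg_lim _ (ereal_nondecreasing_cvgn (@nondecreasing_einfs _ u)))//.
apply: (@le_trans _ _ (einfs u N)); last by apply: ereal_sup_ubound; exists N.
apply: le_ereal_inf_tmp => _ [k /= Nk <-].
by have := hN k Nk; rewrite -leeBlDr.
Qed.

(** * Domination of the symbol *)

Lemma symbol_representative (R : realType) (n : nat)
    (a : 'rV[R]_n -> 'rV[R]_n -> R[i]) (phi : 'rV[R]_n -> 'rV[R]_n -> R) :
  cmeasurable (leb n \x leb n)%E (fun z => a z.1 z.2) ->
  completed_measurable_fun (leb n \x leb n)%E (fun z => phi z.1 z.2) ->
  exists A : 'rV[R]_n * 'rV[R]_n -> R[i], [/\
    measurable_fun setT (fun z => complex.Re (A z)),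
    measurable_fun setT (fun z => complex.Im (A z)) &
    {ae (leb n \x leb n)%E, forall z, expi (phi z.1 z.2) * a z.1 z.2 = A z}].
Proof.
move=> /cmeasurable_representative[b [br bi ab]].
move=> /completed_measurable_representative[ph mph phE].
have mc : measurable_fun setT (fun z => cos (ph z)).
  apply: (@measurableT_comp _ _ _ _ _ _ (@cos R)) => //.
  by apply: continuous_measurable_fun; exact: continuous_cos.
have ms : measurable_fun setT (fun z => sin (ph z)).
  apply: (@measurableT_comp _ _ _ _ _ _ (@sin R)) => //.
  by apply: continuous_measurable_fun; exact: continuous_sin.
exists (fun z => expi (ph z) * b z); split.
- under eq_fun do rewrite Re_mul/=.
  by apply: measurable_funB; exact: measurable_funM.
- under eq_fun do rewrite Im_mul/=.
  by apply: measurable_funD; exact: measurable_funM.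
- by move: ab phE; apply: filterS2 => z -> ->.
Qed.

(** The Fourier transform of a packet is that of the bump times a real kernel, which multiplies real
    and imaginary parts separately. The equality with W holds almost everywhere and is transferred
    to the integrals. *)
Lemma fio_packet (R : realType) (n m s : nat) (phi : 'rV[R]_n -> 'rV[R]_n -> R)
    (a : 'rV[R]_n -> 'rV[R]_n -> R[i]) (x : 'rV[R]_n) (W : 'rV[R]_n -> R[i])
    (j : freq n s) :
  {ae leb n, forall xi, fio_integrand phi a (bumpc m 0) x xi = W xi} ->
  fio phi a (packet m j) x =
  Complex (\int[leb n]_u (complex.Re (W u) * fejer_kernel j u))
          (\int[leb n]_u (complex.Im (W u) * fejer_kernel j u)).
Proof.
move=> aW; apply: complex_eq; rewrite /fio ?Re_cintegral ?Im_cintegral /Rintegral;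
  congr fine; apply: ae_eq_integral_nonmeasurable; apply: filterS aW => xi aWx;
  rewrite /= -aWx /fio_integrand fourier_packet mulrCA; congr EFin.
  by rewrite Re_mul/= mul0r subr0 mulrC.
by rewrite Im_mul/= mul0r addr0 mulrC.
Qed.

(** The link between operator and averaging: for fixed x, averaging W over the grid is a combination
    of the values at x of F on the packets, to which the nuclear series applies. *)
Lemma csmear_fio (R : realType) (n m s : nat) (phi : 'rV[R]_n -> 'rV[R]_n -> R)
    (a : 'rV[R]_n -> 'rV[R]_n -> R[i]) (x : 'rV[R]_n) (W : 'rV[R]_n -> R[i])
    (xi : 'rV[R]_n) :
  {ae leb n, forall xi, fio_integrand phi a (bumpc m 0) x xi = W xi} ->
  csmear s W xi = \sum_(j : freq n s)
    (cellv j xi * (s.+1%:R ^+ n)^-1)%:C%C * fio phi a (packet m j) x.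
Proof.
move=> aW; under eq_bigr do rewrite (fio_packet _ aW).
apply: complex_eq; rewrite ?Re_sum ?Im_sum /=; apply: eq_bigr => j _ /=.
  by rewrite mul0r subr0 mulrA.
by rewrite mul0r addr0 mulrA.
Qed.

Lemma test_function_bumpc (R : realType) (n m : nat) : test_function (bumpc m (0 : 'rV[R]_n)).
Proof.
rewrite (_ : bumpc _ _ = csum m (fun _ : 'I_1 => 1) (fun=> 0)); first exact: test_function_csum.
by apply/funext => y; rewrite /csum big_ord1 mul1r.
Qed.

Lemma cint_of_cintegrable d (T : measurableType d) (R : realType)
    (mu : {measure set T -> \bar R}) (f g : T -> R[i]) :
  measurable_fun setT (fun x => complex.Re (g x)) ->
  measurable_fun setT (fun x => complex.Im (g x)) ->
  {ae mu, forall x, f x = g x} -> (\int[mu]_x (normc (f x))%:E < +oo)%E -> cint mu g.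
Proof.
move=> mr mi fg foo.
have ng : mu.-integrable setT (fun x => (normc (g x))%:E).
  apply/integrableP; split; first by apply/measurable_EFinP; exact: measurable_normc.
  apply: le_lt_trans foo; apply: eq_leW.
  apply: ae_eq_integral_nonmeasurable; apply: filterS fg => x ->.
  by rewrite gee0_abs// lee_fin normc_ge0.
split; apply: (le_integrable _ _ _ ng) => //.
- exact/measurable_EFinP.
- by move=> x _; rewrite /= lee_fin [leRHS]ger0_norm ?normc_ge0// normr_Re_le.
- exact/measurable_EFinP.
- by move=> x _; rewrite /= lee_fin [leRHS]ger0_norm ?normc_ge0// normr_Im_le.
Qed.

(** Everything the two mixed norms require: [h m k] is the majorant of e'_k at scale m and
    resolution [sg m], [Y k] a Borel version of |y_k|, and the bounds [al k], [be k] do not depend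
    on m, with a summable product inherited from nuclearity. *)
Lemma nuclear_domination (R : realType) (n : nat)
    (a : 'rV[R]_n -> 'rV[R]_n -> R[i]) (phi : 'rV[R]_n -> 'rV[R]_n -> R) (p1 p2 : R) :
  cmeasurable (leb n \x leb n)%E (fun z => a z.1 z.2) ->
  completed_measurable_fun (leb n \x leb n)%E (fun z => phi z.1 z.2) ->
  2 <= p1 -> 1 <= p2 -> nuclear_fio phi a p1 p2 ->
  exists (h : nat -> nat -> 'rV[R]_n -> R) (Y : nat -> 'rV[R]_n -> R) (al be : nat -> R),
    [/\ (forall m k, measurable_fun setT (h m k)) /\ (forall m k xi, 0 <= h m k xi),
        (forall k, measurable_fun setT (Y k)) /\ (forall k x, 0 <= Y k x),
        [/\ forall k, 0 <= al k, forall k, 0 <= be k &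
            (\sum_(0 <= k <oo) (al k * be k)%:E < +oo)%E],
        (forall m k, ((\int[leb n]_xi ((h m k xi)%:E `^ p1)) `^ p1^-1 <= (al k)%:E)%E) /\
        (forall k, ((\int[leb n]_x ((Y k x)%:E `^ p2)) `^ p2^-1 <= (be k)%:E)%E) &
        {ae (leb n \x leb n)%E, forall z, ((normc (a z.1 z.2))%:E <=
          limn_einf (fun m => \sum_(0 <= k <oo) (h m k z.2 * Y k z.1)%:E))%E}].
Proof.
move=> ma mphi p12 p21 [wd [E2T [e' [y [de Ey sumoo cv]]]]].
have p11 : 1 <= p1 by apply: le_trans p12; rewrite ler1n.
have p10 : 0 < p1 by rewrite (lt_le_trans ltr01).
have p20 : 0 < p2 by rewrite (lt_le_trans ltr01).
pose p := (1 - p1^-1)^-1.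
have pq : p^-1 + p1^-1 = 1 by rewrite /p invrK subrK.
have [A [mAr mAi aA]] := symbol_representative ma mphi.
have /choice[Yc hYc] : forall k, exists g : 'rV[R]_n -> R[i],
    [/\ measurable_fun setT (fun x => complex.Re (g x)),
      measurable_fun setT (fun x => complex.Im (g x)) & {ae leb n, forall x, y k x = g x}].
  by move=> k; apply: cmeasurable_representative; case: (Ey k).
pose Y k x := normc (Yc k x).
have mY k : measurable_fun setT (Y k) by have [? ? _] := hYc k; exact: measurable_normc.
have Y0 k x : 0 <= Y k x by exact: normc_ge0.
have yY k : {ae leb n, forall x, normc (y k x) = Y k x}.
  by have [_ _] := hYc k; apply: filterS => x; rewrite /Y => ->.
pose dn k := dual_norm (Lp (leb n) p1) (Lp_norm (leb n) p1) (e' k).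
have dnP k : (0 <= dn k)%E /\ dn k \is a fin_num := dual_norm_fin 0 p11 (de k).
have N0 k : (0 <= Lp_norm (leb n) p2 (y k))%E by exact: Lnorm_ge0.
have Nfin k : Lp_norm (leb n) p2 (y k) \is a fin_num.
  by rewrite ge0_fin_numE//; case: (Ey k).
pose be k := fine (Lp_norm (leb n) p2 (y k)).
have C0 : 0 <= majorant_const n p1.
  by rewrite mulr_ge0 ?powR_ge0// invr_ge0 ltW// fourier_lower_gt0.
pose W m z : R[i] := A z * fourier (bumpc m (0 : 'rV[R]_n)) z.2.
have mWr m : measurable_fun setT (fun z => complex.Re (W m z)).
  have [fr fi] := measurable_fourier_bump R n m.
  under eq_fun do rewrite Re_mul.
  apply: measurable_funB; apply: measurable_funM => //.
    by apply: (measurableT_comp fr); exact: measurable_snd.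
  by apply: (measurableT_comp fi); exact: measurable_snd.
have mWi m : measurable_fun setT (fun z => complex.Im (W m z)).
  have [fr fi] := measurable_fourier_bump R n m.
  under eq_fun do rewrite Im_mul.
  apply: measurable_funD; apply: measurable_funM => //.
    by apply: (measurableT_comp fi); exact: measurable_snd.
  by apply: (measurableT_comp fr); exact: measurable_snd.
have aW : {ae leb n, forall x, forall m,
    {ae leb n, forall xi, fio_integrand phi a (bumpc m 0) x xi = W m (x, xi)}}.
  apply: filterS (ae_product_section1 aA) => x aAx m.
  by apply: filterS aAx => xi /= aAx; rewrite /fio_integrand /W aAx.
have iW : {ae leb n, forall x, forall m, cint (leb n) (fun u => W m (x, u))}.
  have wd' : {ae leb n, forall x, forall m,
      cintegrable (leb n) (fio_integrand phi a (bumpc m 0) x)}.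
    by apply: ae_foralln => m; apply: wd; exact: test_function_bumpc.
  move: aW wd'; apply: filterS2 => x aWx wdx m.
  have [_ foo] := wdx m.
  apply: cint_of_cintegrable (aWx m) foo.
    exact: measurableT_comp (mWr m) (measurable_pair1 x).
  exact: measurableT_comp (mWi m) (measurable_pair1 x).
(* By [fourier_bump_ge] this factor makes |A| <= beta m |W m| at each point for large m. *)
pose beta m : R := (fourier_lower R n)^-1 * m.+1%:R ^+ n.
have fl0 := fourier_lower_gt0 R n.
have beta0 m : 0 <= beta m by rewrite mulr_ge0 ?exprn_ge0// invr_ge0 ltW.
have [sg [msg cvW]] := csmear_choice beta0 mWr mWi iW.
have dom : {ae leb n, forall x, forall m (j : freq n (sg m)),
    ((normc (fio phi a (packet m j) x))%:E <=
      \sum_(0 <= k <oo) (normc (e' k (packet m j)) * Y k x)%:E)%E}.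
  apply: ae_foralln => m; apply: filter_forall => j.
  have tj : test_function (@packet R n m (sg m) j) by exact: test_function_csum.
  apply: (nuclear_pointwise p21 _ mY Y0 yY (cv _ tj)).
  by case: (E2T _ tj).
pose h m k := majorant m (sg m) (e' k).
have h0 m k xi : 0 <= h m k xi by exact: majorant_ge0.
have dom2 : {ae leb n, forall x, forall m xi,
    ((beta m * normc (csmear (sg m) (fun u => W m (x, u)) xi))%:E <=
      \sum_(0 <= k <oo) (h m k xi * Y k x)%:E)%E}.
  move: aW dom; apply: filterS2 => x aWx domx m xi.
  rewrite (csmear_fio _ _ (aWx m)).
  pose w (j : freq n (sg m)) : R := beta m * (cellv j xi * ((sg m).+1%:R ^+ n)^-1).
  have cw0 (j : freq n (sg m)) : 0 <= cellv j xi * ((sg m).+1%:R ^+ n)^-1 :> R.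
    by rewrite mulr_ge0 ?cellv_ge0// invr_ge0 exprn_ge0.
  have w0 j : 0 <= w j by rewrite mulr_ge0.
  apply: (@le_trans _ _ (\sum_j (w j)%:E * (normc (fio phi a (packet m j) x))%:E)%E).
    have -> : (\sum_j (w j)%:E * (normc (fio phi a (packet m j) x))%:E =
        (\sum_j w j * normc (fio phi a (packet m j) x))%:E)%E.
      by rewrite -sumEFin; apply: eq_bigr => j _; rewrite EFinM.
    rewrite lee_fin.
    apply: (@le_trans _ _ (beta m * \sum_(j : freq n (sg m))
        (cellv j xi * ((sg m).+1%:R ^+ n)^-1) * normc (fio phi a (packet m j) x))).
      rewrite ler_wpM2l// (le_trans (ler_normc_sum _ _ _))//.
      by apply: ler_sum => j _; rewrite normc_realM.
    rewrite mulr_sumr; apply: eq_leW.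
    by apply: eq_bigr => j _; rewrite mulrA.
  apply: (@le_trans _ _ (\sum_j (w j)%:E *
      \sum_(0 <= k <oo) (normc (e' k (packet m j)) * Y k x)%:E)%E).
    by apply: lee_sum => j _; apply: lee_wpmul2l; rewrite ?lee_fin.
  (* The finite sum over the cells is moved inside the series over k, where it forms the majorant of
     e'_k. *)
  rewrite (eq_bigr (fun j => \sum_(0 <= k <oo)
      ((w j)%:E * (normc (e' k (packet m j)) * Y k x)%:E))%E); last first.
    by move=> j _; rewrite nneseriesZl// => k _; rewrite lee_fin mulr_ge0 ?normc_ge0.
  rewrite -nneseries_sum; last first.
    by move=> j k _; rewrite -EFinM lee_fin mulr_ge0// mulr_ge0 ?normc_ge0.
  apply: lee_nneseries => [k _ _|k _].
    by apply: sume_ge0 => j _; rewrite -EFinM lee_fin mulr_ge0// mulr_ge0 ?normc_ge0.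
  under eq_bigr do rewrite -EFinM.
  rewrite sumEFin lee_fin /h /majorant -/(beta m) mulr_sumr mulr_suml.
  apply: eq_leW; apply: eq_bigr => j _.
  by rewrite /w -!mulrA.
exists h, Y, (fun k => majorant_const n p1 * fine (dn k)), be; split.
- by split=> // m k; exact: measurable_majorant.
- by [].
- split=> [k|k|].
  + by rewrite mulr_ge0// fine_ge0//; case: (dnP k).
  + exact: fine_ge0.
  + rewrite (eq_eseriesr (g := fun k =>
        ((majorant_const n p1)%:E * (dn k * Lp_norm (leb n) p2 (y k)))%E)); last first.
      by move=> k _; have [_ dk] := dnP k; rewrite -mulrA !EFinM !fineK.
    rewrite nneseriesZl => [|k _]; last by rewrite mule_ge0//; case: (dnP k).
    by rewrite lte_mul_pinfty// lee_fin.
- split=> [m k|k]; first exact: (Lnorm_majorant p12 pq (msg m) (de k)).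
  rewrite /be fineK// /Lp_norm unlock/=; apply: eq_leW.
  congr poweR; apply: ae_eq_integral_nonmeasurable; apply: filterS (yY k) => x <-.
  by rewrite /= ger0_norm ?normc_ge0.
- have dom3 := ae_fst (leb n) dom2.
  apply: filterS3 aA cvW dom3 => z aAz cz domz.
  have -> : normc (a z.1 z.2) = normc (A z) by rewrite -aAz normcM normc_expi mul1r.
  apply: le_limn_einf => eps eps0.
  move/cvgrPdist_le : cz => /(_ _ eps0) cz.
  near=> m.
  have hm : beta m * normc (csmear (sg m) (fun u => W m (z.1, u)) z.2 - W m z) <= eps.
    have : `|0 - beta m * normc (csmear (sg m) (fun u => W m (z.1, u)) z.2 - W m z)| <= eps.
      by near: m.
    by rewrite sub0r normrN ger0_norm// mulr_ge0 ?normc_ge0.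
  have lm : fourier_lower R n <= m.+1%:R ^+ n * normc (fourier (bumpc m (0 : 'rV[R]_n)) z.2).
    by near: m; exact: fourier_bump_ge.
  (* Replace |A| by beta m |W m|, then W m by its average, at a cost of at most eps through [hm]. *)
  apply: (@le_trans _ _ (beta m * normc (csmear (sg m) (fun u => W m (z.1, u)) z.2) + eps)%:E).
    rewrite lee_fin.
    apply: (@le_trans _ _ (beta m * normc (W m z))).
      rewrite /W normcM /beta mulrCA ler_peMr ?normc_ge0//.
      by rewrite -mulrA mulrC ler_pdivlMr// mul1r.
    rewrite -lerBlDl; apply: le_trans hm; rewrite -mulrBr ler_wpM2l//.
    rewrite lerBlDl.
    set u := csmear _ _ _; set v := W m z.
    rewrite [X in normc X <= _](_ : v = u + (v - u)); last by rewrite addrC subrK.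
    by rewrite (le_trans (ler_normcD _ _))// lerD2l -(opprB u v) normcN.
  by rewrite EFinD; apply: leeD.
Unshelve. all: by end_near. Qed.

Theorem theorem1p2 (R : realType) (n : nat)
    (a : 'rV[R]_n -> 'rV[R]_n -> R[i]) (phi : 'rV[R]_n -> 'rV[R]_n -> R)
    (p1 p2 : R)
    (a_measurable : cmeasurable (lebesgue_rV n \x lebesgue_rV n)%E
       (fun z => a z.1 z.2))
    (phi_measurable : completed_measurable_fun (lebesgue_rV n \x lebesgue_rV n)%E
       (fun z => phi z.1 z.2))
    (a_loc : {ae lebesgue_rV n, forall x, locally_cintegrable (a x)})
    (hp1 : 2 <= p1) (hp2 : 1 <= p2)
    (F_nuclear : nuclear_fio phi a p1 p2) :
  ((\int[lebesgue_rV n]_xi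
      (\int[lebesgue_rV n]_x (ComplexField.Normc.normc (a x xi) `^ p2)%R%:E)
        `^ (p1 / p2)) `^ p1^-1 < +oo)%E /\
  ((\int[lebesgue_rV n]_x
      (\int[lebesgue_rV n]_xi (ComplexField.Normc.normc (a x xi) `^ p1)%R%:E)
        `^ (p2 / p1)) `^ p2^-1 < +oo)%E.
Proof.
have p11 : 1 <= p1 by apply: le_trans hp1; rewrite ler1n.
have p10 : 0 < p1 by rewrite (lt_le_trans ltr01).
have p20 : 0 < p2 by rewrite (lt_le_trans ltr01).
have [h [Y [al [be [[mh h0] [mY Y0] [al0 be0 aboo] [hal Ybe] dom]]]]] :=
  nuclear_domination a_measurable phi_measurable hp1 hp2 F_nuclear.
have mser (f g : nat -> 'rV[R]_n -> R) :
    (forall k, measurable_fun setT (f k)) -> (forall k, measurable_fun setT (g k)) ->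
    (forall k x, 0 <= f k x) -> (forall k x, 0 <= g k x) ->
    measurable_fun setT (fun z : 'rV[R]_n * 'rV[R]_n =>
      \sum_(0 <= k <oo) (f k z.1 * g k z.2)%:E)%E.
  move=> mf mg f0 g0; apply: ge0_emeasurable_sum => [k z _ _|k _].
    by rewrite lee_fin mulr_ge0.
  apply/measurable_EFinP; apply: measurable_funM.
    by apply: (measurableT_comp (mf k)); exact: measurable_fst.
  by apply: (measurableT_comp (mg k)); exact: measurable_snd.
have ser0 (f g : nat -> 'rV[R]_n -> R) (z : 'rV[R]_n * 'rV[R]_n) :
    (forall k x, 0 <= f k x) -> (forall k x, 0 <= g k x) ->
    (0 <= \sum_(0 <= k <oo) (f k z.1 * g k z.2)%:E)%E.
  by move=> f0 g0; apply: nneseries_ge0 => k _ _; rewrite lee_fin mulr_ge0.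
(* The outer root preserves finiteness, so it is enough to bound [mixed], which carries none. *)
split; rewrite poweR_lty//.
- have baoo : (\sum_(0 <= k <oo) (be k * al k)%:E < +oo)%E.
    by rewrite (eq_eseriesr (g := fun k => (al k * be k)%:E)) // => k _; rewrite mulrC.
  apply: le_lt_trans (poweR_lty p1 baoo).
  apply: (@mixed_liminf _ _ _ _ R (leb n) (leb n) p2 p1
    (fun z => (normc (a z.1 z.2))%:E)
    (fun m z => \sum_(0 <= k <oo) (Y k z.1 * h m k z.2)%:E)%E) => //.
  + by move=> z; rewrite lee_fin normc_ge0.
  + by move=> m z; exact: ser0.
  + by move=> m; exact: mser.
  + apply: filterS dom => z; congr (_ <= limn_einf _)%E.
    by apply/funext => m; apply: eq_eseriesr => k _; rewrite mulrC.
  + by move=> m; exact: mixed_series.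
(* The inner variable is now xi, so the two coordinates are exchanged, also in the almost-everywhere
   bound. *)
- apply: le_lt_trans (poweR_lty p2 aboo).
  apply: (@mixed_liminf _ _ _ _ R (leb n) (leb n) p1 p2
    (fun z => (normc (a z.2 z.1))%:E)
    (fun m z => \sum_(0 <= k <oo) (h m k z.1 * Y k z.2)%:E)%E) => //.
  + by move=> z; rewrite lee_fin normc_ge0.
  + by move=> m z; exact: ser0.
  + by move=> m; exact: mser.
  + exact: (ae_swap dom).
  + by move=> m; exact: mixed_series.
Qed.
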